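(* Let $\mathbb G=\mathbb G(2n,m,\mathbb U)$ be a generalized Heisenberg-type group normalized as in the context, with Carnot–Carathéodory distance $d$ from $o$, and write $x=(\widetilde x_1,\dots,\widetilde x_{l_0})\in\mathbb R^{2k_1}\times\cdots\times\mathbb R^{2k_{l_0}}$. Then: (1) $\mathbb M=\{(x,t):\ \widetilde x_{l_0}\neq0,\ \text{or}\ \widetilde x_{l_0}=0\ \text{and}\ 4|t|<\sum_{j=1}^{l_0-1}\widetilde a_j|\widetilde x_j|^2\mu(\widetilde a_j\pi)\}$. For $g=(x,t)\in\mathbb M$ there is a unique $\theta=\theta(g)\in B_{\mathbb R^m}(0,\pi)$ such that $$4t=\theta\sum_{j=1}^{l_0}\widetilde a_j^2|\widetilde x_j|^2\frac{\mu(\widetilde a_j|\theta|)}{\widetilde a_j|\theta|},$$ and $$d(g)^2=4|t||\theta|+\sum_{j=1}^{l_0}|\widetilde x_j|^2\widetilde a_j|\theta|\cot(\widetilde a_j|\theta|)=\sum_{j=1}^{l_0}|\widetilde x_j|^2\Big(\frac{\widetilde a_j|\theta|}{\sin(\widetilde a_j|\theta|)}\Big)^2=\Big|\frac{U(\theta)}{\sin U(\theta)}x\Big|^2.$$ (2) The cut locus $\mathrm{Cut}_o$ equals $\mathbb M^c=\{(x,t):\ \widetilde x_{l_0}=0,\ 4|t|\ge\sum_{j=1}^{l_0-1}\widetilde a_j|\widetilde x_j|^2\mu(\widetilde a_j\pi)\}$, and for $(x,t)\in\mathbb M^c$, $$d(x,t)^2=\pi\Big(4|t|+\sum_{j=1}^{l_0-1}\widetilde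 a_j|\widetilde x_j|^2\cot(\widetilde a_j\pi)\Big).$$ (3) For every $g\neq o$ there is exactly one $\theta\in\overline{\Omega_*}$ such that $d(g)^2=\phi(g;\theta)=\sup_{\tau\in\Omega_*}\phi(g;\tau)$.
   Context: Step-two group: $q=2n$, $U^{(1)},\dots,U^{(m)}$ linearly independent real skew-symmetric $2n\times2n$ matrices, $\mathbb G=\mathbb R^{2n}\times\mathbb R^m$ with law $(x,t)\cdot(x',t')=(x+x',t+t'+\frac12\langle\mathbb Ux,x'\rangle)$, $\langle\mathbb Ux,x'\rangle=(\langle U^{(j)}x,x'\rangle)_j$, identity $o$; $d(g)$ = Carnot–Carathéodory distance from $o$ (infimum of $\int_0^1|x'|$ over absolutely continuous curves from $o$ to $g$ with $t'=\frac12\langle\mathbb Ux,x'\rangle$). $U(\lambda)=i\sum_j\lambda_jU^{(j)}$. Generalized H-type: there is $S=\mathrm{diag}(\widetilde a_1\mathbb I_{2k_1},\dots,\widetilde a_{l_0}\mathbb I_{2k_{l_0}})$ with $0<\widetilde a_1<\cdots<\widetilde a_{l_0}=1$, $\sum_j2k_j=2n$, such that $U(\lambda)U(\lambda')+U(\lambda')U(\lambda)=2(\lambda\cdot\lambda')S^2$ for all $\lambda,\lambda'\in\mathbb R^m$. Then $\Omega_*=\{\tau:\|U(\tau)\|<\pi\}=B_{\mathbb R^m}(0,\pi)$ and $\phi((x,t);\tau)=\langle U(\tau)\cot U(\tau)x,x\rangle+4t\cdot\tau=4t\cdot\tau+\sum_j|\widetilde x_j|^2\widetilde a_j|\tau|\cot(\widetilde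 a_j|\tau|)$; for $\tau\in\partial\Omega_*$, $\phi(g;\tau)$ is given by the same formula with the convention $0\cdot\infty=0$ (it equals $-\infty$ if $\widetilde x_{l_0}\ne0$). $\mathbb M$ is the set of $g$ such that $\phi(g;\cdot)$ has a nondegenerate critical point in $\Omega_*$. $\mu(s)=\frac{d}{ds}(1-s\cot s)=\frac{2s-\sin2s}{2\sin^2s}$, and $\mu(s)/s$ is extended by continuity ($=2/3$) at $s=0$. $\mathrm{Cut}_o$ is the complement of $\{g:d^2$ is $C^\infty$ near $g\}$. *)

(* Defs.v *)
From HB Require Import structures.
From mathcomp Require Import all_boot all_order all_algebra.
From mathcomp Require Import all_classical all_reals all_analysis.
Import Order.TTheory GRing.Theory Num.Theory.
Import numFieldNormedType.Exports.

Set Implicit Arguments.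
Unset Strict Implicit.
Unset Printing Implicit Defensive.

Local Open Scope classical_set_scope.
Local Open Scope ring_scope.

Section GHtype_defs.
Context {R : realType}.

Definition ip {N : nat} (v w : 'rV[R]_N) : R := \sum_i v 0 i * w 0 i.
Definition enorm {N : nat} (v : 'rV[R]_N) : R := Num.sqrt (ip v v).
Definition esq {p r : nat} (A : 'M[R]_(p, r)) : R := \sum_i \sum_j A i j ^+ 2.

Definition pt (n m : nat) := ('rV[R]_(2 * n) * 'rV[R]_m)%type.

(** A(lambda) = sum_j lambda_j U^(j) (real skew matrix); U(lambda) = i A(lambda). *)
Definition Amat {q m : nat} (U : 'I_m -> 'M[R]_q) (lam : 'rV[R]_m) : 'M[R]_q :=
  \sum_j lam 0 j *: U j.

(** Block structure: blocks j = 0..l (i.e. l0 = l+1 blocks), block j occupies the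
    coordinates [2(k_0+..+k_{j-1}), 2(k_0+..+k_j)) of R^{2n}. *)
Definition in_block {l : nat} (k : 'I_l.+1 -> nat) (j : 'I_l.+1) (i : nat) : bool :=
  ((2 * \sum_(j' < l.+1 | (j' < j)%N) k j' <= i)
   && (i < 2 * \sum_(j' < l.+1 | (j' <= j)%N) k j'))%N.

Definition Smat {q l : nat} (k : 'I_l.+1 -> nat) (a : 'I_l.+1 -> R) : 'M[R]_q :=
  \matrix_(i, i') (if i == i' then \sum_(j | in_block k j i) a j else 0).

Definition bnorm2 {q l : nat} (k : 'I_l.+1 -> nat) (j : 'I_l.+1) (x : 'rV[R]_q) : R :=
  \sum_(i < q | in_block k j i) x 0 i ^+ 2.

Definition GHtype (n m l : nat) (k : 'I_l.+1 -> nat) (a : 'I_l.+1 -> R)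
    (U : 'I_m -> 'M[R]_(2 * n)) : Prop :=
  [/\ ((forall j, 0 < k j)%N /\ (\sum_j k j = n)%N),
      [/\ 0 < a ord0, (forall j j' : 'I_l.+1, (j < j')%N -> a j < a j') & a ord_max = 1],
      (forall j, (U j)^T = - U j),
      (forall c : 'I_m -> R, \sum_j c j *: U j = 0 -> forall j, c j = 0) &
      (* U(l)U(l') + U(l')U(l) = 2 (l.l') S^2 with U(l) = i A(l), i.e. *)
      (forall lam lam' : 'rV[R]_m,
         - (Amat U lam *m Amat U lam' + Amat U lam' *m Amat U lam)
         = (2 * ip lam lam') *: (Smat k a *m Smat k a))].

Definition abs_cont01 (f : R -> R) : Prop :=
  forall e : R, 0 < e -> exists2 del : R, 0 < del &
    forall (N : nat) (b c : 'I_N -> R),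
      (forall i, [/\ 0 <= b i, b i <= c i & c i <= 1]) ->
      (forall i j, i != j -> c i <= b j \/ c j <= b i) ->
      \sum_i (c i - b i) < del -> \sum_i `|f (c i) - f (b i)| < e.

Definition hcurve {n m : nat} (U : 'I_m -> 'M[R]_(2 * n)) (g : pt n m)
    (cx : 'I_(2 * n) -> R -> R) (ct : 'I_m -> R -> R) : Prop :=
  [/\ forall i, [/\ abs_cont01 (cx i), cx i 0 = 0 & cx i 1 = g.1 0 i],
      forall j, [/\ abs_cont01 (ct j), ct j 0 = 0 & ct j 1 = g.2 0 j] &
      {ae lebesgue_measure, forall s, `[0%R, 1%R]%classic s ->
         forall j, derive1 (ct j) s
            = 2^-1 * \sum_i \sum_i' U j i i' * cx i' s * derive1 (cx i) s}].

Definition hlength {q : nat} (cx : 'I_q -> R -> R) : \bar R :=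
  (\int[lebesgue_measure]_(s in `[0%R, 1%R]%classic)
      (Num.sqrt (\sum_i (derive1 (cx i) s) ^+ 2))%:E)%E.

Definition ccdist {n m : nat} (U : 'I_m -> 'M[R]_(2 * n)) (g : pt n m) : R :=
  fine (ereal_inf [set L | exists cx ct, hcurve U g cx ct /\ L = hlength cx]).

Definition scot (s : R) : R := if s == 0 then 1 else s * cos s / sin s.
Definition ssin (s : R) : R := if s == 0 then 1 else s / sin s.
Definition mu (s : R) : R := (2 * s - sin (2 * s)) / (2 * sin s ^+ 2).
Definition mu_over (s : R) : R := if s == 0 then 2 / 3 else mu s / s.

(** phi((x,t); tau) for tau in Omega_* = B(0,pi). *)
Definition phi {n m l : nat} (k : 'I_l.+1 -> nat) (a : 'I_l.+1 -> R)
    (g : pt n m) (tau : 'rV[R]_m) : R :=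
  4 * ip g.2 tau + \sum_j bnorm2 k j g.1 * scot (a j * enorm tau).

(** phi extended to the closed ball (0 * oo = 0 convention; -oo if x~_{l0} <> 0). *)
Definition phi_bar {n m l : nat} (k : 'I_l.+1 -> nat) (a : 'I_l.+1 -> R)
    (g : pt n m) (tau : 'rV[R]_m) : \bar R :=
  if enorm tau < pi then (phi k a g tau)%:E
  else if bnorm2 k ord_max g.1 == 0 then
    (4 * ip g.2 tau
     + \sum_(j < l.+1 | j != ord_max) bnorm2 k j g.1 * scot (a j * enorm tau))%:E
  else -oo%E.

Definition unit_rv {m : nat} (i : 'I_m) : 'rV[R]_m := delta_mx 0 i.
Definition nondeg_crit {m : nat} (f : 'rV[R]_m -> R) (tau : 'rV[R]_m) : Prop :=
  [/\ forall v, derivable f tau v /\ derive f tau v = 0,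
      forall i j, derivable (fun s => derive f s (unit_rv j)) tau (unit_rv i) &
      \det (\matrix_(i, j) derive (fun s => derive f s (unit_rv j)) tau (unit_rv i))
        != 0].

Definition Mset {n m l : nat} (k : 'I_l.+1 -> nat) (a : 'I_l.+1 -> R) : set (pt n m) :=
  [set g | exists tau : 'rV[R]_m, enorm tau < pi /\ nondeg_crit (phi k a g) tau].

(** Functional calculus: for a real symmetric B, mfun h B is the matrix acting as
    h(lambda) on each eigenvector of B with eigenvalue lambda. *)
Definition mfun {q : nat} (h : R -> R) (B : 'M[R]_q) : 'M[R]_q :=
  xget 0 [set M : 'M[R]_q | forall (v : 'cV[R]_q) (lam : R),
                              B *m v = lam *: v -> M *m v = h lam *: v].

(** U(theta)/sin U(theta) = h(U(theta)^2) with h(w) = sqrt w / sin (sqrt w),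
    and U(theta)^2 = - A(theta)^2. *)
Definition UsinU {q m : nat} (U : 'I_m -> 'M[R]_q) (theta : 'rV[R]_m) : 'M[R]_q :=
  mfun (fun w => ssin (Num.sqrt w)) (- (Amat U theta *m Amat U theta)).

Fixpoint Ck {V : normedModType R} (k : nat) (f : V -> R) (A : set V) : Prop :=
  match k with
  | 0 => forall y, A y -> {for y, continuous f}
  | k'.+1 => Ck k' f A /\
      forall v : V, (forall y, A y -> derivable f y v) /\ Ck k' (fun y => derive f y v) A
  end.
Definition smooth_near {V : normedModType R} (f : V -> R) (g : V) : Prop :=
  exists A : set V, [/\ open A, A g & forall k, Ck k f A].

Definition Cut {n m : nat} (U : 'I_m -> 'M[R]_(2 * n)) : set (pt n m) :=
  [set g | ~ smooth_near (fun h : pt n m => ccdist U h ^+ 2) g].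

End GHtype_defs.

(* Main.v *)
Require Import Defs.
From HB Require Import structures.
From mathcomp Require Import all_boot all_order all_algebra.
From mathcomp Require Import all_classical all_reals all_analysis.
From mathcomp Require Import measurable_realfun.
From mathcomp Require Import ring lra.
Import Order.TTheory GRing.Theory Num.Theory.
Import numFieldNormedType.Exports.
Set Implicit Arguments.
Unset Strict Implicit.
Unset Printing Implicit Defensive.
Local Open Scope classical_set_scope.
Local Open Scope ring_scope.

(* Let T = |t| and let s_i be the diagonal entries of S.  On the sphere |tau| = r the
   reference function has maximum f(r) = 4 T r + sum_i x_i^2 (s_i r) cot(s_i r), which is
   concave on [0, pi), with derivative 4 T - sum_i s_i x_i^2 mu(s_i r); M is the set where
   f attains its maximum at a single r < pi.  Lower bound d^2 >= phi(g; tau): along a horizontal curve, differentiate the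
   quadratic form in x given by the Riccati solution s r cot(s r u) (a calibration).
   Upper bound: the curves x = sin(r u S) exp(u A) w / norm, computed with A^2 = -|theta|^2 S^2,
   reach the calibrated value; over the cut locus a free component of w in the last
   block, whose endpoint vanishes at r = pi, supplies the missing vertical coordinate.
   On M the squared radius solves an equation analytic in (x, |t|^2), so d^2 is smooth by
   implicit differentiation.  At an interior point of the complement, d^2 has a cusp in the
   directions of the last block; the boundary consists of limits of such points. *)

(** * Absolutely continuous curves *)

(** Admissible curves are only absolutely continuous and [hlength] integrates [derive1], so the
    calibration has to be integrated from inequalities that hold almost everywhere. Hence the
    opening measure theory: a function of this kind with derivative at most 0 almost everywhere does
    not increase, and such a curve has an arc length function. The relation at [lam = lam'] gives
    A^2 = - |lam|^2 S^2, so A commutes with S and the weighted quadratic forms in x and A x become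
    sums over coordinates with weights depending on s_i. Blocks are therefore translated into
    coordinates only at the end. For smoothness on M the obstacle is t = 0, where |t| and the
    critical radius r are not smooth. With w = r^2 and N(x, w) = sum_i s_i^2 x_i^2 nu(s_i^2 w),
    where nu(u^2) = mu(u) / u, the critical equation N r = 4 |t| is squared to N^2 w = 16 |t|^2. Its
    derivative in w is N (N + 2 w N'), whose second factor is the derivative of N r in r, positive
    because mu' > 0. *)

Section absolute_continuity.
Context {R : realType}.
Implicit Types (f g F : R -> R) (I J : seq (R * R)).

(** Cousin's covering lemma: compactness of [0, 1] in the form suited to interval properties that
    concatenate. *)
Lemma cousin_induction (P : R -> R -> Prop) :
  (forall u v w, u <= v -> v <= w -> P u v -> P v w -> P u w) ->
  (forall x, 0 <= x <= 1 -> exists2 del : R, 0 < del &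
     forall u v, 0 <= u -> u <= x -> x <= v -> v <= 1 ->
       x - del < u -> v < x + del -> P u v) ->
  P 0 1.
Proof.
move=> tr loc.
pose T := [set v : R | 0 <= v <= 1 /\ P 0 v].
have T0 : T 0.
  split; first by rewrite lexx ler01.
  have [|del d0 h] := loc 0; first by rewrite lexx ler01.
  by apply: h => //; lra.
have hsT : has_sup T by split; [exists 0 | exists 1 => v [/andP[]]].
have s0 : 0 <= sup T by apply: ub_le_sup => //; case: hsT.
have s1 : sup T <= 1 by apply: ge_sup; [exists 0|move=> v [/andP[]]].
have [|del d0 h] := loc (sup T); first by rewrite s0.
have [v [/andP[v0 v1] Pv] vs] := sup_adherent d0 hsT.
have vT : v <= sup T by apply: ub_le_sup; [case: hsT|split => //; rewrite v0].
pose w := Num.min (sup T + del / 2) 1.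
have sw : sup T <= w by rewrite le_min s1 andbT; lra.
have w1 : w <= 1 by rewrite ge_min lexx orbT.
have wd : w < sup T + del by rewrite gt_min; apply/orP; left; lra.
have Pw : P 0 w by apply: (tr 0 v w) => //; [exact: le_trans sw|exact: h].
have wT : w <= sup T.
  by apply: ub_le_sup; [case: hsT|split => //; rewrite w1 andbT (le_trans s0)].
have w1' : w = 1.
  move: wT; rewrite /w; case: (leP (sup T + del / 2) 1) => // _ h2; lra.
by rewrite -[X in P _ X]w1'.
Qed.

Definition nonoverlap (p q : R * R) := (p.2 <= q.1) || (q.2 <= p.1).

Definition subitv01 (p : R * R) := [&& 0 <= p.1, p.1 <= p.2 & p.2 <= 1].

Lemma nonoverlap_sym p q : nonoverlap p q = nonoverlap q p.
Proof. by rewrite /nonoverlap orbC. Qed.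

Lemma abs_cont01_seq f e : abs_cont01 f -> 0 < e -> exists2 del : R, 0 < del &
  forall I, all subitv01 I -> pairwise nonoverlap I ->
    \sum_(p <- I) (p.2 - p.1) < del -> \sum_(p <- I) `|f p.2 - f p.1| < e.
Proof.
move=> acf e0; have [del d0 h] := acf e e0; exists del => // I I01 dI.
rewrite !(big_nth (0, 0)) !big_mkord => Idel.
apply: (h _ (fun i : 'I_(size I) => (nth (0, 0) I i).1)
  (fun i : 'I_(size I) => (nth (0, 0) I i).2)) => //.
- by move=> i; have /and3P := all_nthP (0,0) I01 i (ltn_ord i).
- move=> i j ij; suff /orP : nonoverlap (nth (0, 0) I i) (nth (0, 0) I j) by [].
  have /(pairwiseP (0,0)) dI' := dI.
  case: (ltngtP i j) => [lij|lij|/ord_inj eij]; last by rewrite eij eqxx in ij.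
    by apply: dI'; rewrite ?inE.
  by rewrite nonoverlap_sym; apply: dI'; rewrite ?inE.
Qed.

Lemma lebesgue_nonoverlap_le (O : set R) I : open O ->
  all subitv01 I -> pairwise nonoverlap I ->
  (forall p, p \in I -> `[p.1, p.2] `<=` O) ->
  ((\sum_(p <- I) (p.2 - p.1))%:E <= lebesgue_measure O)%E.
Proof.
move=> oO I01 dI IO.
have mO : measurable O by exact: open_measurable.
(* Half-open intervals, because members of [I] may share endpoints while additivity of the measure
   needs disjoint sets. *)
suff [A [mA AO muA _]] : exists A : set R, [/\ measurable A, A `<=` O,
    lebesgue_measure A = (\sum_(p <- I) (p.2 - p.1))%:E
    & A = \big[setU/set0]_(p <- I) `]p.1, p.2]%classic].
  by rewrite -muA; apply: le_measure => //; rewrite inE.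
elim: I I01 dI IO => [|p I IH] /=.
  by exists set0; split => //; rewrite ?big_nil // measure0.
move=> /andP[p01 I01] /andP[pI dI] IO.
have [||q qI|A [mA AO muA AE]] := IH => //.
  by apply: IO; rewrite inE qI orbT.
exists (`]p.1, p.2]%classic `|` A); split.
- exact: measurableU.
- move=> x [|/AO //]; move=> xp; apply: (IO p); first by rewrite mem_head.
  by move: xp; rewrite /= !in_itv/= => /andP[/ltW -> ->].
- rewrite big_cons EFinD -muA measureU //.
    congr (_ + _)%E; apply: (eq_trans (lebesgue_measure_itv _)).
    rewrite /= lte_fin; move: p01 => /and3P[_ p12 _].
    case: ltP => // p21; have -> : p.1 = p.2 by apply/eqP; rewrite eq_le p12.
    by rewrite subrr.
  rewrite -subset0 AE => x [/= xp].
  rewrite -bigcup_seq => -[q /= qI]; rewrite /= !in_itv/= => xq.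
  move: xp; rewrite in_itv/= => xp.
  have /allP/(_ _ qI) := pI; rewrite /nonoverlap => /orP[]; lra.
- by rewrite big_cons AE.
Qed.

(** Straddle form: only intervals containing x are compared, so differentiability at the single
    point x suffices. *)
Lemma is_derive_le_local F x e : derivable F x 1 -> derive1 F x <= 0 -> 0 < e ->
  exists2 del : R, 0 < del & forall u v, u <= x -> x <= v -> x - del < u ->
    v < x + del -> F v - F u <= e * (v - u).
Proof.
move=> dF F0 e0.
have : (fun h => h^-1 *: (F (h + x) - F x)) @ 0^' --> derive1 F x.
  rewrite derive1E; have := dF; rewrite /derivable /derive /= => /cvg_ex[l Fl].
  have -> : (fun h : R => h^-1 *: (F (h + x) - F x)) =
     (fun h : R => h^-1 *: ((F \o shift x) (h *: 1) - F x)).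
    by apply/funext => h /=; rewrite scaler1.
  by apply: (cvgP l).
move/cvgrPdist_lt => /(_ e e0) [del /= d0 H]; exists del => // u v ux xv xu vx.
have q y : `|y - x| < del -> y != x -> (y - x)^-1 * (F y - F x) < e.
  move=> yx ynx; have := H (y - x); rewrite /= sub0r normrN => /(_ yx).
  rewrite subr_eq0 => /(_ ynx); rewrite subrK => h1.
  have := ler_norm (- (derive1 F x - (y - x)^-1 *: (F y - F x))).
  rewrite normrN; rewrite /GRing.scale/= in h1 *; lra.
have hv : F v - F x <= e * (v - x).
  have [->|nvx] := eqVneq v x; first by rewrite !subrr mulr0.
  have vx0 : 0 < v - x by rewrite subr_gt0 lt_neqAle eq_sym nvx.
  have := q v; rewrite gtr0_norm// ltrBlDl => /(_ vx nvx)/ltW.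
  by rewrite ler_pdivrMl// mulrC.
have hu : F x - F u <= e * (x - u).
  have [->|nux] := eqVneq u x; first by rewrite !subrr mulr0.
  have ux0 : u - x < 0 by rewrite subr_lt0 lt_neqAle nux.
  have := q u; rewrite ltr0_norm// opprB ltrBlDl -ltrBlDr => /(_ xu nux)/ltW.
  by rewrite ler_ndivrMl//; nra.
nra.
Qed.

(** The exceptional null set is enclosed in an open set of small measure, where absolute continuity
    bounds the total increment. At every other point the derivative controls the increment
    locally. *)
Lemma abs_cont01_nonincreasing F : abs_cont01 F ->
  {ae lebesgue_measure, forall s, `[0%R, 1%R]%classic s ->
     derivable F s 1 /\ derive1 F s <= 0} -> F 1 <= F 0.
Proof.
move=> acF [N [mN N0 FN]].
apply/ler_addgt0Pr => e e0.
have e20 : 0 < e / 2 by rewrite divr_gt0.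
have [del d0 hdel] := abs_cont01_seq acF e20.
have [|O [oO NO Odel]] := lebesgue_regularity_outer mN _ d0.
  by rewrite [X in (X < _)%E]N0 ltry.
have mO : measurable O by exact: open_measurable.
have {}Odel : (lebesgue_measure O < del%:E)%E.
  rewrite (_ : O = N `|` (O `\` N)); last by rewrite setDUK.
  rewrite measureU //; [|exact: measurableD|exact: setDIK].
  by rewrite [X in (X + _)%E]N0 add0e.
(* An error budget that concatenates: e / 2 times the length from good points, plus the increments
   over intervals inside [O] from exceptional points. As [O] has measure below [del], the latter sum
   to less than e / 2. *)
pose P u v := exists I, [/\ all (fun p => [&& u <= p.1, p.1 <= p.2 & p.2 <= v]) I,
    pairwise nonoverlap I, forall p, p \in I -> `[p.1, p.2] `<=` O &
    F v - F u <= e / 2 * (v - u) + \sum_(p <- I) `|F p.2 - F p.1| ].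
suff [I [I01 dI IO]] : P 0 1.
  have := hdel I I01 dI; have := lebesgue_nonoverlap_le oO I01 dI IO.
  move=> /le_lt_trans/(_ Odel); rewrite lte_fin => h /(_ h).
  lra.
apply: cousin_induction.
  move=> u v w uv vw [I [Ib dI IO FI]] [J [Jb dJ JO FJ]].
  exists (I ++ J); split.
  - rewrite all_cat; apply/andP; split; apply/allP => p.
      by move=> /(allP Ib)/and3P[-> -> h]; rewrite (le_trans h).
    by move=> /(allP Jb)/and3P[h -> ->]; rewrite (le_trans _ h).
  - rewrite pairwise_cat dI dJ !andbT; apply/allrelP => p q pI qJ.
    have /and3P[_ _ h1] := allP Ib _ pI; have /and3P[h2 _ _] := allP Jb _ qJ.
    by rewrite /nonoverlap (le_trans h1 h2).
  - by move=> p; rewrite mem_cat => /orP[/IO|/JO].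
  - rewrite big_cat/=; nra.
move=> x x01; have [xN|xN] := pselect (N x).
  have [del' /= d'0 hO] : nbhs x O by apply: open_nbhs_nbhs; split => //; exact: NO.
  exists del' => // u v u0 ux xv v1 xu vx.
  exists [:: (u, v)]; split => //=.
  - by rewrite !lexx (le_trans ux xv).
  - move=> p; rewrite inE => /eqP -> /= y /=; rewrite in_itv/= => /andP[uy yv].
    apply: hO; rewrite /= ltr_norml; lra.
  - rewrite big_seq1/=; have := ler_norm (F v - F u).
    have := le_trans ux xv; nra.
have [dFx Fx0] : derivable F x 1 /\ derive1 F x <= 0.
  apply: contrapT => h; apply: xN; apply: FN => /= hx; apply: h; apply: hx.
  by rewrite /= in_itv/=.
have [del' d'0 h] := is_derive_le_local dFx Fx0 e20.
exists del' => // u v u0 ux xv v1 xu vx.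
by exists [::]; split => //; rewrite big_nil addr0; exact: h.
Qed.

End absolute_continuity.

(** * Total variation of absolutely continuous functions *)

Section total_variation_AC.
Context {R : realType}.
Implicit Types (f g F : R -> R) (I J : seq (R * R)).

(** The common criterion behind the closure of absolute continuity under sums, products and
    Lipschitz maps. *)
Lemma abs_cont01_dominated f g h (K : R) : abs_cont01 f -> abs_cont01 g ->
  (forall b c, 0 <= b -> b <= c -> c <= 1 ->
     `|h c - h b| <= K * (`|f c - f b| + `|g c - g b|)) -> abs_cont01 h.
Proof.
move=> acf acg hK e e0.
pose K1 := Num.max K 1; have K0 : 0 < K1 by rewrite lt_max ltr01 orbT.
have KK1 : K <= K1 by rewrite le_max lexx.
have e'0 : 0 < e / (2 * K1) by rewrite divr_gt0// mulr_gt0.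
have [d1 d10 h1] := acf _ e'0; have [d2 d20 h2] := acg _ e'0.
exists (Num.min d1 d2); first by rewrite lt_min d10.
move=> N b c bc dbc; rewrite lt_min => /andP[l1 l2].
have {}h1 := h1 N b c bc dbc l1; have {}h2 := h2 N b c bc dbc l2.
apply: (@le_lt_trans _ _ (\sum_i K1 * (`|f (c i) - f (b i)| + `|g (c i) - g (b i)|))).
  apply: ler_sum => i _; have [b0 bci c1] := bc i.
  by rewrite (le_trans (hK _ _ b0 bci c1))// ler_wpM2r// addr_ge0.
rewrite -mulr_sumr big_split/=.
rewrite -ltr_pdivlMl//; have -> : K1^-1 * e = e / (2 * K1) + e / (2 * K1).
  by field; rewrite gt_eqF.
by rewrite ltrD.
Qed.

Definition pieces (b : R) (s : seq R) : seq (R * R) := zip (b :: s) s.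

Lemma piecesP f (b c : R) (s : seq R) : itv_partition b c s ->
  [/\ all (fun p => [&& b <= p.1, p.1 <= p.2 & p.2 <= c]) (pieces b s),
      pairwise nonoverlap (pieces b s),
      \sum_(p <- pieces b s) (p.2 - p.1) = c - b &
      \sum_(p <- pieces b s) `|f p.2 - f p.1| = variation b c f s].
Proof.
move=> bcs; rewrite variation_zip//.
elim: s b bcs => [|x s IH] b bcs.
  by have := itv_partition_nil bcs => ->; rewrite /pieces/= !big_nil subrr.
have xcs := itv_partition_cons bcs; have [h1 h2 h3 h4] := IH _ xcs.
have bx : b < x by case: bcs => /= /andP[].
have xc := itv_partition_le xcs.
rewrite /pieces /= -/(pieces x s) !big_cons /= h3 h4; split => //.
- apply/andP; split; first by rewrite lexx (ltW bx).
  by apply/allP => p /(allP h1)/and3P[h -> ->]; rewrite (le_trans (ltW bx)).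
- rewrite h2 andbT; apply/allP => p /(allP h1)/and3P[h _ _].
  by rewrite /nonoverlap/= h.
- by ring.
Qed.

(** The suprema over partitions are taken one interval at a time: [J] collects the pieces of the
    intervals already cut, [I] those whose variation is still a supremum. Cutting does not change
    the total length, so the bound [del] survives. *)
Lemma total_variation_sum_le f (e del : R) :
  (forall I, all subitv01 I -> pairwise nonoverlap I ->
    \sum_(p <- I) (p.2 - p.1) < del -> \sum_(p <- I) `|f p.2 - f p.1| <= e) ->
  forall I J, all subitv01 (I ++ J) -> pairwise nonoverlap (I ++ J) ->
    \sum_(p <- I ++ J) (p.2 - p.1) < del ->
    (\sum_(p <- I) total_variation p.1 p.2 f
      + (\sum_(p <- J) `|f p.2 - f p.1|)%:E <= e%:E)%E.
Proof.
move=> H; elim => [|p I IH] J.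
  by rewrite big_nil add0e lee_fin; exact: H.
rewrite /= => /andP[p01 IJ01] /andP[pIJ dIJ]; rewrite big_cons/= => hdel.
have [p0 p12 p1] := and3P p01.
set K := (\sum_(p <- I) total_variation p.1 p.2 f
      + (\sum_(p <- J) `|f p.2 - f p.1|)%:E)%E.
have Ke : (K <= e%:E)%E.
  by apply: IH => //; apply: le_lt_trans hdel; rewrite lerDr subr_ge0.
have K0 : (0 <= K)%E.
  rewrite adde_ge0//; last by rewrite lee_fin sumr_ge0.
  rewrite big_seq sume_ge0// => q qI; apply: total_variation_ge0.
  by move: IJ01; rewrite all_cat => /andP[/allP/(_ _ qI)/and3P[]].
have Kfin : K \is a fin_num by rewrite ge0_fin_numE// (le_lt_trans Ke)// ltry.
rewrite big_cons -addeA -/K -leeBrDr// /total_variation.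
apply: ge_ereal_sup => _ [_ [s bs <-] <-]; rewrite leeBrDr//.
have [h1 h2 h3 <-] := piecesP f bs.
rewrite /K addeCA -EFinD -big_cat/=; apply: IH.
- move: IJ01; rewrite !all_cat => /andP[-> ->]; rewrite andbT /=.
  apply/allP => q /(allP h1)/and3P[h5 h6 h7]; rewrite /subitv01 h6.
  by rewrite (le_trans p0)//= (le_trans h7).
- move: dIJ pIJ; rewrite !pairwise_cat h2/= allrel_catr all_cat.
  move=> /andP[-> /andP[-> ->]] /andP[pI pJ]; rewrite !andbT.
  have aux q r : q \in pieces p.1 s -> nonoverlap p r -> nonoverlap q r.
    move=> /(allP h1)/and3P[h5 h6 h7]; rewrite /nonoverlap.
    by move=> /orP[h|h]; [rewrite (le_trans h7)|rewrite (le_trans h)// orbT].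
  apply/andP; split; apply/allrelP => q r.
    by move=> qI rp; rewrite nonoverlap_sym; apply: aux rp _; apply: (allP pI).
  by move=> qp rJ; apply: aux qp _; apply: (allP pJ).
- move: hdel; rewrite !big_cat/= h3; lra.
Qed.

(** The variation is at most 1 on intervals shorter than the [del] that belongs to 1, and finiteness
    concatenates. *)
Lemma abs_cont01_TV_fin f b c : abs_cont01 f -> 0 <= b -> b <= c -> c <= 1 ->
  total_variation b c f \is a fin_num.
Proof.
move=> acf b0 bc c1.
have [del d0 h] := abs_cont01_seq acf ltr01.
have {}h := total_variation_sum_le (fun I a b c => ltW (h I a b c)).
have step u v : 0 <= u -> u <= v -> v <= 1 -> v - u < del ->
    total_variation u v f \is a fin_num.
  move=> u0 uv v1 uvd; have := h [:: (u, v)] [::].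
  rewrite /subitv01 /= u0 uv v1 !big_seq1 big_nil adde0 => /(_ isT isT uvd) hle.
  by rewrite ge0_fin_numE ?(le_lt_trans hle) ?ltry// total_variation_ge0.
suff TV01 : total_variation 0 1 f \is a fin_num.
  have /bounded_variationP BV01 : total_variation 0 1 f \is a fin_num by [].
  apply/bounded_variationP => //; apply: (@bounded_variationl _ b c 1) => //.
  by apply: (@bounded_variationr _ 0 b 1) => //; [exact: le_trans c1|exact: BV01].
apply: (@cousin_induction _ (fun u v => total_variation u v f \is a fin_num)).
  by move=> u v w uv vw Puv Pvw; rewrite (total_variationD f uv vw) fin_numD Puv.
move=> x x01; exists (del / 2); first by rewrite divr_gt0.
by move=> u v u0 ux xv v1 xu vx; apply: step => //; [exact: le_trans xv|lra].
Qed.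

Definition var01 f (s : R) : R := fine (total_variation 0 s f).

Lemma var01B f b c : abs_cont01 f -> 0 <= b -> b <= c -> c <= 1 ->
  var01 f c - var01 f b = fine (total_variation b c f).
Proof.
move=> acf b0 bc c1; rewrite /var01 (total_variationD f b0 bc).
rewrite fineD ?(abs_cont01_TV_fin acf) ?(le_trans bc)//.
by ring.
Qed.

Lemma var01_ge f b c : abs_cont01 f -> 0 <= b -> b <= c -> c <= 1 ->
  `|f c - f b| <= var01 f c - var01 f b.
Proof.
move=> acf b0 bc c1; rewrite var01B// -lee_fin fineK ?(abs_cont01_TV_fin acf)//.
exact: total_variation_ge.
Qed.

Lemma abs_cont01_var01 f : abs_cont01 f -> abs_cont01 (var01 f).
Proof.
move=> acf e e0; have e20 : 0 < e / 2 by rewrite divr_gt0.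
have [del d0 h] := abs_cont01_seq acf e20; exists del => // N b c bc dbc sdel.
have {}h := total_variation_sum_le (fun I a b c => ltW (h I a b c)).
pose I := [seq (b i, c i) | i <- enum 'I_N].
have I01 : all subitv01 I.
  apply/allP => _ /mapP[i _ ->]; rewrite /subitv01 /=.
  by have [-> -> ->] := bc i.
apply: (@le_lt_trans _ _ (e / 2)); last lra.
have := h I [::]; rewrite cats0 => /(_ I01); rewrite big_nil adde0.
rewrite /I !big_map /= => hI.
rewrite -lee_fin -sumEFin; apply: le_trans (hI _ sdel); last first.
  rewrite pairwise_map; have := enum_uniq 'I_N; rewrite uniq_pairwise.
  apply: sub_pairwise => i j /= ij; rewrite /nonoverlap/=.
  by have [->|->] := dbc _ _ ij; rewrite ?orbT.
apply: lee_sum => i _; have [b0 bci c1] := bc i.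
rewrite var01B// ger0_norm ?fine_ge0 ?total_variation_ge0//.
by rewrite fineK ?(abs_cont01_TV_fin acf).
Qed.

Lemma abs_cont01_bounded f : abs_cont01 f -> exists M : R,
  forall s, 0 <= s <= 1 -> `|f s| <= M.
Proof.
move=> acf; exists (`|f 0| + var01 f 1) => s /andP[s0 s1].
have h1 := var01_ge acf (lexx 0) s0 s1.
have h2 := var01_ge acf s0 s1 (lexx 1).
have v0 : var01 f 0 = 0 by rewrite /var01 total_variationxx.
have := ler_normD (f 0) (f s - f 0); rewrite [_ + (_ - _)]addrC subrK.
have := normr_ge0 (f 1 - f s); lra.
Qed.

Lemma abs_cont01_continuous f (x e : R) : abs_cont01 f -> 0 < e ->
  exists2 del : R, 0 < del & forall b c, 0 <= b -> b <= c -> c <= 1 ->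
    c - b < del -> `|f c - f b| < e.
Proof.
move=> acf e0; have [del d0 h] := acf e e0; exists del => // b c b0 bc c1 bcd.
have := h 1%N (fun=> b) (fun=> c); rewrite !big_ord1; apply => //.
by move=> i j; rewrite !ord1 eqxx.
Qed.

End total_variation_AC.

(** * Differentiation of monotone absolutely continuous functions *)

Section monotone_AC.
Context {R : realType}.
Implicit Types (f g F G : R -> R).

Definition clamp01 (s : R) : R := Num.max 0 (Num.min s 1).

Lemma clamp01_ge0 s : 0 <= clamp01 s.
Proof. by rewrite le_max lexx. Qed.

Lemma clamp01_le1 s : clamp01 s <= 1.
Proof. by rewrite ge_max ler01 ge_min lexx orbT. Qed.

Lemma clamp01_homo : {homo clamp01 : x y / x <= y}.
Proof.
move=> x y xy; rewrite /clamp01 ge_max le_max lexx/= le_max.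
by apply/orP; right; rewrite le_min !ge_min xy lexx orbT.
Qed.

Lemma clamp01_id s : 0 <= s -> s <= 1 -> clamp01 s = s.
Proof. by move=> s0 s1; rewrite /clamp01 min_l// max_r. Qed.

Lemma clamp01B x y : x <= y -> clamp01 y - clamp01 x <= y - x.
Proof.
move=> xy; rewrite /clamp01.
case: (leP y 1) => ?; case: (leP x 1) => ?; try case: (leP 0 y) => ?;
  try case: (leP 0 x) => ?; try case: (leP 0 1) => ?; lra.
Qed.

Lemma open_itv_infsup (I : set R) : open I -> is_interval I -> I !=set0 ->
  has_ubound I -> has_lbound I -> I = `]inf I, sup I[%classic.
Proof.
move=> oI iI I0 uI lI; apply/seteqP; split => x /=; rewrite in_itv/=.
  move=> Ix; have := oI; rewrite openE => /(_ _ Ix)[e /= e0 he].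
  have Ixy y : `|x - y| < e -> I y by exact: he.
  have : inf I <= x - e / 2.
    by apply: ge_inf => //; apply: Ixy; rewrite opprB addrC subrK gtr0_norm; lra.
  have : x + e / 2 <= sup I.
    apply: ub_le_sup => //; apply: Ixy.
    by rewrite opprD addrA subrr add0r normrN gtr0_norm; lra.
  lra.
move=> /andP[ix xs].
have ix0 : 0 < x - inf I by rewrite subr_gt0.
have xs0 : 0 < sup I - x by rewrite subr_gt0.
have [y Iy yx] := inf_adherent ix0 (conj I0 lI).
have [z Iz xz] := sup_adherent xs0 (conj I0 uI).
by apply: (iI y z) => //; rewrite !ltW//; lra.
Qed.

(** G, frozen outside [0, 1], is the distribution function of a Stieltjes measure. Absolute
    continuity of G makes this measure dominated by Lebesgue measure, and its Radon-Nikodym density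
    is the derivative almost everywhere by Lebesgue differentiation. *)
Lemma abs_cont01_nondecreasing_derivable G : abs_cont01 G ->
  (forall b c, 0 <= b -> b <= c -> c <= 1 -> G b <= G c) ->
  exists g : R -> R, [/\ lebesgue_measure.-integrable setT (EFin \o g) &
    {ae lebesgue_measure, forall s, 0 < s < 1 ->
       derivable G s 1 /\ derive1 G s = g s}].
Proof.
move=> acG ndG; pose Gt s := G (clamp01 s).
have ndGt : nondecreasing Gt.
  by move=> x y xy; apply: ndG; [exact: clamp01_ge0|exact: clamp01_homo|exact: clamp01_le1].
have cGt : continuous Gt.
  move=> x; apply/cvgrPdist_lt => e e0.
  have [del d0 h] := @abs_cont01_continuous _ G 0 e acG e0.
  exists del => //= y xy. have [xly|ylx] := leP x y.
   rewrite (distrC (Gt x)); apply: h; rewrite ?clamp01_ge0 ?clamp01_le1 ?clamp01_homo//.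
    apply: le_lt_trans (clamp01B xly) _.
    by move: xy; rewrite /ball_ /= distrC ger0_norm// subr_ge0.
  apply: h; rewrite ?clamp01_ge0 ?clamp01_le1 ?clamp01_homo// ?ltW//.
  apply: le_lt_trans (clamp01B (ltW ylx)) _.
  by move: xy; rewrite /ball_ /= ger0_norm// subr_ge0 ltW.
have rcGt : right_continuous Gt by move=> x; apply: cvg_at_right_filter; exact: cGt.
pose F : cumulative R R := HB.pack Gt (isCumulative.Build R _ R Gt ndGt rcGt).
pose mu : {measure set (measurableTypeR R) -> \bar R} := lebesgue_stieltjes_measure F.
have muoc a b : a <= b -> mu `]a, b]%classic = (Gt b - Gt a)%:E.
  move=> ab; suff : lebesgue_stieltjes_measure F `]a, b]%classic = (Gt b - Gt a)%:E by [].
  rewrite /lebesgue_stieltjes_measure /= /measure_extension.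
  rewrite measurable_mu_extE/=; last exact: is_ocitv.
  by rewrite wlength_itv_bnd.
pose D : set (measurableTypeR R) := `]0, 1]%classic.
have mD : measurable D by exact: measurable_itv.
have muD : (mu D < +oo)%E by rewrite muoc// ltry.
pose nu : {finite_measure set _ -> \bar R} := @mfrestr _ (measurableTypeR R) R D mu mD muD.
have nudom : nu `<< @lebesgue_measure R.
  apply/null_content_dominatesP => A mA A0.
  apply/eqP; rewrite eq_le measure_ge0 andbT.
  apply/lee_addgt0Pr => e e0; rewrite add0e.
  have [del d0 hdel] := acG _ e0.
  have [|O [oO AO Odel]] := lebesgue_regularity_outer mA _ d0.
    by rewrite [X in (X < _)%E]A0 ltry.
  have mO : measurable O by exact: open_measurable.
  have {}Odel : (lebesgue_measure O < del%:E)%E.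
    rewrite (_ : O = A `|` (O `\` A)); last by rewrite setDUK.
    rewrite measureU //; [|exact: measurableD|exact: setDIK].
    by rewrite [X in (X + _)%E]A0 add0e.
  (* Bounding the open set makes its components bounded, so that [inf] and [sup] are their
     endpoints. *)
  pose O' := O `&` `]-1, 2[%classic.
  have oO' : open O' by apply: openI => //; exact: interval_open.
  have mO' : measurable O' by exact: open_measurable.
  pose I := open_disjoint_itv oO'.
  have oI k : open (I k : set R) by exact: open_disjoint_itv_open.
  have mI k : measurable (I k) by exact: open_measurable.
  have iI k : is_interval (I k : set R) by exact: open_disjoint_itv_is_interval.
  have OI : O' = \bigcup_k I k by exact: open_disjoint_itv_bigcup.
  have IO k : I k `<=` O' by rewrite OI; exact: bigcup_sup.
  have tI : trivIset [set: nat] I by exact: open_disjoint_itv_trivIset.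
  have IE k : I k = `]inf (I k), sup (I k)[%classic.
    (* An empty component has [inf] and [sup] equal to 0 by convention, and ]0, 0[ is indeed
       empty. *)
    have [->|/set0P Ik0] := eqVneq (I k) set0.
      by rewrite inf0 sup0 set_itvoo0.
    apply: open_itv_infsup => //.
      by exists 2 => x /IO[_]; rewrite /= in_itv/= => /andP[_ /ltW].
    by exists (-1) => x /IO[_]; rewrite /= in_itv/= => /andP[/ltW].
  have Iin k x : I k x -> inf (I k) < x < sup (I k).
    by rewrite {1}IE /= in_itv.
  have inI k x : inf (I k) < x < sup (I k) -> I k x.
    by rewrite {3}IE /= in_itv.
  have leIk k : inf (I k) <= sup (I k).
    have [->|/set0P[x Ikx]] := eqVneq (I k) set0; first by rewrite inf0 sup0.
    by have /andP[h1 h2] := Iin _ _ Ikx; lra.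
  apply: (@le_trans _ _ (mu O')).
    rewrite /nu /= /mfrestr /mrestr; apply: le_measure; rewrite ?inE//.
      exact: measurableI.
    move=> x [/AO Ox]; rewrite /D /= in_itv/= => /andP[x0 x1]; split => //=.
    by rewrite in_itv/=; apply/andP; split; lra.
  have -> : mu O' = (\sum_(k <oo) mu (I k))%E.
    by rewrite OI measure_semi_bigcup// -OI.
  (* Absolute continuity speaks of finitely many intervals: it bounds the partial sums, and the
     bound passes to the limit. *)
  apply: lime_le; first exact: is_cvg_nneseries.
  apply: nearW => n.
  have muI k : (mu (I k) <= (Gt (sup (I k)) - Gt (inf (I k)))%:E)%E.
    rewrite -muoc//; apply: le_measure; [by rewrite inE; exact: mI|by rewrite inE|].
    by rewrite {1}IE; apply: subset_itvl; rewrite bnd_simp.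
  apply: (@le_trans _ _ (\sum_(k < n) (Gt (sup (I k)) - Gt (inf (I k))))%:E).
    by rewrite big_mkord -sumEFin; apply: lee_sum.
  have lebI k : ((clamp01 (sup (I k)) - clamp01 (inf (I k)))%:E
      <= lebesgue_measure (I k : set R))%E.
    have -> : lebesgue_measure (I k : set R) =
        lebesgue_measure (`]inf (I k), sup (I k)[%classic : set R) by rewrite -IE.
    rewrite lebesgue_measure_itv /= lte_fin; case: ltP => h.
      by rewrite lee_fin; exact: clamp01B.
    have -> : sup (I k) = inf (I k) by apply/eqP; rewrite eq_le h leIk.
    by rewrite subrr.
  rewrite lee_fin ltW//.
  apply: le_lt_trans (hdel n (fun k => clamp01 (inf (I k)))
    (fun k => clamp01 (sup (I k))) _ _ _).
  - by apply: ler_sum => k _; exact: ler_norm.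
  - by move=> i; rewrite clamp01_ge0 clamp01_le1 clamp01_homo.
  - move=> i j ij.
    have [Ii0|/set0P[x Iix]] := eqVneq (I i) set0.
      by left; rewrite Ii0 sup0 clamp01_id ?clamp01_ge0.
    have [Ij0|/set0P[y Ijy]] := eqVneq (I j) set0.
      by right; rewrite Ij0 sup0 clamp01_id ?clamp01_ge0.
    have [h|h] := leP (sup (I i)) (inf (I j)); first by left; exact: clamp01_homo.
    have [h'|h'] := leP (sup (I j)) (inf (I i)); first by right; exact: clamp01_homo.
    suff [z Iz] : exists z, I i z /\ I j z.
      have := tI i j Logic.I Logic.I (ex_intro _ z Iz) => /ord_inj eij.
      by rewrite eij eqxx in ij.
    have /andP[? ?] := Iin _ _ Iix; have /andP[? ?] := Iin _ _ Ijy.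
    exists ((Num.max (inf (I i)) (inf (I j)) + Num.min (sup (I i)) (sup (I j))) / 2).
    case: (leP (inf (I i)) (inf (I j))) => ?;
    case: (leP (sup (I i)) (sup (I j))) => ?;
    by split; apply: inI; apply/andP; split; lra.
  - rewrite -lte_fin; apply: le_lt_trans Odel.
    apply: (@le_trans _ _ (lebesgue_measure O')); last first.
      by apply: le_measure; rewrite ?inE//; exact: subIsetl.
    rewrite [X in lebesgue_measure X]OI.
    apply: (@le_trans _ _ (lebesgue_measure (\big[setU/set0]_(k < n) I k))).
      rewrite measure_bigsetU//.
      rewrite -sumEFin; apply: lee_sum => k _.
      exact: lebI.
    apply: le_measure.
    + by apply: mem_set; apply: bigsetU_measurable => k _; exact: mI.
    + by apply: mem_set; apply: bigcup_measurable => k _; exact: mI.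
    + exact: bigsetU_bigcup.
have [gE [gE0 gfin intg nuE]] := radon_nikodym_sigma_finite nudom.
exists (fine \o gE).
have Eg : EFin \o (fine \o gE) = gE by apply/funext => x /=; rewrite fineK.
split; first by rewrite Eg.
have intg' E : measurable E -> lebesgue_measure.-integrable E (EFin \o (fine \o gE)).
  by move=> mE; rewrite Eg; apply: integrableS intg.
have lg : locally_integrable [set: R] (fine \o gE).
  by have := integrable_locally measurableT (intg' _ measurableT); rewrite patch_setT.
have := FTC1 (a := BRight 0) (fun y => intg' _ (measurable_itv _)) lg.
apply: filterS => [|s ftc /andP[s0 s1]].
  exact: (ae_filter_ringOfSetsType lebesgue_measure).
have s0' : (BRight 0%R < BRight s)%O by rewrite bnd_simp.
have [dF F'] := ftc s0'.
pose H x := (\int[lebesgue_measure]_(t in `]0%R, x]) (fine \o gE) t)%R.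
have GE : \forall y \near s, G 0 + H y = G y.
  near=> y; have /andP[y0 y1] : y \in `]0, 1[.
    by near: y; apply: near_in_itvoo; rewrite in_itv/= s0.
  rewrite /H /Rintegral (eq_integral gE) => [|x _]; last by rewrite /= fineK.
  rewrite -nuE; last exact: measurable_itv.
  rewrite /nu /= /mfrestr /mrestr setIidl; last first.
    by apply: subset_itvl; rewrite bnd_simp ltW.
  rewrite muoc ?(ltW y0)//= /Gt !clamp01_id ?lexx ?ler01 ?ltW//.
  by rewrite [RHS](_ : _ = G 0 + (G y - G 0)) //; ring.
have dG : is_derive s 1 (fun y => G 0 + H y) (fine (gE s)).
  have dH : is_derive s 1 H (fine (gE s)) by split; [exact: dF|rewrite -derive1E; exact: F'].
  have := is_deriveD (is_derive_cst (G 0) s 1) dH.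
  by rewrite add0r.
have [dGs G's] := near_eq_is_derive GE dG.
by split => //; rewrite derive1E.
Unshelve. all: by end_near.
Qed.

End monotone_AC.

(** * Arc length of absolutely continuous curves *)

Section length_function.
Context {R : realType}.
Implicit Types (f g F G : R -> R).

Lemma abs_cont01B f g : abs_cont01 f -> abs_cont01 g -> abs_cont01 (fun s => f s - g s).
Proof.
move=> acf acg; apply: (abs_cont01_dominated (K := 1) acf acg) => b c _ _ _.
rewrite mul1r (_ : _ - _ = (f c - f b) - (g c - g b)); last by ring.
exact: ler_normB.
Qed.

(** Jordan decomposition: f = V - (V - f) with V the variation function, both terms being
    nondecreasing and absolutely continuous. *)
Lemma abs_cont01_derivable f : abs_cont01 f ->
  exists g : R -> R, [/\ lebesgue_measure.-integrable setT (EFin \o g) &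
    {ae lebesgue_measure, forall s, 0 < s < 1 ->
       derivable f s 1 /\ derive1 f s = g s}].
Proof.
move=> acf; have acV := abs_cont01_var01 acf.
have acW : abs_cont01 (fun s => var01 f s - f s) by exact: abs_cont01B.
have [|g [ig dg]] := abs_cont01_nondecreasing_derivable acV.
  move=> b c b0 bc c1; have := var01_ge acf b0 bc c1.
  by have := normr_ge0 (f c - f b); lra.
have [|h [ih dh]] := abs_cont01_nondecreasing_derivable acW.
  move=> b c b0 bc c1; have := var01_ge acf b0 bc c1.
  by have := ler_norm (f c - f b); lra.
exists (g \- h); split.
  have -> : EFin \o (g \- h) = ((EFin \o g) \- (EFin \o h))%E by [].
  exact: integrableB.
apply: filterS2 dg dh => [|s hg hh s01].
  exact: (ae_filter_ringOfSetsType lebesgue_measure).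
have [d1 e1] := hg s01; have [d2 e2] := hh s01.
have i1 : is_derive s 1 (var01 f) (g s) by split; rewrite -?derive1E.
have i2 : is_derive s 1 (fun s => var01 f s - f s) (h s) by split; rewrite -?derive1E.
have := is_deriveB i1 i2.
have -> : var01 f - (fun s => var01 f s - f s) = f.
  by apply/funext => x; change (var01 f x - (var01 f x - f x) = f x); ring.
by case=> ? eqd; rewrite derive1E eqd.
Qed.

Lemma ae_open_closed01 (P : R -> Prop) :
  {ae lebesgue_measure, forall s, 0 < s < 1 -> P s} ->
  {ae lebesgue_measure, forall s, `[0%R, 1%R]%classic s -> P s}.
Proof.
move=> hP; have h0 : {ae (@lebesgue_measure R), forall s : R, s <> 0 /\ s <> 1}.
  exists [set 0; 1]%classic; split.
  - by apply: measurableU; exact: measurable_set1.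
  - apply/eqP; rewrite eq_le measure_ge0 andbT.
    apply: (le_trans (measureU2 _ _ _)); [exact: measurable_set1..|].
    rewrite [X in (X + _ <= _)%E](lebesgue_measure_set1 0).
    by rewrite [X in (_ + X <= _)%E](lebesgue_measure_set1 1) adde0.
  - by move=> s /= h; apply: contrapT => /not_orP.
apply: filterS2 hP h0 => [|s hs [s0 s1]].
  exact: (ae_filter_ringOfSetsType lebesgue_measure).
rewrite /= in_itv/= => /andP[h1 h2]; apply: hs.
by rewrite !lt_neqAle h1 h2 eq_sym !andbT; apply/andP; split; apply/eqP.
Qed.

(** Measurability is not assumed: the integral of a nonnegative function is a supremum over the
    simple functions below it. The larger function will be the speed built from [derive1], known to
    coincide with a measurable one only almost everywhere. *)
Lemma ge0_le_lower_integral d (T : measurableType d) (mu : {measure set T -> \bar R})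
    (D : set T) (f1 f2 : T -> \bar R) :
  (forall x, D x -> (0 <= f1 x)%E) -> (forall x, D x -> (f1 x <= f2 x)%E) ->
  (\int[mu]_(x in D) f1 x <= \int[mu]_(x in D) f2 x)%E.
Proof.
move=> f10 f12; rewrite !ge0_integralE//; last first.
  by move=> x Dx; apply: le_trans (f12 _ Dx); exact: f10.
apply: le_ereal_sup => _ [h /= hf <-]; exists h => // x.
apply: le_trans (hf x) _; rewrite /patch; case: ifPn => // /set_mem; exact: f12.
Qed.

Lemma ler_sum_sqr (I : Type) (r : seq I) (F : I -> R) : (forall i, 0 <= F i) ->
  \sum_(i <- r) F i ^+ 2 <= (\sum_(i <- r) F i) ^+ 2.
Proof.
move=> F0; elim: r => [|i r IH]; first by rewrite !big_nil expr0n.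
rewrite !big_cons; have : 0 <= \sum_(j <- r) F j by exact: sumr_ge0.
have := F0 i; nra.
Qed.

(** The arc length is the integral of a speed [v] built from the integrable representatives [g i] of
    the derivatives, hence measurable. A lower bound on the length of the curve only needs [ell 1]
    to be at most [hlength cx]. *)
Lemma abs_cont01_length q (cx : 'I_q -> R -> R) : (forall i, abs_cont01 (cx i)) ->
  exists ell : R -> R, [/\ abs_cont01 ell, ell 0 = 0,
    forall b c, b <= c -> ell b <= ell c,
    ((ell 1)%:E <= hlength cx)%E &
    {ae lebesgue_measure, forall s, `[0%R, 1%R]%classic s ->
       [/\ forall i, derivable (cx i) s 1, derivable ell s 1 &
        derive1 ell s = Num.sqrt (\sum_i (derive1 (cx i) s) ^+ 2)]}].
Proof.
move=> accx.
have [g gP] := choice (fun i => abs_cont01_derivable (accx i)).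
pose v (s : R) := Num.sqrt (\sum_i (g i s) ^+ 2).
have v0 s : 0 <= v s by exact: sqrtr_ge0.
have mg i : measurable_fun setT (g i).
  by have [/(measurable_int lebesgue_measure) /measurable_EFinP] := gP i.
have mv : measurable_fun setT v.
  apply: (measurableT_comp (continuous_measurable_fun (@sqrt_continuous R))).
  by apply: measurable_sum => i; exact: measurable_funX.
have iv : lebesgue_measure.-integrable setT (EFin \o v).
  have ig : lebesgue_measure.-integrable setT
      (fun s => \sum_i (abse \o (EFin \o g i)) s)%E.
    by apply: integrable_sum => // i _; apply: integrable_abse; case: (gP i).
  apply: le_integrable ig => //; first exact/measurable_EFinP.
  move=> s _ /=; rewrite sumEFin lee_fin. rewrite (ger0_norm (v0 s)).
  apply: le_trans (ler_norm _).
  rewrite -[leRHS]ger0_norm ?sumr_ge0// -sqrtr_sqr; apply: ler_wsqrtr.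
  apply: le_trans (ler_sum_sqr _ _) => //.
  by apply: ler_sum => i _; rewrite real_normK ?num_real.
have ivS (A : set R) : measurable A -> lebesgue_measure.-integrable A (EFin \o v).
  by move=> mA; exact: integrableS iv.
pose ell s := (\int[lebesgue_measure]_(t in `]0%R, s]) v t)%R.
have ell0 : ell 0 = 0.
  by rewrite /ell set_itv_ge ?bnd_simp ?ltxx// Rintegral_set0.
have ellB b c : b <= c -> 0 <= b ->
    ell c - ell b = (\int[lebesgue_measure]_(t in `]b, c]) v t)%R.
  by move=> bc b0; rewrite /ell Rintegral_itvB// ?bnd_simp//; exact: ivS.
have Rint0 (A : set R) : 0 <= (\int[lebesgue_measure]_(t in A) v t)%R.
  by apply: Rintegral_ge0 => *; exact: v0.
have ae_good : {ae lebesgue_measure, forall s, `[0%R, 1%R]%classic s ->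
   [/\ forall i, derivable (cx i) s 1, derivable ell s 1 /\ derive1 ell s = v s &
       Num.sqrt (\sum_i (derive1 (cx i) s) ^+ 2) = v s]}.
  apply: ae_open_closed01.
  have lv : locally_integrable [set: R] v.
    by have := integrable_locally measurableT (ivS _ measurableT); rewrite patch_setT.
  have FT := FTC1 (a := BRight 0) (fun y => ivS _ (measurable_itv _)) lv.
  have aeF : Filter (almost_everywhere (@lebesgue_measure R)).
    exact: (ae_filter_ringOfSetsType lebesgue_measure).
  have aeg : {ae lebesgue_measure, forall s, forall i, 0 < s < 1 ->
      derivable (cx i) s 1 /\ derive1 (cx i) s = g i s}.
    by apply: filter_forall => i; case: (gP i).
  apply: filterS2 FT aeg => s hs hg s01; split.
  - by move=> i; case: (hg i s01).
  - have s0 : (BRight 0 < BRight s)%O by case/andP: s01 => s0 _; rewrite bnd_simp.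
    exact: hs s0.
  - rewrite /v; congr Num.sqrt; apply: eq_bigr => i _.
    by case: (hg i s01) => _ ->.
exists ell; split => //.
- move=> e e0; have [del [d0 hdel]] := integral_normr_continuous iv e0.
  exists del => // N b c bc dbc sdel.
  pose D := \big[setU/set0]_(i < N) `]b i, c i]%classic.
  have tF : trivIset setT (fun i : 'I_N => `]b i, c i]%classic).
    move=> i j _ _ [x [/=]]; rewrite !in_itv/= => /andP[h1 h2] /andP[h3 h4].
    apply/eqP; apply: contraT => ij; exfalso.
    by case: (dbc i j ij) => h; lra.
  have mF (i : 'I_N) : measurable `]b i, c i]%classic by exact: measurable_itv.
  have mD : measurable D by exact: bigsetU_measurable.
  have muD : lebesgue_measure D = (\sum_(i < N) (c i - b i))%:E.
    rewrite /D measure_bigsetU_ord//= -sumEFin; apply: eq_bigr => i _.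
    apply: (eq_trans (lebesgue_measure_itv _)); have [_ bci _] := bc i.
    rewrite /= lte_fin; case: ltP => // cbi.
    by have -> : c i = b i by [apply/eqP; rewrite eq_le cbi]; rewrite subrr.
  have muDlt : (lebesgue_measure D < del%:E)%E by rewrite muD lte_fin.
  have := hdel D mD muDlt; congr (_ < _).
  rewrite /Rintegral.
  under eq_integral => x _ do rewrite (ger0_norm (v0 x)).
  rewrite /D ge0_integral_bigsetU//; last 4 first.
  + exact: index_enum_uniq.
  + by move=> i j _ _; exact: tF.
  + by apply/measurable_EFinP; exact: measurable_funTS.
  + by move=> x _; rewrite lee_fin.
  rewrite -sum_fine; last first.
    by move=> i _; apply: integrable_fin_num => //; exact: ivS.
  apply: eq_bigr => i _; have [b0 bci c1] := bc i.
  by rewrite (ellB _ _ bci b0) ger0_norm.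
- move=> b c bc; rewrite -subr_ge0.
  have [b0|b0] := leP 0 b; first by rewrite ellB.
  have -> : ell b = 0.
    by rewrite /ell set_itv_ge ?Rintegral_set0// bnd_simp -leNgt ltW.
  by rewrite subr0; exact: Rint0.
- rewrite [leLHS](_ : _ = \int[lebesgue_measure]_(t in `]0%R, 1%R]) (v t)%:E)%E; last first.
    by rewrite fineK//; apply: integrable_fin_num => //; exact: ivS.
  (* The two speeds agree outside [N]. Removing [N] leaves the integral of [v] unchanged, and what
     remains lies below the integrand of [hlength] at every point. *)
  have [N [mN N0 hN]] := ae_good.
  apply: (@le_trans _ _ (\int[lebesgue_measure]_(t in `[0%R, 1%R]) (v t)%:E)%E).
    apply: ge0_subset_integral => //.
    - by apply/measurable_EFinP; exact: measurable_funTS.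
    - by move=> x _; rewrite lee_fin.
    - by apply: subset_itvr; rewrite bnd_simp.
  rewrite (ge0_negligible_integral mN)//; last 2 first.
  - by apply/measurable_EFinP; exact: measurable_funTS.
  - by move=> x _; rewrite lee_fin.
  rewrite setDE integral_mkcondr; apply: ge0_le_lower_integral => s.
    by move=> _; rewrite /patch; case: ifP => //; rewrite lee_fin.
  move=> s01; rewrite /patch; case: ifPn; last by rewrite lee_fin sqrtr_ge0.
  move=> /set_mem sN; rewrite lee_fin.
  have /contrapT/(_ s01)[_ _ <-] // := fun h => sN (hN s h).
- move: ae_good; apply: filterS => [|s hs s01].
    exact: (ae_filter_ringOfSetsType lebesgue_measure).
  by have [h1 [h2 h2'] h3] := hs s01; split; rewrite ?h2' ?h3.
Qed.

End length_function.

(** * Linear algebra of the structure matrices *)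

Section structure_matrices.
Context {R : realType} (q m : nat) (U : 'I_m -> 'M[R]_q) (s : 'I_q -> R).
Hypothesis s_gt0 : forall i, 0 < s i.
Hypothesis U_skew : forall j, (U j)^T = - U j.

(** The matrix h(S) of the functional calculus of S. *)
Definition wdiag (h : R -> R) : 'M[R]_q := diag_mx (\row_i h (s i)).

Hypothesis U_rel : forall lam lam' : 'rV[R]_m,
  - (Amat U lam *m Amat U lam' + Amat U lam' *m Amat U lam)
  = (2 * ip lam lam') *: wdiag (fun u => u ^+ 2).
Implicit Types (h : R -> R) (w : 'rV[R]_q) (th : 'rV[R]_m).

Definition qform w (M : 'M[R]_q) : R := (w *m M *m w^T) 0 0.

Lemma qformT w M : qform w M^T = qform w M.
Proof.
rewrite /qform; have -> : w *m M^T *m w^T = (w *m M *m w^T)^T by rewrite !trmx_mul trmxK mulmxA.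
by rewrite mxE.
Qed.

Lemma qformD w M M' : qform w (M + M') = qform w M + qform w M'.
Proof. by rewrite /qform mulmxDr mulmxDl mxE. Qed.

Lemma qformZ w c M : qform w (c *: M) = c * qform w M.
Proof. by rewrite /qform -scalemxAr -scalemxAl mxE. Qed.

Lemma qformN w M : qform w (- M) = - qform w M.
Proof. by rewrite -scaleN1r qformZ mulN1r. Qed.

Lemma qform_skew w M : M^T = - M -> qform w M = 0.
Proof. by move=> MT; have := qformT w M; rewrite MT qformN; lra. Qed.

Lemma qform_wdiag w h : qform w (wdiag h) = \sum_i h (s i) * w 0 i ^+ 2.
Proof.
rewrite /qform /wdiag mul_mx_diag mxE; apply: eq_bigr => i _.
by rewrite !mxE; ring.
Qed.

Lemma wdiag_tr h : (wdiag h)^T = wdiag h.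
Proof. exact: tr_diag_mx. Qed.

Lemma wdiagM h h' : wdiag h *m wdiag h' = wdiag (fun u => h u * h' u).
Proof.
rewrite /wdiag mulmx_diag; congr diag_mx; apply/rowP => i.
by rewrite !mxE.
Qed.

Lemma Amat_skew th : (Amat U th)^T = - Amat U th.
Proof.
apply/matrixP => a b; rewrite !mxE !summxE -sumrN; apply: eq_bigr => j _.
have := congr1 (fun M : 'M[R]_q => M a b) (U_skew j).
by rewrite !mxE => ->; rewrite mulrN.
Qed.

Lemma Amat_unit j : Amat U (unit_rv j) = U j.
Proof.
rewrite /Amat (bigD1 j)//= mxE !eqxx scale1r big1 ?addr0// => i ij.
by rewrite mxE (negbTE ij) andbF scale0r.
Qed.

Lemma Amat_sqr th : Amat U th *m Amat U th = - ip th th *: wdiag (fun u => u ^+ 2).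
Proof.
have := U_rel th th; rewrite -mulr2n -scaler_nat -scalerN => /(congr1 (fun M => 2^-1 *: M)).
rewrite !scalerA mulVf ?pnatr_eq0// mulrA mulVf ?pnatr_eq0// scale1r mul1r => h.
by rewrite scaleNr -h opprK.
Qed.

Lemma ip_ge0 N (v : 'rV[R]_N) : 0 <= ip v v.
Proof. by apply: sumr_ge0 => i _; rewrite -expr2 sqr_ge0. Qed.

Lemma ip_eq0 N (v : 'rV[R]_N) : (ip v v == 0) = (v == 0).
Proof.
apply/idP/eqP => [|->]; last by rewrite /ip big1// => i _; rewrite mxE mul0r.
rewrite /ip psumr_eq0 => [/allP h|i _]; last by rewrite -expr2 sqr_ge0.
apply/rowP => i; rewrite mxE; have := h i (mem_index_enum _).
by rewrite -expr2 sqrf_eq0 => /eqP.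
Qed.

(** A(th) commutes with its own square, a nonzero multiple of S^2, so it preserves the eigenspaces
    of S. *)
Lemma Amat_block th i i' : s i != s i' -> Amat U th i i' = 0.
Proof.
move=> sii'; have [->|th0] := eqVneq th 0.
  by rewrite /Amat big1 ?mxE// => j _; rewrite mxE scale0r.
have : Amat U th *m (Amat U th *m Amat U th) = (Amat U th *m Amat U th) *m Amat U th.
  by rewrite mulmxA.
rewrite Amat_sqr -scalemxAr -scalemxAl => /(congr1 (fun M : 'M[R]_q => M i i')).
rewrite /wdiag mul_mx_diag mul_diag_mx !mxE.
have ip0 : - ip th th != 0 by rewrite oppr_eq0 ip_eq0.
move=> /(mulfI ip0)/eqP; rewrite mulrC -subr_eq0 -mulrBl mulf_eq0 => /orP[|/eqP//].
rewrite subr_eq0 eqrXn2 ?(ltW (s_gt0 _))//.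
by rewrite eq_sym (negbTE sii').
Qed.

Lemma Amat_wdiagC th h : Amat U th *m wdiag h = wdiag h *m Amat U th.
Proof.
rewrite /wdiag mul_mx_diag mul_diag_mx; apply/matrixP => i i'; rewrite !mxE.
have [->|/Amat_block ->] := eqVneq (s i) (s i'); first by rewrite mulrC.
by rewrite mulr0 mul0r.
Qed.

Lemma U_wdiagC j h : U j *m wdiag h = wdiag h *m U j.
Proof. by rewrite -Amat_unit Amat_wdiagC. Qed.

Lemma qform_wA w th h : qform w (wdiag h *m Amat U th) = 0.
Proof.
by apply: qform_skew; rewrite trmx_mul Amat_skew wdiag_tr mulNmx Amat_wdiagC.
Qed.

Lemma qform_wAA w th h :
  qform w (wdiag h *m (Amat U th *m Amat U th)) =
  - (ip th th * \sum_i h (s i) * s i ^+ 2 * w 0 i ^+ 2).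
Proof.
rewrite Amat_sqr -scalemxAr qformZ wdiagM qform_wdiag mulNr.
by congr (- (_ * _)); apply: eq_bigr => i _; rewrite mulrA.
Qed.

Lemma ip_unit th j : ip th (unit_rv j) = th 0 j.
Proof.
rewrite /ip (bigD1 j)//= mxE !eqxx mulr1 big1 ?addr0// => i ij.
by rewrite mxE (negbTE ij) andbF mulr0.
Qed.

(** The polarized relation only gives the sum U_j A + A U_j. The two weighted products are
    transposes of each other, so they have the same quadratic form and each contributes half. *)
Lemma qform_wUA w th j h :
  qform w (wdiag h *m (U j *m Amat U th)) =
  - (th 0 j * \sum_i h (s i) * s i ^+ 2 * w 0 i ^+ 2)
  /\ qform w (wdiag h *m (Amat U th *m U j)) =
  - (th 0 j * \sum_i h (s i) * s i ^+ 2 * w 0 i ^+ 2).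
Proof.
have E : qform w (wdiag h *m (U j *m Amat U th)) = qform w (wdiag h *m (Amat U th *m U j)).
  rewrite -qformT !trmx_mul wdiag_tr Amat_skew U_skew mulNmx mulmxN opprK.
  by rewrite -mulmxA U_wdiagC [in LHS]mulmxA Amat_wdiagC mulmxA.
have := congr1 (fun M => qform w (wdiag h *m M)) (U_rel th (unit_rv j)).
rewrite Amat_unit ip_unit mulmxN mulmxDr qformN qformD -E -scalemxAr qformZ wdiagM.
rewrite qform_wdiag.
by lra.
Qed.

Lemma qform_wU w j h : qform w (wdiag h *m U j) = 0.
Proof. by rewrite -Amat_unit qform_wA. Qed.

Definition Avec th w : 'rV[R]_q := w *m (Amat U th)^T.

Lemma AvecE th w i : Avec th w 0 i = \sum_i' Amat U th i i' * w 0 i'.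
Proof. by rewrite /Avec mxE; apply: eq_bigr => i' _; rewrite mxE mulrC. Qed.

(* With x = P w + K A w and x' = P' w + K' A w (P, K, P', K' functions of S),
   this evaluates the drift <U_j x, x'> of the vertical coordinate. *)
Lemma drift_form w th j (p k p' k' : R -> R) :
  \sum_i \sum_i' U j i i' * (p (s i') * w 0 i' + k (s i') * Avec th w 0 i')
     * (p' (s i) * w 0 i + k' (s i) * Avec th w 0 i)
  = th 0 j * \sum_i (p (s i) * k' (s i) - k (s i) * p' (s i)) * s i ^+ 2 * w 0 i ^+ 2.
Proof.
pose A := Amat U th.
pose X := w *m (wdiag p + A^T *m wdiag k).
pose Y := w *m (wdiag p' + A^T *m wdiag k').
have XE i : X 0 i = p (s i) * w 0 i + k (s i) * Avec th w 0 i.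
  by rewrite /X mulmxDr mulmxA /wdiag !mul_mx_diag !mxE [w 0 i * _]mulrC
    [_ * k _]mulrC.
have YE i : Y 0 i = p' (s i) * w 0 i + k' (s i) * Avec th w 0 i.
  by rewrite /Y mulmxDr mulmxA /wdiag !mul_mx_diag !mxE [w 0 i * _]mulrC
    [_ * k' _]mulrC.
transitivity ((Y *m U j *m X^T) 0 0).
  rewrite mxE; under [RHS]eq_bigr do rewrite [X^T _ _]mxE [(Y *m _) _ _]mxE big_distrl/=.
  rewrite exchange_big/=; apply: eq_bigr => i _; apply: eq_bigr => i' _.
  by rewrite XE YE; ring.
transitivity (qform w ((wdiag p' + A^T *m wdiag k') *m U j *m
    (wdiag p + A^T *m wdiag k)^T)).
  by rewrite /qform /X /Y trmx_mul !mulmxA.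
rewrite linearD /= trmx_mul trmxK !wdiag_tr /A Amat_skew !mulNmx.
rewrite mulmxDr !mulmxDl !mulNmx !qformD !qformN.
have -> : wdiag p' *m U j *m wdiag p = wdiag (fun u => p' u * p u) *m U j.
  by rewrite -mulmxA U_wdiagC mulmxA wdiagM.
have -> : wdiag p' *m U j *m (wdiag k *m Amat U th) =
    wdiag (fun u => p' u * k u) *m (U j *m Amat U th).
  by rewrite mulmxA -[_ *m U j *m _]mulmxA U_wdiagC mulmxA wdiagM mulmxA.
have -> : Amat U th *m wdiag k' *m U j *m wdiag p =
    wdiag (fun u => k' u * p u) *m (Amat U th *m U j).
  by rewrite Amat_wdiagC -mulmxA U_wdiagC mulmxA -[_ *m Amat U th *m _]mulmxA
    Amat_wdiagC mulmxA wdiagM mulmxA.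
have -> : Amat U th *m wdiag k' *m U j *m (wdiag k *m Amat U th) =
    wdiag (fun u => k' u * k u) *m (Amat U th *m U j *m Amat U th).
  rewrite mulmxA Amat_wdiagC -!mulmxA [U j *m (_ *m _)]mulmxA U_wdiagC.
  by rewrite -mulmxA [Amat U th *m (wdiag k *m _)]mulmxA Amat_wdiagC -mulmxA
    [wdiag k' *m _]mulmxA wdiagM.
(* A U_j A is skew and commutes with functions of S, so this term has no quadratic form. *)
have -> : qform w (wdiag (fun u => k' u * k u) *m (Amat U th *m U j *m Amat U th)) = 0.
  apply: qform_skew; rewrite !trmx_mul wdiag_tr !Amat_skew U_skew.
  rewrite !(mulNmx, mulmxN) opprK; congr (- _).
  rewrite -!mulmxA Amat_wdiagC [U j *m (wdiag _ *m _)]mulmxA U_wdiagC -mulmxA.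
  by rewrite [Amat U th *m (wdiag _ *m _)]mulmxA Amat_wdiagC -mulmxA.
rewrite qform_wU (qform_wUA _ _ _ _).1 (qform_wUA _ _ _ _).2 !(add0r, addr0, oppr0, opprD, opprK).
rewrite -mulrN -mulrDr -sumrN -big_split/=; congr (_ * _); apply: eq_bigr => i _.
by ring.
Qed.

Lemma sum_wAvec0 w th h : \sum_i h (s i) * (w 0 i * Avec th w 0 i) = 0.
Proof.
rewrite -[RHS](qform_wA w th h) -qformT trmx_mul wdiag_tr.
rewrite /qform mulmxA -/(Avec th w) /wdiag mul_mx_diag mxE; apply: eq_bigr => i _.
rewrite !mxE; ring.
Qed.

Lemma sum_wAvec2 w th h : \sum_i h (s i) * Avec th w 0 i ^+ 2 =
  ip th th * \sum_i h (s i) * s i ^+ 2 * w 0 i ^+ 2.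
Proof.
rewrite -qform_wdiag /qform /Avec trmx_mul trmxK !mulmxA.
transitivity (qform w ((Amat U th)^T *m wdiag h *m Amat U th)).
  by rewrite /qform !mulmxA.
rewrite Amat_skew mulNmx Amat_wdiagC mulNmx -mulmxA qformN qform_wAA.
by rewrite opprK.
Qed.

Lemma enorm2 N (v : 'rV[R]_N) : enorm v ^+ 2 = ip v v.
Proof. by rewrite sqr_sqrtr// ip_ge0. Qed.

End structure_matrices.

(** * Pointwise differentiation rules *)

Section derive_pointwise.
Context {R : realType} {V : normedModType R}.
Implicit Types (f g : V -> R) (x v : V).

Lemma is_deriveD_fun f g x v df dg : is_derive x v f df -> is_derive x v g dg ->
  is_derive x v (fun y => f y + g y) (df + dg).
Proof. exact: is_deriveD. Qed.

Lemma is_deriveB_fun f g x v df dg : is_derive x v f df -> is_derive x v g dg ->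
  is_derive x v (fun y => f y - g y) (df - dg).
Proof. exact: is_deriveB. Qed.

Lemma is_deriveM_fun f g x v df dg : is_derive x v f df -> is_derive x v g dg ->
  is_derive x v (fun y => f y * g y) (df * g x + f x * dg).
Proof.
move=> hf hg; have := is_deriveM hf hg.
by rewrite [X in is_derive _ _ _ X -> _]addrC /GRing.scale/= [g x * df]mulrC.
Qed.

Lemma is_deriveZ_fun f (c : R) x v df : is_derive x v f df ->
  is_derive x v (fun y => c * f y) (c * df).
Proof. exact: is_deriveZ. Qed.

Lemma is_derive_sum_seq (I : Type) (r : seq I) (F : I -> V -> R) x v (dF : I -> R) :
  (forall i, is_derive x v (F i) (dF i)) ->
  is_derive x v (fun y => \sum_(i <- r) F i y) (\sum_(i <- r) dF i).
Proof.
move=> h; elim: r => [|i r IH].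
  rewrite big_nil (_ : (fun _ => _) = cst 0); first exact: is_derive_cst.
  by apply/funext => y; rewrite big_nil.
rewrite big_cons (_ : (fun _ => _) = (fun y => F i y + \sum_(j <- r) F j y)).
  exact: is_deriveD_fun.
by apply/funext => y; rewrite big_cons.
Qed.

(** Directional derivatives are derivatives along a line; the chain rule thus reduces to one
    variable, without Frechet differentiability. *)
Lemma is_derive_lineP f x v df :
  is_derive x v f df <-> is_derive (0 : R) 1 (fun s => f (s *: v + x)) df.
Proof.
have E : (fun h : R => h^-1 *: ((f \o shift x) (h *: v) - f x)) =
    (fun h : R => h^-1 *: (((fun s => f (s *: v + x)) \o shift 0) (h *: (1 : R))
      - f (0 *: v + x))).
  by apply/funext => h /=; rewrite scale0r add0r addr0 /GRing.scale/= mulr1.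
by split => -[h1 h2]; split; move: h1 h2; rewrite /derivable /derive E.
Qed.

Lemma is_derive_comp_fun (f : R -> R) g x v df dg : is_derive (g x) 1 f df ->
  is_derive x v g dg -> is_derive x v (fun y => f (g y)) (df * dg).
Proof.
move=> hf /is_derive_lineP hg; apply/is_derive_lineP.
have hf' : is_derive (g (0 *: v + x)) 1 f df by rewrite scale0r add0r.
by have := is_derive1_comp hf' hg; rewrite mulrC.
Qed.

Lemma is_deriveV_fun f x v df : f x != 0 -> is_derive x v f df ->
  is_derive x v (fun y => (f y)^-1) (- df / f x ^+ 2).
Proof.
move=> fx hf.
have hi := @is_deriveV R (@idfun R) (f x) 1 1 fx (is_derive_id _ _).
apply: (is_derive_eq (is_derive_comp_fun hi hf)).
by rewrite /GRing.scale/= mulr1; field.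
Qed.

Lemma is_derive_continuous1 (f : R -> R) (x df : R) : is_derive x 1 f df ->
  {for x, continuous f}.
Proof.
by move=> [h _]; apply: differentiable_continuous; exact/derivable1_diffP.
Qed.

Lemma is_derive_derivable f x v df : is_derive x v f df -> derivable f x v.
Proof. by case. Qed.

Lemma is_derive_val f x v df : is_derive x v f df -> derive f x v = df.
Proof. by case. Qed.

End derive_pointwise.

Lemma cvg_sum_seq {R : realType} {T : Type} (F : set_system T) {FF : Filter F}
    (I : Type) (r : seq I) (f : I -> T -> R) (a : I -> R) :
  (forall i, f i x @[x --> F] --> a i) ->
  (\sum_(i <- r) f i x) @[x --> F] --> \sum_(i <- r) a i.
Proof.
move=> h; elim: r => [|i r IH].
  rewrite big_nil (_ : (fun _ => _) = cst 0); first exact: cvg_cst.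
  by apply/funext => y; rewrite big_nil.
rewrite big_cons (_ : (fun _ => _) = (fun y => f i y + \sum_(j <- r) f j y)).
  exact: cvgD.
by apply/funext => y; rewrite big_cons.
Qed.

Section derive_one.
Context {R : realType}.

Lemma derive1_is_derive (f : R -> R) (x : R) : derivable f x 1 -> is_derive x 1 f (derive1 f x).
Proof. by move=> h; split => //; rewrite derive1E. Qed.

Lemma is_derive_derive1 (f : R -> R) (x df : R) : is_derive x 1 f df -> derive1 f x = df.
Proof. by rewrite derive1E; case. Qed.

Lemma C1_lipschitz (f df : R -> R) (a b : R) : a <= b ->
  (forall x, a <= x <= b -> is_derive x 1 f (df x)) ->
  (forall x, a <= x <= b -> {for x, continuous df}) ->
  exists2 K : R, 0 <= K & forall x y, a <= x -> x <= y -> y <= b ->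
    `|f y - f x| <= K * (y - x).
Proof.
move=> ab hf cdf.
have [|c cab hc] := @EVT_max _ (fun x => `|df x|) a b ab.
  apply: continuous_in_subspaceT => x; rewrite inE/= in_itv/= => xab.
  by apply: continuous_comp; [exact: cdf|exact: norm_continuous].
exists `|df c| => // x y ax xy yb.
have [||z zxy ->] := @MVT_segment _ f df x y xy.
- move=> z; rewrite in_itv/= => /andP[h1 h2]; apply: hf; lra.
- apply: derivable_within_continuous => z; rewrite in_itv/= => /andP[h1 h2].
  have [] // : is_derive z 1 f (df z) by apply: hf; lra.
rewrite normrM [`|y - x|]ger0_norm ?subr_ge0// ler_wpM2r ?subr_ge0//.
by apply: hc; move: zxy; rewrite !in_itv/=; lra.
Qed.
End derive_one.

(** * Closure properties of absolute continuity *)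

Section AC_closure.
Context {R : realType}.
Implicit Types (f g F : R -> R).

Lemma abs_cont01_cst (c : R) : abs_cont01 (fun=> c).
Proof.
move=> e e0; exists 1 => // N b d _ _ _.
by rewrite big1// => i _; rewrite subrr normr0.
Qed.

Lemma abs_cont01D f g : abs_cont01 f -> abs_cont01 g -> abs_cont01 (fun s => f s + g s).
Proof.
move=> acf acg; apply: (abs_cont01_dominated (K := 1) acf acg) => b c _ _ _.
rewrite mul1r (_ : _ - _ = (f c - f b) + (g c - g b)); last by ring.
exact: ler_normD.
Qed.

Lemma abs_cont01M f g : abs_cont01 f -> abs_cont01 g -> abs_cont01 (fun s => f s * g s).
Proof.
move=> acf acg; have [M fM] := abs_cont01_bounded acf.
have [N gN] := abs_cont01_bounded acg.
apply: (abs_cont01_dominated (K := Num.max M N) acf acg) => b c b0 bc c1.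
rewrite (_ : _ - _ = (f c - f b) * g b + f c * (g c - g b)); last by ring.
apply: le_trans (ler_normD _ _) _; rewrite !normrM mulrDr [`|_ - _| * `|g b|]mulrC.
apply: lerD; apply: ler_wpM2r => //; rewrite le_max.
  by rewrite gN ?orbT// b0 (le_trans bc).
by rewrite fM// c1 andbT (le_trans b0).
Qed.

Lemma abs_cont01_sum (I : Type) (r : seq I) (F : I -> R -> R) :
  (forall i, abs_cont01 (F i)) -> abs_cont01 (fun s => \sum_(i <- r) F i s).
Proof.
move=> h; elim: r => [|i r IH].
  rewrite (_ : (fun _ => _) = (fun=> 0)); first exact: abs_cont01_cst.
  by apply/funext => s; rewrite big_nil.
rewrite (_ : (fun _ => _) = (fun s => F i s + \sum_(j <- r) F j s)).
  exact: abs_cont01D.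
by apply/funext => s; rewrite big_cons.
Qed.

Lemma abs_cont01_lipschitz (h : R -> R) f (K : R) : abs_cont01 f -> 
  (forall b c, 0 <= b -> b <= c -> c <= 1 ->
     `|h (f c) - h (f b)| <= K * `|f c - f b|) -> abs_cont01 (fun s => h (f s)).
Proof.
move=> acf hK; apply: (abs_cont01_dominated (K := K) acf (abs_cont01_cst 0)).
by move=> b c b0 bc c1; rewrite subrr normr0 addr0; exact: hK.
Qed.

End AC_closure.

(** * The lower bound on the length of a horizontal curve *)

Section riccati.
Context {R : realType}.

(** The solution of the Riccati equation y' = - (al^2 + y^2) with its pole at u = 0; for al = 0 it
    is the limit 1 / u. *)
Definition acot (al u : R) : R := if al == 0 then u^-1 else al * cos (al * u) / sin (al * u).

Lemma acot1 (al : R) : acot al 1 = scot al.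
Proof. by rewrite /acot /scot; case: eqP => _; rewrite ?invr1 ?mulr1. Qed.

Lemma is_derive_sin_comp (al u : R) : is_derive u 1 (fun y => sin (al * y)) (al * cos (al * u)).
Proof.
apply: (is_derive_eq (is_derive_comp_fun (is_derive_sin _) (is_deriveZ_fun al (is_derive_id u 1)))).
by rewrite mulr1 mulrC.
Qed.

Lemma is_derive_cos_comp (al u : R) : is_derive u 1 (fun y => cos (al * y)) (- al * sin (al * u)).
Proof.
apply: (is_derive_eq (is_derive_comp_fun (is_derive_cos _) (is_deriveZ_fun al (is_derive_id u 1)))).
by rewrite mulr1 mulrC mulrN mulNr.
Qed.

Lemma is_derive_acot (al u : R) : 0 <= al < pi -> 0 < u <= 1 ->
  is_derive u 1 (acot al) (- (al ^+ 2 + acot al u ^+ 2)).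
Proof.
move=> /andP[al0 alpi] /andP[u0 u1]; rewrite /acot; case: eqVneq => [->|aln0].
  apply: (is_derive_eq (is_deriveV_fun _ (is_derive_id u 1))); first by rewrite gt_eqF.
  by rewrite /=; field; rewrite gt_eqF.
have s0 : 0 < sin (al * u).
  have algt0 : 0 < al by rewrite lt_neqAle eq_sym aln0.
  apply: sin_gt0_pi; rewrite mulr_gt0//=.
  by apply: le_lt_trans alpi; rewrite ler_piMr.
have sn0 : sin (al * u) != 0 by rewrite gt_eqF.
apply: (is_derive_eq (is_deriveM_fun (is_deriveZ_fun al (is_derive_cos_comp al u))
  (is_deriveV_fun sn0 (is_derive_sin_comp al u)))).
by field.
Qed.

Lemma acot_lipschitz (al e : R) : 0 <= al < pi -> 0 < e <= 1 ->
  exists2 K : R, 0 <= K & forall x y, e <= x -> x <= y -> y <= 1 ->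
    `|acot al y - acot al x| <= K * (y - x).
Proof.
move=> alpi /andP[e0 e1].
apply: (C1_lipschitz e1 (df := fun u => - (al ^+ 2 + acot al u ^+ 2))).
  by move=> x /andP[ex x1]; apply: is_derive_acot => //; rewrite (lt_le_trans e0).
move=> x /andP[ex x1]; have x01 : 0 < x <= 1 by rewrite (lt_le_trans e0).
have h := is_derive_acot alpi x01.
have h2 := is_deriveM_fun h h.
have h3 := is_deriveB_fun (is_derive_cst (- al ^+ 2) x 1) h2.
have -> : (fun u => - (al ^+ 2 + acot al u ^+ 2)) =
   (fun u => cst (- al ^+ 2) u - acot al u * acot al u).
  by apply/funext => u; rewrite /cst opprD expr2.
exact: is_derive_continuous1 h3.
Qed.

End riccati.

Section lower_bound.
Context {R : realType} (n m : nat) (U : 'I_m -> 'M[R]_(2 * n)) (s : 'I_(2 * n) -> R).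
Hypothesis s_gt0 : forall i, 0 < s i.
Hypothesis s_le1 : forall i, s i <= 1.
Hypothesis U_skew : forall j, (U j)^T = - U j.
Hypothesis U_rel : forall lam lam' : 'rV[R]_m,
  - (Amat U lam *m Amat U lam' + Amat U lam' *m Amat U lam)
  = (2 * ip lam lam') *: wdiag s (fun u => u ^+ 2).

(* The Hamilton-Jacobi (calibration) inequality, with the Riccati solution evaluated
   at the normalized length (ell + eta) / M instead of at the time: no constant-speed
   reparametrization is needed, and eta > 0 avoids the singularity at the origin. *)
Lemma calibration_pointwise (tau : 'rV[R]_m) (Q : R -> R) (M v : R) (x x' : 'rV[R]_(2 * n)) :
  0 < M -> v = Num.sqrt (\sum_i x' 0 i ^+ 2) ->
  \sum_i (- ((s i * enorm tau) ^+ 2 + Q (s i) ^+ 2) * (v / M) * x 0 i ^+ 2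
          + Q (s i) * (2 * x 0 i * x' 0 i))
  + 2 * \sum_i Avec U tau x 0 i * x' 0 i <= M * v.
Proof.
(* [y] is half the horizontal gradient of the calibrating function. Since A is skew, its squared
   norm is exactly the sum that the Riccati equation subtracts. *)
move=> M0 vE; pose y i := Q (s i) * x 0 i + Avec U tau x 0 i.
have v0 : 0 <= v by rewrite vE sqrtr_ge0.
have v2 : v ^+ 2 = \sum_i x' 0 i ^+ 2.
  by rewrite vE sqr_sqrtr// sumr_ge0// => i _; rewrite sqr_ge0.
have Y2 : \sum_i y i ^+ 2 = \sum_i ((s i * enorm tau) ^+ 2 + Q (s i) ^+ 2) * x 0 i ^+ 2.
  have -> : \sum_i y i ^+ 2 = \sum_i (Q (s i) ^+ 2 * x 0 i ^+ 2)
     + (\sum_i (2 * Q (s i)) * (x 0 i * Avec U tau x 0 i)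
     + \sum_i 1 * Avec U tau x 0 i ^+ 2).
    by rewrite -!big_split/=; apply: eq_bigr => i _; rewrite /y; ring.
  rewrite (sum_wAvec0 s_gt0 U_skew U_rel x tau (fun u => 2 * Q u)) add0r.
  rewrite (sum_wAvec2 s_gt0 U_skew U_rel x tau (fun=> 1)) -enorm2 mulr_sumr -big_split/=.
  by apply: eq_bigr => i _; ring.
have -> : \sum_i (- ((s i * enorm tau) ^+ 2 + Q (s i) ^+ 2) * (v / M) * x 0 i ^+ 2
          + Q (s i) * (2 * x 0 i * x' 0 i)) + 2 * \sum_i Avec U tau x 0 i * x' 0 i
   = \sum_i (2 * y i * x' 0 i) - v / M * \sum_i y i ^+ 2.
  rewrite Y2 !mulr_sumr -sumrB -big_split/=.
  by apply: eq_bigr => i _; rewrite /y; ring.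
have [v00|vn0] := eqVneq v 0.
  rewrite v00 mul0r mulr0 mul0r subr0 big1// => i _.
  move: v2; rewrite v00 expr0n/= => /esym/eqP; rewrite psumr_eq0; last first.
    by move=> k _; rewrite sqr_ge0.
  move=> /allP/(_ i (mem_index_enum _)); rewrite implyTb sqrf_eq0 => /eqP ->.
  by rewrite mulr0.
have vgt0 : 0 < v by rewrite lt_neqAle eq_sym vn0.
(* Arithmetic-geometric mean with weights v / M and M / v: the terms in [y] cancel the Riccati term,
   and |x'|^2 = v^2 leaves M v. *)
suff h i : 2 * y i * x' 0 i <= v / M * y i ^+ 2 + M / v * x' 0 i ^+ 2.
  rewrite lerBlDl; apply: le_trans (ler_sum _ (fun i _ => h i)) _.
  rewrite big_split/= -!mulr_sumr -v2.
  by rewrite le_eqVlt; apply/orP; left; apply/eqP; field; rewrite gt_eqF.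
have := sqr_ge0 (v * y i - M * x' 0 i) => h.
rewrite -subr_ge0.
have -> : v / M * y i ^+ 2 + M / v * x' 0 i ^+ 2 - 2 * y i * x' 0 i
    = (v * y i - M * x' 0 i) ^+ 2 / (v * M).
  by field; rewrite !gt_eqF.
by rewrite divr_ge0// mulr_ge0// ltW.
Qed.

(** [E] is the arc length of the curve, fixed before [tau], so that one and the same bound can be
    passed to the limit |tau| -> pi. *)
Lemma hcurve_lower_bound (g : pt n m) cx ct : hcurve U g cx ct ->
  exists2 E : R, 0 <= E /\ (E%:E <= hlength cx)%E &
    forall tau : 'rV[R]_m, enorm tau < pi ->
    4 * ip g.2 tau + \sum_i g.1 0 i ^+ 2 * scot (s i * enorm tau) <= E ^+ 2.
Proof.
move=> [hcx hct hae].
have accx i : abs_cont01 (cx i) by have [] := hcx i.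
have acct j : abs_cont01 (ct j) by have [] := hct j.
have [ell [acell ell0 nd_ell ell1 ael]] := abs_cont01_length accx.
have E0 : 0 <= ell 1 by rewrite -ell0 nd_ell.
exists (ell 1) => // tau taupi.
apply/ler_addgt0Pr => e e0.
(* The calibration yields [M * ell 1 = ell 1 ^+ 2 + eta * ell 1]; this [eta] makes the excess at
   most e. *)
pose eta := e / (ell 1 + 1).
have eta0 : 0 < eta by rewrite divr_gt0// ltr_wpDl.
have etaE : eta * ell 1 <= e.
  rewrite /eta mulrAC ler_pdivrMr ?ltr_wpDl// ler_pM2l//.
  by rewrite lerDl.
pose M := ell 1 + eta; have M0 : 0 < M by rewrite ltr_wpDl.
pose z t := (ell t + eta) / M.
have z01 t : 0 <= t <= 1 -> eta / M <= z t <= 1.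
  move=> /andP[t0 t1]; rewrite /z ler_pM2r ?invr_gt0// lerDr -ell0 nd_ell//=.
  by rewrite ler_pdivrMr// mul1r lerD2r nd_ell.
have em0 : 0 < eta / M by rewrite divr_gt0.
have em1 : eta / M <= 1.
  by have := z01 0; rewrite lexx ler01 => /(_ isT)/andP[]; exact: le_trans.
have r0 : 0 <= enorm tau by exact: sqrtr_ge0.
have alpi i : 0 <= s i * enorm tau < pi.
  apply/andP; split; first by rewrite mulr_ge0// ltW.
  by apply: le_lt_trans taupi; rewrite ler_piMl.
pose Q t u := acot (u * enorm tau) (z t).
(* The calibrating function along the curve minus its bound. It vanishes at 0 because z(0) = eta / M
   > 0 keeps the Riccati factor finite while x(0) = 0. *)
pose F t := \sum_i Q t (s i) * (cx i t * cx i t) + 4 * (\sum_j tau 0 j * ct j t) - M * ell t.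
have acz : abs_cont01 z.
  apply: (abs_cont01_lipschitz (h := fun y => (y + eta) / M) (K := M^-1) acell).
  move=> b c _ _ _; rewrite -mulrBl normrM mulrC ger0_norm ?invr_ge0 ?(ltW M0)//.
  by have -> : ell c + eta - (ell b + eta) = ell c - ell b by ring.
have acQ i : abs_cont01 (fun t => Q t (s i)).
  have [K K0 hK] := acot_lipschitz (alpi i) (introT andP (conj em0 em1)).
  apply: (abs_cont01_lipschitz (h := acot (s i * enorm tau)) (K := K) acz).
  move=> b c b0 bc c1.
  have zbc : z b <= z c by rewrite /z ler_pM2r ?invr_gt0// lerD2r nd_ell.
  rewrite [`|z c - _|]ger0_norm ?subr_ge0//; apply: hK => //.
    by have /andP[] : eta / M <= z b <= 1 by apply: z01; rewrite b0 (le_trans bc).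
  by have /andP[] : eta / M <= z c <= 1 by apply: z01; rewrite c1 (le_trans b0).
have acF : abs_cont01 F.
  apply: abs_cont01B.
    apply: abs_cont01D.
      by apply: abs_cont01_sum => i; apply: abs_cont01M => //; exact: abs_cont01M.
    apply: (abs_cont01M (abs_cont01_cst 4)); apply: abs_cont01_sum => j.
    exact: (abs_cont01M (abs_cont01_cst _)).
  exact: (abs_cont01M (abs_cont01_cst _)).
have F0 : F 0 = 0.
  rewrite /F ell0 mulr0 subr0 !big1 ?mulr0 ?addr0//.
    by move=> j _; have [_ -> _] := hct j; rewrite mulr0.
  by move=> i _; have [_ -> _] := hcx i; rewrite mul0r mulr0.
have F1 : F 1 = 4 * ip g.2 tau + \sum_i g.1 0 i ^+ 2 * scot (s i * enorm tau)
     - M * ell 1.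
  rewrite /F; congr (_ - _); rewrite addrC; congr (4 * _ + _).
    by apply: eq_bigr => j _; have [_ _ ->] := hct j; rewrite mulrC.
  apply: eq_bigr => i _; have [_ _ ->] := hcx i; rewrite /Q /z divff ?gt_eqF//.
  by rewrite acot1 mulrC expr2.
suff : F 1 <= F 0.
  rewrite F0 F1 subr_le0 => /le_trans; apply.
  by rewrite /M mulrDl -expr2 lerD2l.
apply: abs_cont01_nonincreasing acF _.
have aect : {ae lebesgue_measure, forall t, forall j, `[0%R, 1%R]%classic t ->
      derivable (ct j) t 1}.
  have aeF : Filter (almost_everywhere (@lebesgue_measure R)).
    exact: (ae_filter_ringOfSetsType lebesgue_measure).
  apply: filter_forall => j; apply: ae_open_closed01.
  have [g' [_]] := abs_cont01_derivable (acct j).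
  by apply: filterS => t h /h[].
have aeF : Filter (almost_everywhere (@lebesgue_measure R)).
  exact: (ae_filter_ringOfSetsType lebesgue_measure).
apply: filterS3 ael aect hae => t hl hc ht t01.
have [dcx dell ellE] := hl t01; have {}ht := ht t01.
have {hl hc} dct j : derivable (ct j) t 1 by exact: hc.
have {t01} t01 : 0 <= t <= 1 by move: t01; rewrite /= in_itv/=.
pose x : 'rV[R]_(2 * n) := \row_i cx i t.
pose x' : 'rV[R]_(2 * n) := \row_i derive1 (cx i) t.
pose v := derive1 ell t.
have dz : is_derive t 1 z (v / M).
  apply: (is_derive_eq (is_deriveM_fun (is_deriveD_fun (derive1_is_derive dell)
    (is_derive_cst eta t 1)) (is_derive_cst M^-1 t 1))).
  by rewrite mulr0 !addr0.
have dQ i : is_derive t 1 (fun t => Q t (s i))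
    (- ((s i * enorm tau) ^+ 2 + Q t (s i) ^+ 2) * (v / M)).
  apply: is_derive_comp_fun dz; apply: is_derive_acot => //.
  by have /andP[h ->] := z01 _ t01; rewrite (lt_le_trans em0).
have dF : is_derive t 1 F (\sum_i (- ((s i * enorm tau) ^+ 2 + Q t (s i) ^+ 2) * (v / M)
       * (cx i t * cx i t) + Q t (s i) * (derive1 (cx i) t * cx i t + cx i t * derive1 (cx i) t))
     + 4 * (\sum_j tau 0 j * derive1 (ct j) t) - M * v).
  apply: is_deriveB_fun.
    apply: is_deriveD_fun.
      apply: is_derive_sum_seq => i; apply: is_deriveM_fun => //.
      by apply: is_deriveM_fun; exact: derive1_is_derive.
    apply: is_deriveZ_fun; apply: is_derive_sum_seq => j; apply: is_deriveZ_fun.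
    exact: derive1_is_derive.
  by apply: is_deriveZ_fun; exact: derive1_is_derive.
split; first by case: dF.
rewrite (is_derive_derive1 dF) subr_le0.
have vE : v = Num.sqrt (\sum_i x' 0 i ^+ 2).
  by rewrite /v ellE; congr Num.sqrt; apply: eq_bigr => i _; rewrite mxE.
have := calibration_pointwise tau (Q t) x M0 vE; apply: le_trans.
rewrite le_eqVlt; apply/orP; left; apply/eqP; congr (_ + _).
  by apply: eq_bigr => i _; rewrite !mxE; ring.
(* Horizontality turns 4 tau . t' into 2 <A(tau) x, x'>. *)
rewrite -[4]/(2 * 2)%:R natrM -mulrA; congr (_ * _).
under eq_bigr do rewrite ht mulrCA.
rewrite -mulr_sumr mulVKf ?pnatr_eq0//.
under eq_bigr do rewrite mulr_sumr; rewrite exchange_big/=; apply: eq_bigr => i _.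
under eq_bigr do rewrite mulr_sumr; rewrite exchange_big/= AvecE mulr_suml.
apply: eq_bigr => i' _; rewrite !mxE /Amat summxE !mulr_suml; apply: eq_bigr => j _.
by rewrite !mxE; ring.
Qed.

End lower_bound.

(** * Geodesics *)

Section geodesics.
Context {R : realType}.

Lemma abs_cont01_C1 (f df : R -> R) : (forall x : R, is_derive x 1 f (df x)) ->
  continuous df -> abs_cont01 f.
Proof.
move=> hf cdf; have [K K0 hK] := C1_lipschitz (@ler01 R) (fun x _ => hf x) (fun x _ => cdf x).
have acid : abs_cont01 (fun x : R => x).
  move=> e e0; exists e => // N b c bc _; apply: le_lt_trans.
  by apply: ler_sum => i _; have [_ h _] := bc i; rewrite ger0_norm// subr_ge0.
apply: (abs_cont01_lipschitz (h := f) (K := K) acid) => b c b0 bc c1.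
by rewrite [`|c - b|]ger0_norm ?subr_ge0//; exact: hK.
Qed.

Lemma hlength_constant_speed q (cx : 'I_q -> R -> R) (v : R) :
  (forall t, Num.sqrt (\sum_i derive1 (cx i) t ^+ 2) = v) -> hlength cx = v%:E.
Proof.
move=> hv; rewrite /hlength.
under eq_integral do rewrite hv.
rewrite integral_cst//= [X in (_ * X)%E](lebesgue_measure_itv `[0, 1])/= lte_fin ltr01.
by rewrite -EFinD subr0 mule1.
Qed.

Variables (n m : nat) (U : 'I_m -> 'M[R]_(2 * n)).

Lemma ccdist_eq (g : pt n m) (L : R) : 0 <= L ->
  (exists cx ct, hcurve U g cx ct /\ hlength cx = L%:E) ->
  (forall cx ct, hcurve U g cx ct -> (L%:E <= hlength cx)%E) ->
  ccdist U g = L.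
Proof.
move=> L0 [cx [ct [hc hL]]] lb; rewrite /ccdist.
set S := [set _ | _]; suff -> : ereal_inf S = L%:E by [].
apply/eqP; rewrite eq_le; apply/andP; split.
  by apply: ereal_inf_lbound; exists cx, ct.
by apply: le_ereal_inf_tmp => _ [cx' [ct' [hc' ->]]]; exact: lb hc'.
Qed.

Variable s : 'I_(2 * n) -> R.
Hypothesis s_gt0 : forall i, 0 < s i.
Hypothesis U_skew : forall j, (U j)^T = - U j.
Hypothesis U_rel : forall lam lam' : 'rV[R]_m,
  - (Amat U lam *m Amat U lam' + Amat U lam' *m Amat U lam)
  = (2 * ip lam lam') *: wdiag s (fun u => u ^+ 2).

Lemma straight_line (x : 'rV[R]_(2 * n)) :
  exists cx ct, hcurve U (x, 0) cx ct /\ hlength cx = (enorm x)%:E.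
Proof.
exists (fun i t => x 0 i * t), (fun _ _ => 0).
have d i (t : R) : is_derive t 1 (fun t => x 0 i * t) (x 0 i).
  by apply: (is_derive_eq (is_deriveZ_fun (x 0 i) (is_derive_id t 1))); rewrite mulr1.
split; last first.
  apply: hlength_constant_speed => t; congr Num.sqrt; apply: eq_bigr => i _.
  by rewrite (is_derive_derive1 (d i t)) expr2.
split.
- move=> i; rewrite mulr0 mulr1; split => //.
  by apply: (abs_cont01_C1 (d i)) => t; exact: cst_continuous.
- by move=> j; rewrite mxE; split => //; exact: abs_cont01_cst.
- apply: aeW => t _ j; rewrite (is_derive_derive1 (is_derive_cst _ _ _)).
  have /= := @drift_form _ _ _ U s s_gt0 U_skew U_rel x 0 j (fun=> t) (fun=> 0) (fun=> 1) (fun=> 0).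
  rewrite mxE mul0r => h; rewrite -[LHS](mulr0 2^-1) -[in LHS]h; congr (_ * _).
  apply: eq_bigr => i _; apply: eq_bigr => i' _.
  by rewrite (is_derive_derive1 (d i t)); ring.
Qed.

(** From A^2 = - r^2 S^2, exp(u A) = cos(u r S) + (r S)^-1 sin(u r S) A, and the double angle
    formulas turn sin(u r S) exp(u A) w into the curve [cx]. Its velocity is r S exp(2 u A) w,
    whence the constant speed |r S w|. *)
Lemma geodesic (w : 'rV[R]_(2 * n)) (th : 'rV[R]_m) (r := enorm th) : 0 < r ->
  let x := \row_i (sin (2 * (s i * r)) / 2 * w 0 i
     + (1 - cos (2 * (s i * r))) / (2 * (s i * r)) * Avec U th w 0 i) in
  let t := (\sum_i (1 - sin (2 * (s i * r)) / (2 * (s i * r))) * s i ^+ 2 * w 0 i ^+ 2)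
     / 4 *: th in
  exists cx ct, hcurve U (x, t) cx ct /\
    hlength cx = (Num.sqrt (\sum_i (s i * r) ^+ 2 * w 0 i ^+ 2))%:E.
Proof.
move=> r0 x t.
pose al i := 2 * (s i * r).
have al0 i : al i != 0 by rewrite !mulf_neq0// gt_eqF.
pose cx i y := sin (al i * y) / 2 * w 0 i + (1 - cos (al i * y)) / al i * Avec U th w 0 i.
pose dcx i y := s i * r * cos (al i * y) * w 0 i + sin (al i * y) * Avec U th w 0 i.
pose ct j y := th 0 j / 4 * \sum_i ((y - sin (al i * y) / al i) * (s i ^+ 2 * w 0 i ^+ 2)).
pose dct j y := th 0 j / 4 * \sum_i ((1 - cos (al i * y)) * (s i ^+ 2 * w 0 i ^+ 2)).
have dx i (y : R) : is_derive y 1 (cx i) (dcx i y).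
  have h1 := is_deriveM_fun (is_deriveM_fun (is_derive_sin_comp (al i) y)
    (is_derive_cst (2^-1 : R) y 1)) (is_derive_cst (w 0 i) y 1).
  have h2 := is_deriveM_fun (is_deriveM_fun (is_deriveB_fun (is_derive_cst (1 : R) y 1)
    (is_derive_cos_comp (al i) y)) (is_derive_cst ((al i)^-1 : R) y 1))
    (is_derive_cst (Avec U th w 0 i) y 1).
  apply: (is_derive_eq (is_deriveD_fun h1 h2)).
  by rewrite /cst /dcx /al; field; rewrite !gt_eqF.
have dt j (y : R) : is_derive y 1 (ct j) (dct j y).
  apply: is_deriveZ_fun; apply: is_derive_sum_seq => i.
  have h := is_deriveM_fun (is_deriveB_fun (is_derive_id y 1) (is_deriveM_fun
    (is_derive_sin_comp (al i) y) (is_derive_cst ((al i)^-1 : R) y 1)))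
    (is_derive_cst (s i ^+ 2 * w 0 i ^+ 2) y 1).
  by apply: (is_derive_eq h); rewrite /cst; field.
have csin i : continuous (fun y => sin (al i * y)).
  by move=> y; exact: is_derive_continuous1 (is_derive_sin_comp _ _).
have ccos i : continuous (fun y => cos (al i * y)).
  by move=> y; exact: is_derive_continuous1 (is_derive_cos_comp _ _).
have cdx i : continuous (dcx i).
  move=> y; apply: cvgD; apply: cvgM; try exact: cvg_cst; last exact: csin.
  by apply: cvgM; [exact: cvg_cst|exact: ccos].
have cdt j : continuous (dct j).
  move=> y; apply: cvgM; first exact: cvg_cst.
  apply: cvg_sum_seq => i; apply: cvgM; last exact: cvg_cst.
  by apply: cvgB; [exact: cvg_cst|exact: ccos].
exists cx, ct; split; last first.
  apply: hlength_constant_speed => y; congr Num.sqrt.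
  under eq_bigr do rewrite (is_derive_derive1 (dx _ _)).
  have -> : \sum_i dcx i y ^+ 2 =
    \sum_i ((s i * r * cos (al i * y)) ^+ 2 * w 0 i ^+ 2)
    + (\sum_i (2 * (s i * r * cos (al i * y) * sin (al i * y))) * (w 0 i * Avec U th w 0 i)
    + \sum_i (sin (al i * y) ^+ 2) * Avec U th w 0 i ^+ 2).
    by rewrite -!big_split/=; apply: eq_bigr => i _; rewrite /dcx; ring.
  rewrite (sum_wAvec0 s_gt0 U_skew U_rel w th (fun u => 2 * (u * r * cos (2 * (u * r) * y)
     * sin (2 * (u * r) * y)))) add0r.
  rewrite (sum_wAvec2 s_gt0 U_skew U_rel w th (fun u => sin (2 * (u * r) * y) ^+ 2)).
  rewrite -enorm2 -/r mulr_sumr -big_split/=; apply: eq_bigr => i _.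
  by rewrite /al sin2cos2; ring.
split.
- move=> i; split; first exact: (abs_cont01_C1 (dx i)).
    by rewrite /cx mulr0 sin0 cos0 subrr !mul0r addr0.
  by rewrite /cx /= !mulr1 [RHS]mxE.
- move=> j; split; first exact: (abs_cont01_C1 (dt j)).
    by rewrite /ct big1 ?mulr0// => i _; rewrite mulr0 sin0 mul0r subrr mul0r.
  rewrite /ct /= mxE mulrC [th 0 j / 4]mulrC mulrA; congr (_ / _ * _).
  by apply: eq_bigr => i _; rewrite mulr1 mulrA.
- apply: aeW => y _ j; rewrite (is_derive_derive1 (dt j y)) /dct.
  have := @drift_form _ _ _ U s s_gt0 U_skew U_rel w th j
    (fun u => sin (2 * (u * r) * y) / 2) (fun u => (1 - cos (2 * (u * r) * y)) / (2 * (u * r)))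
    (fun u => u * r * cos (2 * (u * r) * y)) (fun u => sin (2 * (u * r) * y)).
  under [X in _ = 2^-1 * X]eq_bigr do under eq_bigr do rewrite (is_derive_derive1 (dx _ _)).
  rewrite /cx /dcx /= => ->.
  rewrite !mulr_sumr; apply: eq_bigr => i _; rewrite /al.
  have := sin2cos2 (2 * (s i * r) * y).
  have := gt_eqF (s_gt0 i); have := gt_eqF r0 => rn sn.
  set S := sin _; set C := cos _ => SC.
  rewrite -[S / 2 * S](_ : S ^+ 2 / 2 = _); last by ring.
  by rewrite SC; field; rewrite rn sn.
Qed.

End geodesics.

(** * Trigonometric functions of a square root *)

Section entire_series.
Context {R : realType}.
Implicit Types (c : R ^nat) (x v s : R).

(** Domination by an exponential series: it gives convergence everywhere and is stable under
    [pseries_diffs], so derivatives of every order stay in the class. *)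
Definition exp_bounded c :=
  exists B K : R, 0 <= K /\ forall n, `|c n| * n`!%:R <= B * K ^+ n.

Definition psum c x : R := limn (pseries c x).

Lemma exp_bounded_diffs c : exp_bounded c -> exp_bounded (pseries_diffs c).
Proof.
move=> [B [K [K0 h]]]; exists (B * K), K; split => // n.
have := h n.+1; rewrite exprS mulrA; apply: le_trans.
by rewrite /pseries_diffs normrM normr_nat factS natrM mulrCA mulrA.
Qed.

Lemma exp_bounded_cvg c x : exp_bounded c -> cvgn (pseries c x).
Proof.
move=> [B [K [K0 h]]].
apply: normed_cvg; rewrite /normed_series_of.
apply: (@series_le_cvg _ _ (fun n => B * exp_coeff (K * `|x|) n)) => /=.
- by move=> n; exact: normr_ge0.
- move=> n; apply: le_trans (_ : 0 <= `|c n| * `|x| ^+ n) _; first by rewrite mulr_ge0// exprn_ge0.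
  rewrite /exp_coeff /= exprMn mulrA ler_pdivlMr ?ltr0n ?fact_gt0//.
  by rewrite mulrAC mulrA ler_wpM2r ?exprn_ge0//; exact: h.
- move=> n; rewrite normrM normrX /exp_coeff /= exprMn mulrA ler_pdivlMr ?ltr0n ?fact_gt0//.
  by rewrite mulrAC mulrA ler_wpM2r ?exprn_ge0//; exact: h.
- have -> : [series B * exp_coeff (K * `|x|) n]_n = B *: series (exp_coeff (K * `|x|)).
    by apply/funext => n; rewrite /series /= fctE/= -mulr_sumr.
  by apply: is_cvgZr; exact: is_cvg_series_exp_coeff.
Qed.

Lemma is_derive_psum c x : exp_bounded c ->
  is_derive x 1 (psum c) (psum (pseries_diffs c) x).
Proof.
move=> hc; have hc1 := exp_bounded_diffs hc; have hc2 := exp_bounded_diffs hc1.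
apply: (@pseries_snd_diffs _ c (`|x| + 1)); try exact: exp_bounded_cvg.
by rewrite [ltRHS]ger0_norm ?addr_ge0// ltrDl.
Qed.

Lemma psum0 c : psum c 0 = c 0%N.
Proof.
rewrite /psum; apply/cvg_lim => //; apply: cvg_near_cst.
exists 1%N => // -[|n] // _; rewrite /pseries /series /= big_nat_recl//= expr0 mulr1.
by rewrite big1 ?addr0// => i _; rewrite expr0n mulr0.
Qed.

(* cos u and sin u / u as entire functions of u^2: this makes mu u / u a smooth function
   of u^2, including at 0. *)
Definition cos_sqrt_coeff : R ^nat := fun n => (-1) ^+ n / (n.*2)`!%:R.
Definition sinc_sqrt_coeff : R ^nat := fun n => (-1) ^+ n / (n.*2.+1)`!%:R.

Lemma exp_bounded_cos : exp_bounded cos_sqrt_coeff.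
Proof.
exists 1, 1; split => // n; rewrite expr1n mulr1 /cos_sqrt_coeff.
rewrite normrM normrX normrN normr1 expr1n mul1r normfV normr_nat.
rewrite mulrC ler_pdivrMr ?ltr0n ?fact_gt0// mul1r ler_nat.
by rewrite leq_fact// -addnn leq_addr.
Qed.

Lemma exp_bounded_sinc : exp_bounded sinc_sqrt_coeff.
Proof.
exists 1, 1; split => // n; rewrite expr1n mulr1 /sinc_sqrt_coeff.
rewrite normrM normrX normrN normr1 expr1n mul1r normfV normr_nat.
rewrite mulrC ler_pdivrMr ?ltr0n ?fact_gt0// mul1r ler_nat.
by rewrite leq_fact// -addnn (leq_trans (leq_addr n _)).
Qed.

Definition cos_sqrt (v : R) : R := psum cos_sqrt_coeff v.
Definition sinc_sqrt (v : R) : R := psum sinc_sqrt_coeff v.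
Definition sinc_sqrt1 (v : R) : R := psum (pseries_diffs sinc_sqrt_coeff) v.
Definition sinc_sqrt2 (v : R) : R := psum (pseries_diffs (pseries_diffs sinc_sqrt_coeff)) v.

Lemma cos_sqrt_sqr s : cos_sqrt (s ^+ 2) = cos s.
Proof.
rewrite /cos_sqrt /psum; apply/cvg_lim => //.
suff -> : pseries cos_sqrt_coeff (s ^+ 2) = series (cos_coeff' s).
  exact: cvg_cos_coeff'.
apply/funext => n; rewrite /pseries /series /=; apply: eq_bigr => i _.
by rewrite /cos_coeff' /cos_sqrt_coeff -exprnP -exprM -mul2n mulrAC.
Qed.

Lemma sinc_sqrt_sqr s : s * sinc_sqrt (s ^+ 2) = sin s.
Proof.
have [->|s0] := eqVneq s 0; first by rewrite mul0r sin0.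
suff : sinc_sqrt (s ^+ 2) = s^-1 * sin s by move=> ->; rewrite mulVKf.
rewrite /sinc_sqrt /psum; apply/cvg_lim => //.
have -> : pseries sinc_sqrt_coeff (s ^+ 2) = s^-1 *: series (sin_coeff' s).
  apply/funext => n; rewrite /pseries /series /= fctE /= scaler_sumr; apply: eq_bigr => i _.
  rewrite /sin_coeff' /sinc_sqrt_coeff -exprnP -exprM -mul2n exprS /GRing.scale/=.
  by field; rewrite s0 pnatr_eq0 -lt0n fact_gt0.
by apply: cvgZr; exact: cvg_sin_coeff'.
Qed.

Lemma is_derive_cos_sqrt v : is_derive v 1 cos_sqrt (- sinc_sqrt v / 2).
Proof.
apply: (is_derive_eq (is_derive_psum v exp_bounded_cos)).
have -> : pseries_diffs cos_sqrt_coeff = (- 2^-1) *: sinc_sqrt_coeff.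
  apply/funext => n; rewrite /pseries_diffs fctE /GRing.scale/= /cos_sqrt_coeff /sinc_sqrt_coeff.
  rewrite doubleS factS natrM exprS.
  have -> : (n.*2.+2)%:R = 2 * n.+1%:R :> R by rewrite -natrM mul2n doubleS.
  by field; rewrite nat1r !pnatr_eq0 /= -lt0n fact_gt0.
have -> : - sinc_sqrt v / 2 = - 2^-1 *: sinc_sqrt v by rewrite /GRing.scale/=; field.
rewrite {1}/psum; apply/cvg_lim => //.
have -> : pseries (- 2^-1 *: sinc_sqrt_coeff) v = - 2^-1 *: pseries sinc_sqrt_coeff v.
  apply/funext => n; transitivity (- 2^-1 * \sum_(0 <= i < n) sinc_sqrt_coeff i * v ^+ i) => //.
  rewrite mulr_sumr /pseries /series /=; apply: eq_bigr => i _.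
  by rewrite mulrA.
by apply: cvgZr; apply: exp_bounded_cvg; exact: exp_bounded_sinc.
Qed.

Lemma is_derive_sinc_sqrt v : is_derive v 1 sinc_sqrt (sinc_sqrt1 v).
Proof. exact: is_derive_psum exp_bounded_sinc. Qed.

Lemma is_derive_sinc_sqrt1 v : is_derive v 1 sinc_sqrt1 (sinc_sqrt2 v).
Proof. exact: is_derive_psum (exp_bounded_diffs exp_bounded_sinc). Qed.

Lemma sinc_sqrt0 : sinc_sqrt 0 = 1.
Proof. by rewrite /sinc_sqrt psum0 /sinc_sqrt_coeff expr0 (_ : (0.*2.+1)`! = 1)%N// divr1. Qed.

Lemma cos_sqrt0 : cos_sqrt 0 = 1.
Proof. by rewrite /cos_sqrt psum0 /cos_sqrt_coeff expr0 double0 fact0 divr1. Qed.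

Lemma sinc_sqrt10 : sinc_sqrt1 0 = - 6^-1.
Proof.
rewrite /sinc_sqrt1 psum0 /pseries_diffs /sinc_sqrt_coeff expr1 mul1r.
by rewrite (_ : (1.*2.+1)`! = 6)%N// mulN1r.
Qed.

Lemma sinc_sqrt_gt0 s : 0 <= s < pi -> 0 < sinc_sqrt (s ^+ 2).
Proof.
rewrite le_eqVlt => /andP[/predU1P[<- _|s0 spi]].
  by rewrite expr0n/= sinc_sqrt0.
by rewrite -(pmulr_rgt0 _ s0) sinc_sqrt_sqr sin_gt0_pi// s0.
Qed.

Definition scot_sqrt (v : R) : R := cos_sqrt v / sinc_sqrt v.

Lemma scotE s : scot s = scot_sqrt (s ^+ 2).
Proof.
rewrite /scot /scot_sqrt; case: eqP => [->|/eqP s0].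
  by rewrite expr0n/= cos_sqrt0 sinc_sqrt0 divr1.
by rewrite cos_sqrt_sqr -sinc_sqrt_sqr invfM mulrA [s * _]mulrC mulfK.
Qed.

Lemma ssinE s : ssin s = (sinc_sqrt (s ^+ 2))^-1.
Proof.
rewrite /ssin; case: eqP => [->|/eqP s0].
  by rewrite expr0n/= sinc_sqrt0 invr1.
by rewrite -sinc_sqrt_sqr invfM mulrA mulfV// mul1r.
Qed.

(** [nu (u ^+ 2)] is mu(u) / u without the singularity at 0. The formula is -2 times the derivative
    of [scot_sqrt]. *)
Definition nu (v : R) : R := 1 + 2 * (cos_sqrt v * (sinc_sqrt1 v / sinc_sqrt v ^+ 2)).

Definition nu' (v : R) : R := 2 * (- sinc_sqrt v / 2 * (sinc_sqrt1 v / sinc_sqrt v ^+ 2)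
  + cos_sqrt v * (sinc_sqrt2 v / sinc_sqrt v ^+ 2
                  - 2 * sinc_sqrt1 v ^+ 2 / sinc_sqrt v ^+ 3)).

Lemma is_derive_scot_sqrt v : sinc_sqrt v != 0 ->
  is_derive v 1 scot_sqrt (- nu v / 2).
Proof.
move=> S0; apply: (is_derive_eq (is_deriveM_fun (is_derive_cos_sqrt v)
  (is_deriveV_fun S0 (is_derive_sinc_sqrt v)))).
by rewrite /nu; field.
Qed.

Lemma is_derive_nu v : sinc_sqrt v != 0 -> is_derive v 1 nu (nu' v).
Proof.
move=> S0.
have S20 : sinc_sqrt v * sinc_sqrt v != 0 by rewrite mulf_neq0.
have dS2 := is_deriveM_fun (is_derive_sinc_sqrt v) (is_derive_sinc_sqrt v).
have h := is_deriveM_fun (is_derive_cos_sqrt v) (is_deriveM_fun (is_derive_sinc_sqrt1 v)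
   (is_deriveV_fun (f := fun y => sinc_sqrt y * sinc_sqrt y) S20 dS2)).
apply: (is_derive_eq (is_deriveD_fun (is_derive_cst (1 : R) v 1) (is_deriveZ_fun 2 h))).
by rewrite /nu'; field.
Qed.

(** Obtained by differentiating the identity y sinc_sqrt(y^2) = sin y. *)
Lemma sinc_sqrt1_sqr s : s != 0 ->
  sinc_sqrt1 (s ^+ 2) = (cos s - sin s / s) / (2 * s ^+ 2).
Proof.
move=> s0; have dsq : is_derive s 1 (fun y : R => y * y) (1 * s + s * 1).
  exact: is_deriveM_fun (is_derive_id s 1) (is_derive_id s 1).
have dS : is_derive s 1 (fun y => y * sinc_sqrt (y * y))
   (1 * sinc_sqrt (s * s) + s * (sinc_sqrt1 (s * s) * (1 * s + s * 1))).
  by apply: is_deriveM_fun; exact: is_derive_comp_fun (is_derive_sinc_sqrt _) dsq.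
have E : (fun y => y * sinc_sqrt (y * y)) = sin.
  by apply/funext => y; rewrite -expr2 sinc_sqrt_sqr.
rewrite E in dS; have [_ e1] := dS; have [_ e2] := is_derive_sin s.
have := etrans (esym e1) e2; rewrite -expr2 => <-.
have -> : sin s = s * sinc_sqrt (s ^+ 2) by rewrite sinc_sqrt_sqr.
by field.
Qed.

Lemma sin_double s : sin (2 * s) = 2 * (sin s * cos s) :> R.
Proof. by rewrite mulr_natl sin_mulr2n [cos _ * _]mulrC mulr_natl. Qed.

Lemma mu_overE s : 0 <= s < pi -> mu_over s = nu (s ^+ 2).
Proof.
move=> spi; have S0 := sinc_sqrt_gt0 spi; rewrite /mu_over; case: eqP => [->|/eqP s0].
  by rewrite expr0n/= /nu sinc_sqrt10 sinc_sqrt0 cos_sqrt0; field.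
have ss : sin s != 0 by rewrite -sinc_sqrt_sqr mulf_neq0// gt_eqF.
have SE : sinc_sqrt (s ^+ 2) = sin s / s by rewrite -sinc_sqrt_sqr mulrAC mulfV// mul1r.
rewrite /nu sinc_sqrt1_sqr// SE cos_sqrt_sqr /mu sin_double.
have -> : 2 * s - 2 * (sin s * cos s) = 2 * (s * (sin s ^+ 2 + cos s ^+ 2) - sin s * cos s).
  by rewrite addrC addrC [sin s ^+ 2 + _]addrC cos2Dsin2 mulr1; ring.
by field; rewrite ss s0.
Qed.

Lemma muE s : 0 <= s < pi -> mu s = s * nu (s ^+ 2).
Proof.
move=> spi; have := mu_overE spi; rewrite /mu_over; case: eqP => [-> _|/eqP s0 <-].
  by rewrite /mu mulr0 sin0 subrr !mul0r.
by rewrite mulrC divfK.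
Qed.

Lemma sin_gt_mul_cos s : 0 < s < pi -> s * cos s < sin s :> R.
Proof.
move=> /andP[s0 spi]; pose p (y : R) := sin y - y * cos y.
have dp (y : R) : is_derive y 1 p (y * sin y).
  apply: (is_derive_eq (is_deriveB_fun (is_derive_sin y)
    (is_deriveM_fun (is_derive_id y 1) (is_derive_cos y)))).
  by ring.
have [|c /=] := MVT s0 (fun x _ => dp x).
  by apply: derivable_within_continuous => y _; case: (dp y).
rewrite in_itv/= => /andP[c0 cs]; rewrite /p sin0 mul0r !subr0 => e.
rewrite -subr_gt0 e !mulr_gt0// sin_gt0_pi// c0 (lt_trans cs)//.
Qed.

Lemma is_derive_mu s : 0 < s < pi ->
  is_derive s 1 mu (2 * (sin s - s * cos s) / sin s ^+ 3).
Proof.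
move=> s0pi; have ss : 0 < sin s by exact: sin_gt0_pi.
have ssn : sin s != 0 by rewrite gt_eqF.
have den : 2 * (sin s * sin s) != 0 by rewrite !mulf_neq0.
have h := is_deriveM_fun (is_deriveB_fun (is_deriveZ_fun 2 (is_derive_id s 1))
  (is_derive_sin_comp 2 s)) (is_deriveV_fun (f := fun y => 2 * (sin y * sin y)) den
   (is_deriveZ_fun 2 (is_deriveM_fun (is_derive_sin s) (is_derive_sin s)))).
apply: (is_derive_eq h); rewrite sin_double.
have -> : cos (2 * s) = 1 - 2 * sin s ^+ 2.
  rewrite mulr_natl cos_mulr2n cos2sin2; ring.
have c2 : cos s ^+ 2 = 1 - sin s ^+ 2 by exact: cos2sin2.
rewrite /=.
transitivity ((4 * sin s ^+ 2 * (2 * sin s ^+ 2)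
   - (2 * s - 2 * (sin s * cos s)) * (4 * (sin s * cos s))) / (2 * sin s ^+ 2) ^+ 2).
  by rewrite /=; field.
transitivity ((8 * sin s ^+ 4 + 8 * sin s ^+ 2 * cos s ^+ 2 - 8 * s * sin s * cos s)
   / (2 * sin s ^+ 2) ^+ 2); first by field.
rewrite c2; by field.
Qed.

Definition dmu (s : R) : R := nu (s ^+ 2) + 2 * s ^+ 2 * nu' (s ^+ 2).

Lemma is_derive_mu_ext s : 0 <= s < pi -> is_derive s 1 (fun y : R => y * nu (y ^+ 2)) (dmu s).
Proof.
move=> spi; have S0 := sinc_sqrt_gt0 spi.
have Sn : sinc_sqrt (s * s) != 0 by rewrite -expr2 gt_eqF.
have dsq : is_derive s 1 (fun y : R => y * y) (1 * s + s * 1).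
  exact: is_deriveM_fun (is_derive_id s 1) (is_derive_id s 1).
have h := is_deriveM_fun (is_derive_id s 1) (is_derive_comp_fun (g := fun y : R => y * y) (is_derive_nu Sn) dsq).
by apply: (is_derive_eq h); rewrite /dmu expr2 /=; ring.
Qed.

(** Away from 0 the sign is read off the closed form 2 (sin s - s cos s) / sin^3 s of mu'; at 0 the
    value is nu(0) = 2/3. *)
Lemma dmu_gt0 s : 0 <= s < pi -> 0 < dmu s.
Proof.
move=> spi; have := spi; rewrite le_eqVlt => /andP[/predU1P[<- _|s0 ltspi]].
  by rewrite /dmu expr0n/= mulr0 mul0r addr0 /nu sinc_sqrt10 sinc_sqrt0 cos_sqrt0; lra.
have s0pi : 0 < s < pi by rewrite s0.
have [_ <-] := is_derive_mu_ext spi.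
have -> : derive (fun y : R => y * nu (y ^+ 2)) s 1 = 2 * (sin s - s * cos s) / sin s ^+ 3.
  have [_ <-] := is_derive_mu s0pi; apply: near_eq_derive.
  near=> y; have : y \in `]0, pi[ by near: y; apply: near_in_itvoo; rewrite in_itv/= s0.
  by rewrite in_itv/= => /andP[y0 ypi]; rewrite muE// (ltW y0).
by rewrite divr_gt0 ?exprn_gt0 ?sin_gt0_pi// mulr_gt0// subr_gt0 sin_gt_mul_cos.
Unshelve. all: by end_near. Qed.

Lemma mu_lt s s' : 0 <= s -> s < s' -> s' < pi -> mu s < mu s' :> R.
Proof.
move=> s0 ss' s'pi; rewrite !muE ?s0 ?(lt_trans ss')// ?(le_trans s0) ?(ltW ss')//.
have [x|/=|c] := @MVT _ (fun y : R => y * nu (y ^+ 2)) dmu _ _ ss'.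
- by rewrite in_itv/= => /andP[x0 x1]; apply: is_derive_mu_ext; lra.
- apply: derivable_within_continuous => y; rewrite in_itv/= => /andP[y0 y1].
  by have [] : is_derive y 1 (fun y : R => y * nu (y ^+ 2)) (dmu y) by apply: is_derive_mu_ext; lra.
rewrite in_itv/= => /andP[c0 c1] e; rewrite -subr_gt0 e mulr_gt0 ?subr_gt0//.
by apply: dmu_gt0; lra.
Qed.

Lemma mu0 : mu 0 = 0 :> R.
Proof. by rewrite /mu mulr0 sin0 subrr mul0r. Qed.

Lemma mu_gt0 s : 0 < s < pi -> 0 < mu s :> R.
Proof. by move=> /andP[s0 spi]; rewrite -mu0; exact: mu_lt. Qed.

Lemma nu_gt0 s : 0 <= s < pi -> 0 < nu (s ^+ 2).
Proof.
move=> spi; have := spi; rewrite le_eqVlt => /andP[/predU1P[<- _|s0 ltspi]].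
  by rewrite expr0n/= /nu sinc_sqrt10 sinc_sqrt0 cos_sqrt0; lra.
by rewrite -(pmulr_rgt0 _ s0) -muE// mu_gt0// s0.
Qed.

Lemma is_derive_scot (al r : R) : 0 <= al * r < pi ->
  is_derive r 1 (fun y => scot (al * y)) (- (al * mu (al * r))).
Proof.
move=> spi; have S0 := sinc_sqrt_gt0 spi.
have Sn : sinc_sqrt ((al * r) * (al * r)) != 0 by rewrite -expr2 gt_eqF.
have dal := is_deriveZ_fun al (is_derive_id r 1).
have h := is_derive_comp_fun (g := fun y : R => (al * y) * (al * y)) (is_derive_scot_sqrt Sn) (is_deriveM_fun dal dal).
have -> : (fun y => scot (al * y)) = (fun y => scot_sqrt ((al * y) * (al * y))).
  by apply/funext => y; rewrite scotE expr2.
by apply: (is_derive_eq h); rewrite muE// expr2 /=; field.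
Qed.

(** Combined with the critical equation, it turns the critical value 4 |t| r + sum x_i^2 scot(s_i r)
    into the squared length sum x_i^2 ssin(s_i r)^2. *)
Lemma scot_mu_ssin s : sin s != 0 \/ s = 0 -> ssin s ^+ 2 = s * mu s + scot s :> R.
Proof.
move=> [ss|->]; last by rewrite mu0 /ssin /scot eqxx; ring.
have s0 : s != 0 by apply: contraNneq ss => ->; rewrite sin0.
rewrite /ssin /scot (negbTE s0) /mu sin_double.
by field.
Qed.

End entire_series.

(** * The distance *)

Section distance.
Context {R : realType} (n m : nat) (U : 'I_m -> 'M[R]_(2 * n)) (s : 'I_(2 * n) -> R).
Hypothesis s_gt0 : forall i, 0 < s i.
Hypothesis s_le1 : forall i, s i <= 1.
Hypothesis U_skew : forall j, (U j)^T = - U j.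
Hypothesis U_rel : forall lam lam' : 'rV[R]_m,
  - (Amat U lam *m Amat U lam' + Amat U lam' *m Amat U lam)
  = (2 * ip lam lam') *: wdiag s (fun u => u ^+ 2).
Implicit Types (x : 'rV[R]_(2 * n)) (t th tau : 'rV[R]_m).

Definition radial x (T r : R) : R := 4 * T * r + \sum_i x 0 i ^+ 2 * scot (s i * r).
Definition slope x (r : R) : R := \sum_i x 0 i ^+ 2 * (s i * mu (s i * r)).
(** Only the coordinates that occur in x must stay below the pole of cot, so r = pi is allowed when
    the last block vanishes. *)
Definition radial_dom x (r : R) : Prop := forall i, x 0 i != 0 -> s i * r < pi.

Lemma is_derive_radial x (T r : R) : 0 <= r -> radial_dom x r ->
  is_derive r 1 (radial x T) (4 * T - slope x r).
Proof.
move=> r0 xr; rewrite /slope -sumrN.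
apply: is_deriveD_fun.
  by apply: (is_derive_eq (is_deriveZ_fun (4 * T) (is_derive_id r 1))); rewrite mulr1.
apply: is_derive_sum_seq => i; have [->|xi] := eqVneq (x 0 i) 0.
  rewrite expr0n mul0r oppr0 (_ : (fun _ => _) = cst 0); first exact: is_derive_cst.
  by apply/funext => y; rewrite mul0r.
rewrite -mulrN; apply: is_deriveZ_fun; apply: is_derive_scot.
by rewrite mulr_ge0 ?xr// ltW.
Qed.

Lemma radial_dom_le x (r r' : R) : radial_dom x r' -> r <= r' -> radial_dom x r.
Proof. by move=> h rr' i /h; apply: le_lt_trans; rewrite ler_pM2l. Qed.

Lemma radial_dom_pi x (r : R) : r < pi -> radial_dom x r.
Proof.
move=> rpi i _; have [r0|r0] := leP 0 r; first by apply: le_lt_trans rpi; rewrite ler_piMl.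
by apply: (lt_trans _ (pi_gt0 R)); rewrite pmulr_rlt0.
Qed.

(** Meant for r = pi, where bounds are only available at smaller radii. *)
Lemma left_closed_le (f : R -> R) (df r c : R) : 0 < r -> is_derive r 1 f df ->
  (forall y, 0 < y < r -> f y <= c) -> f r <= c.
Proof.
move=> r0 /is_derive_continuous1 cf h; rewrite leNgt; apply/negP => cfr.
have e0 : 0 < f r - c by rewrite subr_gt0.
have /cvgrPdist_lt/(_ _ e0)[del /= d0 hd] := cf.
pose y := r - Num.min (del / 2) (r / 2).
have mn : 0 < Num.min (del / 2) (r / 2) by rewrite lt_min !divr_gt0.
have mn1 : Num.min (del / 2) (r / 2) <= del / 2 by rewrite ge_min lexx.
have mn2 : Num.min (del / 2) (r / 2) <= r / 2 by rewrite ge_min lexx orbT.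
have : `|f r - f y| < f r - c.
  apply: hd; rewrite /ball_ /= /y opprB addrC subrK gtr0_norm//; lra.
have : f y <= c by apply: h; rewrite /y; lra.
by have := ler_norm (f r - f y); lra.
Qed.

Lemma enorm_ge0 N (v : 'rV[R]_N) : 0 <= enorm v.
Proof. exact: sqrtr_ge0. Qed.

Lemma enorm_eq0 N (v : 'rV[R]_N) : (enorm v == 0) = (v == 0).
Proof. by rewrite -ip_eq0 -enorm2 sqrf_eq0. Qed.

Lemma ipZl N (c : R) (v w : 'rV[R]_N) : ip (c *: v) w = c * ip v w.
Proof. by rewrite /ip mulr_sumr; apply: eq_bigr => i _; rewrite !mxE mulrA. Qed.

Lemma ipC N (v w : 'rV[R]_N) : ip v w = ip w v.
Proof. by apply: eq_bigr => i _; rewrite mulrC. Qed.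

Lemma ipZr N (c : R) (v w : 'rV[R]_N) : ip v (c *: w) = c * ip v w.
Proof. by rewrite ipC ipZl ipC. Qed.

Lemma enormZ N (c : R) (v : 'rV[R]_N) : enorm (c *: v) = `|c| * enorm v.
Proof. by rewrite /enorm ipZl ipZr mulrA -expr2 sqrtrM ?sqr_ge0// sqrtr_sqr. Qed.

(** One identity yields both the Cauchy-Schwarz inequality and its equality case; the latter fixes
    the direction of the maximizer of phi. *)
Lemma ip_cauchy_gap N (v w : 'rV[R]_N) :
  ip (enorm w *: v - enorm v *: w) (enorm w *: v - enorm v *: w) =
  2 * (enorm v * enorm w) * (enorm v * enorm w - ip v w).
Proof.
have -> : ip (enorm w *: v - enorm v *: w) (enorm w *: v - enorm v *: w) =
   enorm w ^+ 2 * ip v v - 2 * (enorm v * enorm w) * ip v w + enorm v ^+ 2 * ip w w.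
  rewrite /ip !mulr_sumr -sumrB -big_split/=; apply: eq_bigr => i _.
  by rewrite !mxE; ring.
by rewrite -!enorm2; ring.
Qed.

Lemma enorm0 N : enorm (0 : 'rV[R]_N) = 0.
Proof. by apply/eqP; rewrite enorm_eq0. Qed.

Lemma ip0l N (w : 'rV[R]_N) : ip 0 w = 0.
Proof. by rewrite -(scale0r w) ipZl mul0r. Qed.

Lemma ip_le_enorm N (v w : 'rV[R]_N) : ip v w <= enorm v * enorm w.
Proof.
have [->|v0] := eqVneq v 0; first by rewrite ip0l enorm0 mul0r.
have [->|w0] := eqVneq w 0; first by rewrite ipC ip0l enorm0 mulr0.
have vw : 0 < 2 * (enorm v * enorm w).
  by rewrite mulr_gt0// mulr_gt0// lt_neqAle eq_sym enorm_eq0 enorm_ge0 ?v0 ?w0.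
by rewrite -subr_ge0 -(pmulr_rge0 _ vw) -ip_cauchy_gap ip_ge0.
Qed.

Lemma ip_eq_enorm N (v w : 'rV[R]_N) : ip v w = enorm v * enorm w ->
  enorm w *: v = enorm v *: w.
Proof.
move=> h; apply/eqP; rewrite -subr_eq0 -ip_eq0 ip_cauchy_gap h.
by rewrite subrr mulr0.
Qed.

Lemma Avec_block th x i : (forall i', s i' = s i -> x 0 i' = 0) -> Avec U th x 0 i = 0.
Proof.
move=> h; rewrite AvecE big1// => i' _.
have [si|/Amat_block ->] := eqVneq (s i) (s i'); first by rewrite h ?mulr0.
- by rewrite mul0r.
- exact: s_gt0.
- exact: U_rel.
Qed.

Lemma Avec_Avec th x i : Avec U th (Avec U th x) 0 i = - (s i * enorm th) ^+ 2 * x 0 i.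
Proof.
rewrite /Avec -mulmxA -trmx_mul (Amat_sqr U_rel) linearZ /= wdiag_tr -scalemxAr.
by rewrite /wdiag mul_mx_diag !mxE -enorm2; ring.
Qed.

Lemma AvecD th x y : Avec U th (x + y) = Avec U th x + Avec U th y.
Proof. by rewrite /Avec mulmxDl. Qed.

Lemma Avec_weight th x (h : R -> R) i :
  Avec U th (\row_k (h (s k) * x 0 k)) 0 i = h (s i) * Avec U th x 0 i.
Proof.
rewrite !AvecE mulr_sumr; apply: eq_bigr => k _; rewrite !mxE.
have [->|/(Amat_block s_gt0 U_rel) ->] := eqVneq (s i) (s k); first by rewrite mulrCA.
by rewrite !mul0r mulr0.
Qed.

(* w solves x = sin(r S) exp(A) w, i.e. w = cot(r S) x - (r S)^-1 A x; the free
   component V of w along the i0-th basis vector is invisible in the endpoint when sin r = 0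
   and accounts for the large vertical coordinates over the cut locus. *)
Lemma geodesic_to x th (V : R) (i0 : 'I_(2 * n)) : 0 < enorm th -> s i0 = 1 ->
  (forall i, sin (s i * enorm th) = 0 -> x 0 i = 0) ->
  V = 0 \/ sin (enorm th) = 0 ->
  exists cx ct, hcurve U (x, ((\sum_i s i ^+ 2 * x 0 i ^+ 2 * mu_over (s i * enorm th)
      + V ^+ 2) / 4) *: th) cx ct /\
    hlength cx = (Num.sqrt (\sum_i x 0 i ^+ 2 * ssin (s i * enorm th) ^+ 2
      + (enorm th * V) ^+ 2))%:E.
Proof.
set r := enorm th => r0 si0 hx hV.
have al0 i : s i * r != 0 by rewrite mulf_neq0// gt_eqF.
have hA i : sin (s i * r) = 0 -> Avec U th x 0 i = 0.
  by move=> si; apply: Avec_block => i' si'; apply: hx; rewrite si'.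
pose P u := cos (u * r) / sin (u * r); pose K u := - (u * r)^-1.
pose w1 : 'rV[R]_(2 * n) :=
  \row_i (P (s i) * x 0 i) + \row_i (K (s i) * Avec U th x 0 i).
pose e0 : 'rV[R]_(2 * n) := V *: unit_rv i0.
pose w := w1 + e0.
have w1E i : w1 0 i = P (s i) * x 0 i + K (s i) * Avec U th x 0 i by rewrite !mxE.
have e0E i : e0 0 i = V * (i == i0)%:R by rewrite !mxE eqxx.
have Ae0 i : sin (s i * r) != 0 -> Avec U th e0 0 i = 0.
  move=> si; rewrite AvecE big1// => k _; rewrite e0E.
  have [->|_] := eqVneq k i0; last by rewrite !mulr0.
  case: hV => [->|sr]; first by rewrite !mul0r mulr0.
  rewrite (Amat_block s_gt0 U_rel) ?mul0r//; apply: contraNneq si => ->.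
  by rewrite si0 mul1r sr.
have e00 i : sin (s i * r) != 0 -> e0 0 i = 0.
  move=> si; rewrite e0E; case: hV => [->|sr]; first by rewrite mul0r.
  case: eqP => [ii|]; last by rewrite mulr0.
  by rewrite ii si0 mul1r sr eqxx in si.
have Aw i : sin (s i * r) != 0 ->
    Avec U th w 0 i = P (s i) * Avec U th x 0 i + s i * r * x 0 i.
  move=> si; rewrite /w /w1 !AvecD mxE Ae0// addr0 mxE Avec_weight Avec_weight Avec_Avec.
  by congr (_ + _); rewrite /K -/r; field; rewrite !gt_eqF.
(* The cross terms vanish: x against A x by skewness, and [w1] against [e0] because the latter lives
   only where sin(s_i r) = 0, where x and A x are zero. The rest is cot^2 + 1 = 1 / sin^2; where sin
   vanishes, both x and the quotient are 0. *)
have wsq (h : R -> R) : \sum_i h (s i) * w 0 i ^+ 2 =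
    \sum_i h (s i) * x 0 i ^+ 2 / sin (s i * r) ^+ 2 + h 1 * V ^+ 2.
  have cross i : w1 0 i * e0 0 i = 0.
    have [si|/e00 ->] := eqVneq (sin (s i * r)) 0; last by rewrite mulr0.
    by rewrite w1E hx// hA// !mulr0 addr0 mul0r.
  have -> : \sum_i h (s i) * w 0 i ^+ 2 = \sum_i h (s i) * P (s i) ^+ 2 * x 0 i ^+ 2
    + (\sum_i (2 * h (s i) * P (s i) * K (s i)) * (x 0 i * Avec U th x 0 i)
    + (\sum_i (h (s i) * K (s i) ^+ 2) * Avec U th x 0 i ^+ 2
    + \sum_i h (s i) * e0 0 i ^+ 2)).
    rewrite -!big_split/=; apply: eq_bigr => i _.
    have -> : w 0 i = w1 0 i + e0 0 i by rewrite mxE.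
    have -> : h (s i) * (w1 0 i + e0 0 i) ^+ 2 = h (s i) * w1 0 i ^+ 2
       + 2 * h (s i) * (w1 0 i * e0 0 i) + h (s i) * e0 0 i ^+ 2 by ring.
    by rewrite cross w1E; ring.
  rewrite (sum_wAvec0 s_gt0 U_skew U_rel x th (fun u => 2 * h u * P u * K u)) add0r.
  rewrite (sum_wAvec2 s_gt0 U_skew U_rel x th (fun u => h u * K u ^+ 2)) -enorm2 -/r.
  rewrite addrA mulr_sumr -big_split/=; congr (_ + _).
    apply: eq_bigr => i _; have [/hx ->|si] := eqVneq (sin (s i * r)) 0.
      by rewrite expr0n/= !mulr0 mul0r addr0.
    transitivity (h (s i) * x 0 i ^+ 2 * (cos (s i * r) ^+ 2 + sin (s i * r) ^+ 2)
       / sin (s i * r) ^+ 2).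
      by rewrite /P /K; field; rewrite ?si ?(gt_eqF r0) ?(gt_eqF (s_gt0 i)).
    by rewrite cos2Dsin2 mulr1.
  rewrite (bigD1 i0)//= e0E eqxx mulr1 si0 big1 ?addr0// => i ii0.
  by rewrite e0E (negbTE ii0) !mulr0 expr0n mulr0.
have := geodesic s_gt0 U_skew U_rel w r0; rewrite -/r.
rewrite (_ : \row_i _ = x); last first.
  apply/rowP => i; rewrite mxE sin_double.
  have -> : cos (2 * (s i * r)) = 1 - 2 * sin (s i * r) ^+ 2.
    by rewrite mulr_natl cos_mulr2n cos2sin2; ring.
  have [si|si] := eqVneq (sin (s i * r)) 0.
    by rewrite si mul0r mulr0 expr0n/= mulr0 subr0 subrr !mul0r addr0 hx.
  rewrite Aw// mxE e00// addr0 w1E /P /K.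
  transitivity ((cos (s i * r) ^+ 2 + sin (s i * r) ^+ 2) * x 0 i).
    by field; rewrite ?si ?(gt_eqF r0) ?(gt_eqF (s_gt0 i)).
  by rewrite cos2Dsin2 mul1r.
have -> : \sum_i (1 - sin (2 * (s i * r)) / (2 * (s i * r))) * s i ^+ 2 * w 0 i ^+ 2
   = \sum_i s i ^+ 2 * x 0 i ^+ 2 * mu_over (s i * r) + V ^+ 2.
  rewrite (wsq (fun u => (1 - sin (2 * (u * r)) / (2 * (u * r))) * u ^+ 2)) mul1r.
  congr (_ + _).
    apply: eq_bigr => i _; have [/hx ->|si] := eqVneq (sin (s i * r)) 0.
      by rewrite expr0n/= !(mulr0, mul0r).
    rewrite /mu_over (negbTE (al0 i)) /mu; field.
    by rewrite ?si ?(gt_eqF r0) ?(gt_eqF (s_gt0 i)).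
  case: hV => [->|sr]; first by rewrite expr0n/= mulr0.
  by rewrite sin_double sr mul0r mulr0 mul0r subr0 expr1n !mul1r.
have -> : \sum_i (s i * r) ^+ 2 * w 0 i ^+ 2
   = \sum_i x 0 i ^+ 2 * ssin (s i * r) ^+ 2 + (r * V) ^+ 2.
  rewrite (wsq (fun u => (u * r) ^+ 2)) mul1r -exprMn; congr (_ + _).
  apply: eq_bigr => i _; rewrite /ssin (negbTE (al0 i)) expr_div_n.
  by rewrite mulrAC [RHS]mulrC.
exact.
Qed.

(** Serves both regimes: V = 0 on M, and |th| = pi over the cut locus. The equation for t is the
    vertical endpoint reached by [geodesic_to], and [scot_mu_ssin] turns the squared length of that
    geodesic into [radial] at |th|, where the calibration bound meets it. *)
Lemma distance_value x t th (V : R) (i0 : 'I_(2 * n)) :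
  enorm th <= pi -> s i0 = 1 -> radial_dom x (enorm th) -> V = 0 \/ enorm th = pi ->
  4 *: t = (\sum_i s i ^+ 2 * x 0 i ^+ 2 * mu_over (s i * enorm th) + V ^+ 2) *: th ->
  ccdist U (x, t) ^+ 2 = radial x (enorm t) (enorm th).
Proof.
move=> thpi si0 xdom hV ht.
set N := (X in _ = X *: th) in ht.
have r0 := enorm_ge0 th.
have x0 i : sin (s i * enorm th) = 0 -> x 0 i = 0 \/ enorm th = 0.
  move=> si; have [->|xi] := eqVneq (x 0 i) 0; [by left|right].
  apply/eqP; rewrite eq_le r0 andbT leNgt; apply/negP => rgt0.
  suff : 0 < sin (s i * enorm th) by rewrite si ltxx.
  by apply: sin_gt0_pi; rewrite mulr_gt0// xdom.
have N0 : 0 <= N.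
  rewrite addr_ge0 ?sqr_ge0// sumr_ge0// => i _.
  have [->|xi] := eqVneq (x 0 i) 0; first by rewrite expr0n mulr0 mul0r.
  have si : 0 <= s i * enorm th < pi by rewrite xdom// andbT mulr_ge0// ltW.
  by rewrite mu_overE//; apply: mulr_ge0; [rewrite mulr_ge0// sqr_ge0|rewrite ltW// nu_gt0].
have tE : t = (N / 4) *: th.
  have := congr1 (fun v => 4^-1 *: v) ht.
  by rewrite !scalerA mulVf ?pnatr_eq0// scale1r mulrC.
have Tr : 4 * enorm t * enorm th = N * enorm th ^+ 2.
  by rewrite tE enormZ ger0_norm ?divr_ge0//; field.
have Tip : 4 * ip t th = N * enorm th ^+ 2 by rewrite tE ipZl enorm2; field.
set L2 := radial _ _ _.
have L2E : L2 = \sum_i x 0 i ^+ 2 * ssin (s i * enorm th) ^+ 2 + (enorm th * V) ^+ 2.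
  rewrite /L2 /radial Tr /N mulrDl exprMn [V ^+ 2 * _]mulrC addrAC; congr (_ + _).
  rewrite mulr_suml -big_split/=; apply: eq_bigr => i _.
  have [->|xi] := eqVneq (x 0 i) 0; first by rewrite expr0n !(mulr0, mul0r) addr0.
  have si : 0 <= s i * enorm th < pi by rewrite xdom// andbT mulr_ge0// ltW.
  rewrite scot_mu_ssin; last first.
    have [->|rn0] := eqVneq (s i * enorm th) 0; [by right|left].
    rewrite gt_eqF// sin_gt0_pi// lt_neqAle eq_sym rn0.
    by have /andP[-> ->] := si.
  rewrite mu_overE// muE//; ring.
have L20 : 0 <= L2 by rewrite L2E addr_ge0 ?sqr_ge0// sumr_ge0// => i _; rewrite mulr_ge0 ?sqr_ge0.
rewrite (@ccdist_eq _ _ _ U (x, t) (Num.sqrt L2)) ?sqrtr_ge0 ?sqr_sqrtr//.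
- have [th0|rn0] := eqVneq (enorm th) 0.
    move: th0 tE => /eqP; rewrite enorm_eq0 => /eqP th0; rewrite th0 scaler0 => t0.
    have [cx [ct [hc hl]]] := straight_line s_gt0 U_skew U_rel x.
    exists cx, ct; rewrite t0; split => //; rewrite hl; congr (Num.sqrt _)%:E.
    rewrite L2E th0 enorm0 mul0r expr0n addr0; apply: eq_bigr => i _.
    by rewrite mulr0 /ssin eqxx expr1n mulr1 expr2.
  have rgt0 : 0 < enorm th by rewrite lt_neqAle eq_sym rn0.
  have [||cx [ct [hc hl]]] := @geodesic_to x th V i0 rgt0 si0.
  + by move=> i /x0[//|/eqP]; rewrite (negbTE rn0).
  + by case: hV => [|->]; [left|right; exact: sinpi].
  by exists cx, ct; rewrite -L2E in hl; rewrite tE; split.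
- move=> cx ct /hcurve_lower_bound => /(_ s s_gt0 s_le1 U_skew U_rel)[E [E0 hE] lb].
  apply: le_trans hE; rewrite lee_fin -[E]ger0_norm// -sqrtr_sqr ler_wsqrtr//.
  have lb' y : 0 <= y -> y <= enorm th -> y < pi -> radial x (enorm t) y <= E ^+ 2.
    move=> y0 yr ypi; have [r00|rn0] := eqVneq (enorm th) 0.
      have yE : y = 0 by apply/eqP; rewrite eq_le y0 andbT -r00.
      have := lb 0; rewrite enorm0 pi_gt0 => /(_ isT); apply: le_trans.
      by rewrite ipC ip0l /= /radial yE !mulr0.
    (* On the ray of [th], which also carries t, one has t . tau = |t| |tau|, so the calibration
       bound is [radial] at y. *)
    have := lb ((y / enorm th) *: th).
    rewrite enormZ ger0_norm ?divr_ge0// divfK// => /(_ ypi); apply: le_trans.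
    rewrite /= /radial ipZr lerD2r mulrCA Tip.
    rewrite -(ler_pM2r (_ : 0 < enorm th)) ?lt_neqAle 1?eq_sym ?rn0//.
    rewrite mulrAC Tr le_eqVlt; apply/orP; left; apply/eqP; field.
    exact: rn0.
  have [rpi|] := ltP (enorm th) pi; first exact: lb'.
  move=> pir; have rE : enorm th = pi by apply/eqP; rewrite eq_le thpi.
  rewrite /L2; apply: left_closed_le (is_derive_radial _ _ _) _ => //.
    by rewrite rE pi_gt0.
  by move=> y /andP[y0 yr]; apply: lb'; rewrite ?ltW// -rE.
Qed.

End distance.

(** * Monotonicity of the radial function and of its slope *)

Section radial_monotonicity.
Context {R : realType}.

Lemma mu_unbounded (K : R) : exists2 r : R, 0 < r < pi & K <= mu r.
Proof.
pose K1 := Num.max K 1; have K10 : 0 < K1 by rewrite lt_max ltr01 orbT.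
have pi0 := pi_gt0 R.
(* For y in ]pi / 2, pi[ with sin y < e, K1 sin^2 y <= pi / 2 < y, while the numerator of mu is at
   least 2 y because cos y <= 0. *)
pose e := Num.min (pi / 2 / K1) 1.
have e0 : 0 < e by rewrite lt_min ltr01 !divr_gt0.
have csin : {for pi, continuous (@sin R)} by exact: is_derive_continuous1 (is_derive_sin _).
have /cvgrPdist_lt/(_ _ e0)[del /= d0 hd] := csin.
pose y := pi - Num.min (del / 2) (pi / 4).
have mn : 0 < Num.min (del / 2) (pi / 4) by rewrite lt_min !divr_gt0.
have mn1 : Num.min (del / 2) (pi / 4) <= del / 2 by rewrite ge_min lexx.
have mn2 : Num.min (del / 2) (pi / 4) <= pi / 4 by rewrite ge_min lexx orbT.
have y0 : pi / 2 < y by rewrite /y; lra.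
have ypi : y < pi by rewrite /y; lra.
have y0pi : 0 < y < pi by rewrite ypi andbT; lra.
exists y => //.
have sy : 0 < sin y by exact: sin_gt0_pi.
have : `|sin pi - sin y| < e.
  apply: hd; rewrite /ball_ /= /y opprB addrC subrK gtr0_norm//; lra.
rewrite sinpi sub0r normrN gtr0_norm// lt_min => /andP[sy1 sy2].
have cy : cos y <= 0.
  rewrite -(subrK pi y) cosDpi oppr_le0 -cosN opprB.
  by apply: cos_ge0_pihalf; lra.
have K1mu : K1 <= mu y.
  rewrite /mu ler_pdivlMr ?mulr_gt0 ?exprn_gt0// sin_double.
  have : K1 * sin y ^+ 2 <= pi / 2.
    rewrite ltr_pdivlMr// in sy1; have : 0 < sin y * K1 by rewrite mulr_gt0.
    have -> : K1 * sin y ^+ 2 = (sin y * K1) * sin y by ring.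
    nra.
  have : sin y * cos y <= 0 by rewrite mulr_ge0_le0// ltW.
  lra.
by apply: le_trans K1mu; rewrite le_max lexx.
Qed.

Variables (N : nat) (s : 'I_(2 * N) -> R).
Hypothesis s_gt0 : forall i, 0 < s i.
Hypothesis s_le1 : forall i, s i <= 1.
Implicit Types (x : 'rV[R]_(2 * N)) (r T : R).

Lemma sr_dom x r i : 0 <= r -> radial_dom s x r -> x 0 i != 0 -> 0 <= s i * r < pi.
Proof. by move=> r0 xr xi; rewrite xr// andbT mulr_ge0// ltW. Qed.

Lemma slope0 x : slope s x 0 = 0.
Proof. by rewrite /slope big1// => i _; rewrite mulr0 mu0 !mulr0. Qed.

Lemma slope_lt x r r' : x != 0 -> 0 <= r -> r < r' -> radial_dom s x r' ->
  slope s x r < slope s x r'.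
Proof.
move=> x0 r0 rr' xr'.
have h i : x 0 i != 0 -> s i * mu (s i * r) < s i * mu (s i * r').
  move=> xi; rewrite ltr_pM2l//; apply: mu_lt; rewrite ?mulr_ge0 ?ltr_pM2l ?xr'// ltW//.
have [i xi] : exists i, x 0 i != 0.
  by apply/rV0Pn.
rewrite /slope (bigD1 i)//= [ltRHS](bigD1 i)//=; apply: ltr_leD.
  by rewrite ltr_pM2l ?h// exprn_even_gt0.
apply: ler_sum => j _; have [->|xj] := eqVneq (x 0 j) 0; first by rewrite expr0n !mul0r.
by rewrite ler_wpM2l ?sqr_ge0// ltW// h.
Qed.

Lemma slope_le x r r' : 0 <= r -> r <= r' -> radial_dom s x r' ->
  slope s x r <= slope s x r'.
Proof.
move=> r0; rewrite le_eqVlt => /predU1P[->//|rr' h].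
have [->|x0] := eqVneq x 0; last by rewrite ltW// slope_lt.
by rewrite /slope !big1// => i _; rewrite mxE expr0n mul0r.
Qed.

(** The slope with mu(u) written as u nu(u^2), a form whose derivative is also available at r = 0,
    as the intermediate value theorem on [0, r'] requires. *)
Definition slope_ext x r : R := \sum_i x 0 i ^+ 2 * (s i * (s i * r * nu ((s i * r) ^+ 2))).

Definition dslope x r : R := \sum_i x 0 i ^+ 2 * (s i ^+ 2 * dmu (s i * r)).

Lemma slope_extE x r : 0 <= r -> radial_dom s x r -> slope s x r = slope_ext x r.
Proof.
move=> r0 xr; apply: eq_bigr => i _.
have [->|xi] := eqVneq (x 0 i) 0; first by rewrite expr0n !mul0r.
by rewrite muE// (sr_dom r0 xr xi).
Qed.

Lemma is_derive_slope_ext x r : 0 <= r -> radial_dom s x r ->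
  is_derive r 1 (slope_ext x) (dslope x r).
Proof.
move=> r0 xr; apply: is_derive_sum_seq => i.
have [->|xi] := eqVneq (x 0 i) 0.
  rewrite expr0n mul0r (_ : (fun _ => _) = cst 0); first exact: is_derive_cst.
  by apply/funext => y; rewrite mul0r.
apply: is_deriveZ_fun; rewrite expr2 -mulrA; apply: is_deriveZ_fun; rewrite mulrC.
apply: (is_derive_comp_fun (f := fun y => y * nu (y ^+ 2)) (g := fun y => s i * y)).
  by apply: is_derive_mu_ext; exact: sr_dom r0 xr xi.
by apply: (is_derive_eq (is_deriveZ_fun (s i) (is_derive_id r 1))); rewrite mulr1.
Qed.

Lemma slope_root x T r' : 0 <= T -> 0 < r' -> radial_dom s x r' -> 4 * T < slope s x r' ->
  exists2 r, 0 <= r < r' & slope s x r = 4 * T.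
Proof.
move=> T0 r'0 xr' Tr'.
have h r : 0 <= r -> r <= r' -> radial_dom s x r by move=> _; exact: radial_dom_le xr'.
have [||r] := @IVT _ (slope_ext x) 0 r' (4 * T) (ltW r'0).
- apply: derivable_within_continuous => y; rewrite in_itv/= => /andP[y0 y1].
  by have [] := is_derive_slope_ext y0 (h _ y0 y1).
- have hx0 : radial_dom s x 0 by apply: (h 0 (lexx 0) (ltW r'0)).
  rewrite -!slope_extE ?lexx ?(ltW r'0) ?slope0 //.
  by rewrite ge_min mulr_ge0//= le_max (ltW Tr') orbT.
rewrite in_itv/= => /andP[r0 r1]; rewrite -(slope_extE r0 (h _ r0 r1)) => e; exists r => //.
rewrite r0 lt_neqAle r1 andbT; apply/eqP => rr'.
by move: Tr'; rewrite -e rr' ltxx.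
Qed.

(** A nonzero coordinate with s i = 1 sends the slope to infinity at pi, so every |t| is matched by
    a radius below pi. *)
Lemma slope_unbounded x T i : s i = 1 -> x 0 i != 0 ->
  exists2 r, 0 < r < pi & 4 * T < slope s x r.
Proof.
move=> si xi; have xi2 : 0 < x 0 i ^+ 2 by rewrite exprn_even_gt0.
have [r /andP[r0 rpi] h] := mu_unbounded ((4 * T + 1) / x 0 i ^+ 2).
exists r; first by rewrite r0.
apply: (@lt_le_trans _ _ (4 * T + 1)); first by rewrite ltrDl.
rewrite ler_pdivrMr// in h; apply: (le_trans h).
rewrite /slope (bigD1 i)//= si !mul1r mulrC lerDl sumr_ge0// => j _.
have xr : radial_dom s x r by exact: radial_dom_pi.
have [->|xj] := eqVneq (x 0 j) 0; first by rewrite expr0n mul0r.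
have := sr_dom (ltW r0) xr xj; rewrite le_eqVlt => /andP[/predU1P[e|p1] p2].
  by rewrite -e mu0 !mulr0.
by rewrite mulr_ge0 ?sqr_ge0// mulr_ge0 ?ltW// mu_gt0// p1.
Qed.

Lemma radial_MVT x T r r' : 0 <= r -> r < r' -> radial_dom s x r' ->
  exists2 c, r < c < r' & radial s x T r' - radial s x T r = (4 * T - slope s x c) * (r' - r).
Proof.
move=> r0 rr' xr'.
have h y : y <= r' -> radial_dom s x y by exact: radial_dom_le xr'.
have [||c] := @MVT _ (radial s x T) (fun y => 4 * T - slope s x y) r r' rr'.
- move=> y; rewrite in_itv/= => /andP[y0 y1].
  by apply: is_derive_radial => //; [lra|apply: h; exact: ltW].
- apply: derivable_within_continuous => y; rewrite in_itv/= => /andP[y0 y1].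
  have y0' : 0 <= y by lra.
  by have [] := is_derive_radial s_gt0 T y0' (h _ y1).
by rewrite in_itv/= => c1 e; exists c.
Qed.

Lemma radial_lt_left x T r r' : 0 <= r -> r < r' -> radial_dom s x r' ->
  slope s x r' <= 4 * T -> x != 0 \/ 0 < T -> radial s x T r < radial s x T r'.
Proof.
move=> r0 rr' xr' sT xT; have [c /andP[c0 c1] e] := radial_MVT T r0 rr' xr'.
rewrite -subr_gt0 e mulr_gt0 ?subr_gt0//; have [xe|x0] := eqVneq x 0.
  case: xT => [|T0]; first by rewrite xe eqxx.
  by rewrite /slope big1 ?mulr_gt0// => i _; rewrite xe mxE expr0n mul0r.
apply: lt_le_trans sT; apply: slope_lt => //; lra.
Qed.

Lemma radial_lt_right x T r r' : 0 <= r -> r < r' -> radial_dom s x r' ->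
  4 * T <= slope s x r -> x != 0 -> radial s x T r' < radial s x T r.
Proof.
move=> r0 rr' xr' sT x0; have [c /andP[c0 c1] e] := radial_MVT T r0 rr' xr'.
rewrite -subr_lt0 e pmulr_llt0 ?subr_gt0// subr_lt0.
apply: le_lt_trans sT _; apply: slope_lt => //.
by apply: radial_dom_le xr' _ => //; exact: ltW.
Qed.

End radial_monotonicity.

(** * Critical points of the reference function *)

Section critical_points.
Context {R : realType} (n m : nat) (s : 'I_(2 * n) -> R).
Hypothesis s_gt0 : forall i, 0 < s i.
Hypothesis s_le1 : forall i, s i <= 1.
Implicit Types (x : 'rV[R]_(2 * n)) (t th tau v : 'rV[R]_m) (r w : R).

Lemma is_derive_coord N (j : 'I_N) (x v : 'rV[R]_N) :
  is_derive x v (fun y : 'rV[R]_N => y 0 j) (v 0 j).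
Proof.
apply/is_derive_lineP.
have -> : (fun h : R => (h *: v + x) 0 j) = (fun h : R => h * v 0 j + x 0 j).
  by apply/funext => h; rewrite !mxE.
have h1 := is_deriveM_fun (is_derive_id (0 : R) 1) (is_derive_cst (v 0 j) (0 : R) 1).
apply: (is_derive_eq (is_deriveD_fun h1 (is_derive_cst (x 0 j) (0 : R) 1))).
by rewrite /cst mul1r mulr0 !addr0.
Qed.

Lemma is_derive_ipl N (t x v : 'rV[R]_N) : is_derive x v (fun y => ip t y) (ip t v).
Proof.
by apply: is_derive_sum_seq => j; apply: is_deriveZ_fun; exact: is_derive_coord.
Qed.

Lemma is_derive_ip2 N (x v : 'rV[R]_N) : is_derive x v (fun y => ip y y) (2 * ip x v).
Proof.
rewrite /ip mulr_sumr; apply: is_derive_sum_seq => j.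
apply: (is_derive_eq (is_deriveM_fun (is_derive_coord j x v) (is_derive_coord j x v))).
by ring.
Qed.

Lemma continuous_ip2 N : continuous (fun y : 'rV[R]_N => ip y y).
Proof.
move=> x; apply: (cvg_sum_seq (FF := nbhs_filter x)) => j.
by apply: cvgM; exact: coord_continuous.
Qed.

Lemma near_enorm_lt N (x : 'rV[R]_N) (c : R) : enorm x < c ->
  \forall y \near x, enorm y < c.
Proof.
move=> xc; have c0 : 0 < c by apply: le_lt_trans xc; exact: enorm_ge0.
have h : ip x x < c ^+ 2 by rewrite -enorm2 ltrXn2r// ?nnegrE ?enorm_ge0 ?ltW.
have e0 : 0 < c ^+ 2 - ip x x by rewrite subr_gt0.
have hn : \forall y \near x, `|ip x x - ip y y| < c ^+ 2 - ip x x.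
  by have /cvgrPdist_lt/(_ _ e0) := @continuous_ip2 N x.
apply: filterS hn => y hy; have : ip y y < c ^+ 2.
  by have := ler_norm (ip y y - ip x x); rewrite distrC; lra.
by rewrite -enorm2 ltr_pXn2r ?nnegrE ?enorm_ge0// ltW.
Qed.

Definition phis x t tau : R := 4 * ip t tau + \sum_i x 0 i ^+ 2 * scot (s i * enorm tau).

(** With w = |tau|^2 the gradient of [phis] is 4 t - Nsum x w tau, an expression that stays
    differentiable at tau = 0. [Nsum'] is the derivative in w. *)
Definition Nsum x w : R := \sum_i s i ^+ 2 * x 0 i ^+ 2 * nu (s i ^+ 2 * w).
Definition Nsum' x w : R := \sum_i s i ^+ 2 * x 0 i ^+ 2 * (s i ^+ 2 * nu' (s i ^+ 2 * w)).

Lemma sinc_sqrt_ip_neq0 tau i : enorm tau < pi -> sinc_sqrt (s i ^+ 2 * ip tau tau) != 0.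
Proof.
move=> h; rewrite -enorm2 -exprMn gt_eqF// sinc_sqrt_gt0//.
rewrite mulr_ge0 ?enorm_ge0 ?ltW//=; apply: le_lt_trans h.
by rewrite ler_piMl// enorm_ge0.
Qed.

Lemma is_derive_phis x t tau v : enorm tau < pi ->
  is_derive tau v (phis x t) (4 * ip t v - Nsum x (ip tau tau) * ip tau v).
Proof.
move=> taupi; rewrite /Nsum mulr_suml -sumrN.
apply: is_deriveD_fun; first by apply: is_deriveZ_fun; exact: is_derive_ipl.
apply: is_derive_sum_seq => i.
have h := is_derive_comp_fun (f := scot_sqrt) (g := fun y : 'rV[R]_m => s i ^+ 2 * ip y y)
  (is_derive_scot_sqrt (sinc_sqrt_ip_neq0 i taupi))
  (is_deriveZ_fun (s i ^+ 2) (is_derive_ip2 tau v)).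
have -> : (fun y : 'rV[R]_m => x 0 i ^+ 2 * scot (s i * enorm y)) =
    (fun y => x 0 i ^+ 2 * scot_sqrt (s i ^+ 2 * ip y y)).
  by apply/funext => y; rewrite scotE exprMn enorm2.
by apply: (is_derive_eq (is_deriveZ_fun (x 0 i ^+ 2) h)); field.
Qed.

Lemma is_derive_grad_phis x t tau v (j : 'I_m) : enorm tau < pi ->
  is_derive tau v (fun y => derive (phis x t) y (unit_rv j))
    (- (Nsum' x (ip tau tau) * (2 * ip tau v) * tau 0 j + Nsum x (ip tau tau) * v 0 j)).
Proof.
move=> taupi.
have dN : is_derive tau v (fun y => Nsum x (ip y y)) (Nsum' x (ip tau tau) * (2 * ip tau v)).
  rewrite /Nsum' mulr_suml; apply: is_derive_sum_seq => i.
  have h := is_derive_comp_fun (f := nu) (g := fun y : 'rV[R]_m => s i ^+ 2 * ip y y)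
    (is_derive_nu (sinc_sqrt_ip_neq0 i taupi))
    (is_deriveZ_fun (s i ^+ 2) (is_derive_ip2 tau v)).
  by apply: (is_derive_eq (is_deriveZ_fun (s i ^+ 2 * x 0 i ^+ 2) h)); ring.
have h := is_deriveB_fun (is_derive_cst (4 * t 0 j) tau v)
  (is_deriveM_fun dN (is_derive_coord j tau v)).
rewrite sub0r in h; apply: near_eq_is_derive h.
have := near_enorm_lt taupi; apply: filterS => y ypi.
by rewrite (is_derive_val (is_derive_phis x t (unit_rv j) ypi)) !ip_unit.
Qed.

Lemma Nsum_gt0 x w : x != 0 -> 0 <= w < pi ^+ 2 -> 0 < Nsum x w.
Proof.
move=> /rV0Pn[i xi] /andP[w0 wpi].
have nup j : 0 < nu (s j ^+ 2 * w).
  rewrite -[w]sqr_sqrtr// -exprMn; apply: nu_gt0.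
  rewrite mulr_ge0 ?sqrtr_ge0 ?ltW//=.
  apply: (@le_lt_trans _ _ (Num.sqrt w)); first by rewrite ler_piMl ?sqrtr_ge0.
  by rewrite -(@ltr_pXn2r _ 2) ?nnegrE ?sqrtr_ge0 ?pi_ge0// sqr_sqrtr.
rewrite /Nsum (bigD1 i)//=; apply: ltr_wpDr.
  by apply: sumr_ge0 => j _; apply: mulr_ge0; [rewrite mulr_ge0// sqr_ge0|exact: ltW].
apply: mulr_gt0 => //; apply: mulr_gt0; first exact: exprn_gt0.
by rewrite exprn_even_gt0.
Qed.

Lemma Nsum_dslope x tau : Nsum x (ip tau tau) + 2 * ip tau tau * Nsum' x (ip tau tau)
  = dslope s x (enorm tau).
Proof.
rewrite mulr_sumr -big_split/=; apply: eq_bigr => i _.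
by rewrite /dmu exprMn enorm2; ring.
Qed.

Lemma dslope_gt0 x r : x != 0 -> 0 <= r -> radial_dom s x r -> 0 < dslope s x r.
Proof.
move=> /rV0Pn[i xi] r0 xr.
have h j : x 0 j != 0 -> 0 < dmu (s j * r) by move=> xj; exact: dmu_gt0 (sr_dom s_gt0 r0 xr xj).
rewrite /dslope (bigD1 i)//=; apply: ltr_wpDr.
  apply: sumr_ge0 => j _; have [->|xj] := eqVneq (x 0 j) 0; first by rewrite expr0n mul0r.
  by apply: mulr_ge0; [exact: sqr_ge0|apply: mulr_ge0; [exact: sqr_ge0|rewrite ltW// h]].
apply: mulr_gt0; first by rewrite exprn_even_gt0.
by apply: mulr_gt0; [exact: exprn_gt0|exact: h].
Qed.

(** The Hessian is - (N I + 2 N' tau tau^T), with eigenvalue - N across tau and - (N + 2 |tau|^2 N')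
    = - [dslope] along it, both negative unless x = 0. For x = 0 it is the zero matrix, which is
    singular because m > 0. *)
Lemma nondeg_critP x t tau : (0 < m)%N -> enorm tau < pi ->
  nondeg_crit (phis x t) tau <-> 4 *: t = Nsum x (ip tau tau) *: tau /\ x != 0.
Proof.
move=> m0 taupi.
have He i j : derive (fun y => derive (phis x t) y (unit_rv j)) tau (unit_rv i) =
   - (Nsum' x (ip tau tau) * (2 * tau 0 i) * tau 0 j + Nsum x (ip tau tau) * (i == j)%:R).
  rewrite (is_derive_val (is_derive_grad_phis x t _ _ taupi)) ip_unit mxE eqxx.
  by rewrite eq_sym.
have crit : (forall v, derivable (phis x t) tau v /\ derive (phis x t) tau v = 0) <->
   4 *: t = Nsum x (ip tau tau) *: tau.
  split=> [h|e v].
    apply/rowP => j; have [_] := h (unit_rv j).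
    rewrite (is_derive_val (is_derive_phis x t _ taupi)) !ip_unit !mxE => /eqP.
    by rewrite subr_eq0 => /eqP.
  have h := is_derive_phis x t v taupi; split; first by case: h.
  by rewrite (is_derive_val h) -!ipZl e subrr.
have Hx0 : x = 0 -> Nsum x (ip tau tau) = 0 /\ Nsum' x (ip tau tau) = 0.
  by move=> ->; split; apply: big1 => i _; rewrite mxE expr0n mulr0 mul0r.
split=> [[/crit h1 _ h2]|[/crit h1 x0]]; split => //.
- apply: contraNneq h2 => /Hx0[N0 N0']; apply/det0P; exists (unit_rv (Ordinal m0)).
    apply/rV0Pn; exists (Ordinal m0); by rewrite mxE !eqxx oner_eq0.
  rewrite (_ : \matrix_(i, j) _ = 0) ?mulmx0//; apply/matrixP => i j.
  by rewrite !mxE He N0 N0' !mul0r addr0 oppr0.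
- by move=> i j; case: (is_derive_grad_phis x t (unit_rv i) j taupi).
- apply/det0P => -[u u0 hu].
  have := congr1 (fun M => ip M u) hu; rewrite ip0l /ip.
  set N := Nsum x _ in He *; set N' := Nsum' x _ in He *.
  have -> : \sum_i (u *m \matrix_(i, j)
     derive (fun y => derive (phis x t) y (unit_rv j)) tau (unit_rv i)) 0 i * u 0 i
     = - (N * ip u u + 2 * N' * ip tau u ^+ 2).
    have -> : N * ip u u = \sum_i \sum_k u 0 k * (N * (k == i)%:R) * u 0 i.
      rewrite mulr_sumr; apply: eq_bigr => i _; rewrite (bigD1 i)//= eqxx big1 ?addr0.
        by rewrite mulr1; ring.
      by move=> k /negbTE ->; rewrite !mulr0 mul0r.
    have quad (c : R) : 2 * c * ip tau u ^+ 2
        = \sum_i \sum_k u 0 k * (c * (2 * tau 0 k) * tau 0 i) * u 0 i.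
      rewrite expr2 {1}/ip big_distrl big_distrr/=; apply: eq_bigr => i _.
      by rewrite /ip !big_distrr/=; apply: eq_bigr => k _; ring.
    rewrite quad.
    rewrite -big_split -sumrN/=; apply: eq_bigr => i _.
    rewrite mxE mulr_suml -big_split -sumrN/=; apply: eq_bigr => k _.
    by rewrite mxE He; ring.
  have u2 : 0 < ip u u by rewrite lt_neqAle eq_sym ip_eq0 u0 ip_ge0.
  have w0 := ip_ge0 tau.
  have wpi : ip tau tau < pi ^+ 2 by rewrite -enorm2 ltr_pXn2r ?nnegrE ?enorm_ge0 ?pi_ge0.
  have N0 : 0 < N by apply: Nsum_gt0 => //; rewrite w0.
  have cs : ip tau u ^+ 2 <= ip tau tau * ip u u.
    have k1 := ip_le_enorm tau u.
    have k2 := ip_le_enorm (- tau) u; rewrite -scaleN1r ipZl enormZ normrN1 mul1r mulN1r in k2.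
    rewrite -!enorm2 -exprMn -real_normK ?num_real// ler_pXn2r ?nnegrE//.
      by rewrite ler_norml; apply/andP; split => //; rewrite lerNl.
    by rewrite mulr_ge0 ?enorm_ge0.
  have hd : 0 < N + 2 * ip tau tau * N'.
    by rewrite Nsum_dslope dslope_gt0 ?enorm_ge0//; exact: radial_dom_pi.
  have := sqr_ge0 (ip tau u).
  move=> hs /eqP; rewrite oppr_eq0 => /eqP e.
  (* For N' < 0, Cauchy-Schwarz replaces (tau . u)^2 by |tau|^2 |u|^2, which leaves the eigenvalue
     along tau. *)
  have [N'0|N'0] := leP 0 N'.
    have : 0 < N * ip u u by rewrite mulr_gt0.
    have : 0 <= 2 * N' * ip tau u ^+ 2 by rewrite mulr_ge0// mulr_ge0.
    by lra.
  have : 2 * N' * (ip tau tau * ip u u) <= 2 * N' * ip tau u ^+ 2.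
    by apply: ler_wnM2l => //; lra.
  have : 0 < (N + 2 * ip tau tau * N') * ip u u by rewrite mulr_gt0.
  by lra.
Qed.

End critical_points.

(** * The set M, the distance and the supremum of phi in coordinates *)

Section main_coordinates.
Context {R : realType} (n m : nat) (U : 'I_m -> 'M[R]_(2 * n)) (s : 'I_(2 * n) -> R).
Hypothesis s_gt0 : forall i, 0 < s i.
Hypothesis s_le1 : forall i, s i <= 1.
Hypothesis s_max : exists i0, s i0 = 1.
Hypothesis U_skew : forall j, (U j)^T = - U j.
Hypothesis U_rel : forall lam lam' : 'rV[R]_m,
  - (Amat U lam *m Amat U lam' + Amat U lam' *m Amat U lam)
  = (2 * ip lam lam') *: wdiag s (fun u => u ^+ 2).
Implicit Types (x : 'rV[R]_(2 * n)) (t th tau : 'rV[R]_m) (r : R).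

Definition hasmax x : Prop := exists2 i, s i = 1 & x 0 i != 0.

(** Without a component in the last block, the division by zero in mu(pi) enters [slope s x pi] only
    multiplied by vanishing coordinates. *)
Definition inM x t : Prop := hasmax x \/ 4 * enorm t < slope s x pi.

Definition Nover x r : R := \sum_i s i ^+ 2 * x 0 i ^+ 2 * mu_over (s i * r).

Lemma radial_dom_nomax x : ~ hasmax x -> radial_dom s x pi.
Proof.
move=> h i xi; rewrite gtr_pMl ?pi_gt0// lt_neqAle s_le1 andbT.
by apply/eqP => si; apply: h; exists i.
Qed.

Lemma inM_neq0 x t : inM x t -> x != 0.
Proof.
move=> [[i _]|]; first by apply: contraNneq => ->; rewrite mxE.
apply: contraTneq => ->; rewrite -leNgt /slope big1 ?mulr_ge0 ?enorm_ge0// => i _.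
by rewrite mxE expr0n mul0r.
Qed.

Lemma Nover_Nsum x r : 0 <= r < pi -> Nover x r = Nsum s x (r ^+ 2).
Proof.
move=> /andP[r0 rpi]; apply: eq_bigr => i _; rewrite mu_overE ?exprMn//.
apply/andP; split; first by rewrite mulr_ge0// ltW.
by apply: le_lt_trans rpi; rewrite ler_piMl.
Qed.

Lemma Nover_slope x r : Nover x r * r = slope s x r.
Proof.
rewrite mulr_suml; apply: eq_bigr => i _; rewrite /mu_over.
case: eqP => [/eqP|/eqP sr].
  rewrite mulf_eq0 gt_eqF//= => /eqP ->.
  by rewrite !mulr0 mu0 !mulr0.
have r0 : r != 0 by apply: contraNneq sr => ->; rewrite mulr0.
by field; rewrite r0 gt_eqF.
Qed.

Lemma Nover_gt0 x r : x != 0 -> 0 <= r < pi -> 0 < Nover x r.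
Proof.
move=> x0 /andP[r0 rpi]; rewrite Nover_Nsum ?r0//; apply: Nsum_gt0 => //.
by rewrite sqr_ge0/= ltr_pXn2r ?nnegrE ?pi_ge0.
Qed.

Lemma inM_root x t : inM x t -> exists2 r, 0 <= r < pi & slope s x r = 4 * enorm t.
Proof.
move=> h; have [[i si xi]|nmax] := pselect (hasmax x).
  have [r' /andP[r'0 r'pi] hr'] := slope_unbounded s_gt0 s_le1 (enorm t) si xi.
  have [r /andP[r0 rr'] hr] := slope_root s_gt0 (enorm_ge0 t) r'0
    (radial_dom_pi s_gt0 s_le1 (x := x) r'pi) hr'.
  by exists r => //; rewrite r0 (lt_trans rr').
have {}h : 4 * enorm t < slope s x pi by case: h.
have [r hr hr'] := slope_root s_gt0 (enorm_ge0 t) (pi_gt0 R) (radial_dom_nomax nmax) h.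
by exists r.
Qed.

Lemma inM_theta x t : inM x t ->
  exists2 th, enorm th < pi & 4 *: t = Nover x (enorm th) *: th.
Proof.
move=> h; have [r /andP[r0 rpi] hr] := inM_root h.
have [t0|tn0] := eqVneq t 0.
  by exists 0; rewrite ?enorm0 ?pi_gt0// t0 !scaler0.
have T0 : 0 < enorm t by rewrite lt_neqAle eq_sym enorm_eq0 tn0 enorm_ge0.
exists ((r / enorm t) *: t).
  by rewrite enormZ ger0_norm ?divr_ge0 ?enorm_ge0// divfK ?gt_eqF.
rewrite enormZ ger0_norm ?divr_ge0 ?enorm_ge0// divfK ?gt_eqF// scalerA mulrA.
by rewrite Nover_slope hr mulfK// gt_eqF.
Qed.

Lemma theta_slope x t th : (4 : R) *: t = Nover x (enorm th) *: th -> x != 0 ->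
  enorm th < pi -> slope s x (enorm th) = 4 * enorm t.
Proof.
move=> e x0 thpi; have := congr1 (@enorm R m) e; rewrite !enormZ => h.
rewrite -Nover_slope -[Nover x _]ger0_norm; last first.
  by rewrite ltW// Nover_gt0// enorm_ge0.
by rewrite -h ger0_norm.
Qed.

Lemma slope_inj x r r' : x != 0 -> 0 <= r < pi -> 0 <= r' < pi ->
  slope s x r = slope s x r' -> r = r'.
Proof.
move=> x0 /andP[r0 rpi] /andP[r'0 r'pi] e.
have h y y' : 0 <= y -> y < y' -> y' < pi -> slope s x y < slope s x y'.
  by move=> y0 yy' y'pi; apply: slope_lt => //; exact: radial_dom_pi.
case: (ltgtP r r') => // rr'.
  by have := h _ _ r0 rr' r'pi; rewrite e ltxx.
by have := h _ _ r'0 rr' rpi; rewrite e ltxx.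
Qed.

Lemma theta_unique x t th th' : x != 0 -> enorm th < pi -> enorm th' < pi ->
  (4 : R) *: t = Nover x (enorm th) *: th -> (4 : R) *: t = Nover x (enorm th') *: th' ->
  th = th'.
Proof.
move=> x0 hpi hpi' e e'.
have rr : enorm th = enorm th'.
  by apply: (@slope_inj x) => //; rewrite ?enorm_ge0// (theta_slope e) ?(theta_slope e').
have N0 : 0 < Nover x (enorm th) by rewrite Nover_gt0// enorm_ge0.
apply: (scalerI (lt0r_neq0 N0)); rewrite -e {}e'.
by rewrite rr.
Qed.

Lemma inM_critP x t : (0 < m)%N ->
  (exists tau, enorm tau < pi /\ nondeg_crit (phis s x t) tau) <-> inM x t.
Proof.
move=> m0; split=> [[tau [taupi]]|h].
  move=> /(nondeg_critP s_gt0 s_le1 _ _ m0 taupi)[e x0].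
  have {}e : 4 *: t = Nover x (enorm tau) *: tau.
    by rewrite Nover_Nsum ?enorm_ge0// enorm2.
  have [hm|nm] := pselect (hasmax x); first by left.
  right; rewrite -(theta_slope e x0 taupi); apply: slope_lt => //.
    exact: enorm_ge0.
  exact: radial_dom_nomax.
have [th thpi e] := inM_theta h; exists th; split => //.
apply/(nondeg_critP s_gt0 s_le1 _ _ m0 thpi); split; last exact: inM_neq0 h.
by rewrite e Nover_Nsum ?enorm_ge0// enorm2.
Qed.

Lemma ccdist_theta x t th : enorm th < pi -> 4 *: t = Nover x (enorm th) *: th ->
  ccdist U (x, t) ^+ 2 = radial s x (enorm t) (enorm th).
Proof.
move=> thpi e; have [i0 si0] := s_max.
apply: (@distance_value _ _ _ U s s_gt0 s_le1 U_skew U_rel x t th 0 i0) => //.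
- exact: ltW.
- exact: radial_dom_pi.
- by left.
- by rewrite expr0n addr0.
Qed.

Lemma ninM x t : ~ inM x t -> ~ hasmax x /\ slope s x pi <= 4 * enorm t.
Proof.
move=> h; split=> [hm|]; first by apply: h; left.
by rewrite leNgt; apply/negP => hlt; apply: h; right.
Qed.

Lemma ninM_t0 x t : ~ inM x t -> t = 0 -> x = 0.
Proof.
move=> /ninM[nm sT] t0; apply/eqP; apply: contraT => x0.
suff : slope s x 0 < slope s x pi.
  by rewrite slope0 => /lt_le_trans/(_ sT); rewrite t0 enorm0 mulr0 ltxx.
by apply: slope_lt => //; [exact: pi_gt0|exact: radial_dom_nomax].
Qed.

Lemma ccdist_cut x t : ~ inM x t -> ccdist U (x, t) ^+ 2 = radial s x (enorm t) pi.
Proof.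
move=> h; have [nm sT] := ninM h; have [i0 si0] := s_max.
have pi0 := pi_gt0 R.
have [t0|tn0] := eqVneq t 0.
  have x0 := ninM_t0 h t0.
  rewrite (@ccdist_theta x t 0) ?enorm0 ?pi_gt0//; last by rewrite t0 !scaler0.
  by rewrite /radial t0 enorm0 !mulr0 !mul0r x0 !big1// => i _; rewrite mxE expr0n mul0r.
have T0 : 0 < enorm t by rewrite lt_neqAle eq_sym enorm_eq0 tn0 enorm_ge0.
have thE : enorm ((pi / enorm t) *: t) = pi.
  by rewrite enormZ ger0_norm ?divr_ge0 ?enorm_ge0 ?ltW// divfK ?gt_eqF.
rewrite -[in RHS]thE.
(* Chosen so that (Nover x pi + V^2) pi = 4 |t|; the radicand is nonnegative exactly on the
   complement of M with vanishing last block. *)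
pose V := Num.sqrt ((4 * enorm t - slope s x pi) / pi).
apply: (@distance_value _ _ _ U s s_gt0 s_le1 U_skew U_rel x t _ V i0) => //.
- by rewrite thE.
- by rewrite thE; exact: radial_dom_nomax.
- by right.
- rewrite thE -/(Nover x pi) /V sqr_sqrtr; last by rewrite divr_ge0 ?subr_ge0// ltW.
  rewrite scalerA; congr (_ *: _).
  have alg (T N p : R) : T != 0 -> p != 0 -> 4 = (N + (4 * T - N * p) / p) * (p / T).
    by move=> Tn pn; field; rewrite Tn pn.
  by rewrite -Nover_slope; apply: alg; rewrite gt_eqF.
Qed.

(* [r] is the radius at which [radial s x (enorm t)] attains its maximum on [0, pi]. *)
Lemma critical_radius x t : exists r, [/\ 0 <= r <= pi /\ radial_dom s x r,
  slope s x r <= 4 * enorm t,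
  r < pi -> slope s x r = 4 * enorm t /\ x != 0,
  r = pi -> ~ inM x t &
  ccdist U (x, t) ^+ 2 = radial s x (enorm t) r].
Proof.
have [h|h] := pselect (inM x t).
  have [th thpi e] := inM_theta h; have x0 := inM_neq0 h.
  exists (enorm th); split.
  - by split; [rewrite enorm_ge0 ltW|exact: radial_dom_pi].
  - by rewrite (theta_slope e).
  - by rewrite (theta_slope e).
  - by move=> thE; move: thpi; rewrite thE ltxx.
  - exact: ccdist_theta.
exists pi; have [nm sT] := ninM h; split => //.
- by split; [rewrite pi_ge0 lexx|exact: radial_dom_nomax].
- by rewrite ltxx.
- exact: ccdist_cut.
Qed.

(** The derivative 4 |t| - slope is strictly decreasing when x != 0. For x = 0 the function is
    linear with slope 4 |t|, positive away from o, and r is then the right endpoint pi. *)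
Lemma radial_lt_max x t r r' : (x, t) != (0, 0) ->
  0 <= r <= pi -> radial_dom s x r -> slope s x r <= 4 * enorm t ->
  (r < pi -> slope s x r = 4 * enorm t /\ x != 0) ->
  0 <= r' <= pi -> radial_dom s x r' -> r' != r ->
  radial s x (enorm t) r' < radial s x (enorm t) r.
Proof.
move=> g0 /andP[r0 rpi] xr sr hr /andP[r'0 r'pi] xr' rr'.
case: (ltgtP r' r) rr' => // [lt|lt] _.
  apply: radial_lt_left => //; have [x0|x0] := eqVneq x 0; [right|by left].
  rewrite lt_neqAle eq_sym enorm_ge0 enorm_eq0 andbT.
  by apply: contraNneq g0 => ->; rewrite x0.
have [e x0] := hr (lt_le_trans lt r'pi).
by apply: radial_lt_right => //; rewrite e.
Qed.

Lemma phis_le_radial x t tau : phis s x t tau <= radial s x (enorm t) (enorm tau).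
Proof.
by rewrite /phis /radial lerD2r -mulrA ler_wpM2l// ip_le_enorm.
Qed.

(** On the boundary sphere the terms of a vanishing last block are 0 times a value of [scot], which
    realizes the convention 0 * oo = 0. *)
Definition phis_bar x t tau : \bar R :=
  if enorm tau < pi then (phis s x t tau)%:E
  else if `[< hasmax x >] then -oo%E else (phis s x t tau)%:E.

(** By Cauchy-Schwarz, [phis] is at most [radial] at |tau|, with equality on the ray of t. The
    strict maximum of [radial] fixes |th| and the equality case fixes the direction. *)
Lemma phis_sup x t : (x, t) != (0, 0) ->
  exists! th, enorm th <= pi /\
    ((ccdist U (x, t) ^+ 2)%:E = phis_bar x t th /\
     phis_bar x t th
       = ereal_sup [set (phis s x t tau)%:E | tau in [set tau : 'rV[R]_m | enorm tau < pi]]).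
Proof.
move=> g0; have [r [[rpi xr] sr hr hpi dE]] := critical_radius x t.
have /andP[r0 rpi'] := rpi.
have pi0 := pi_gt0 R.
set S := ereal_sup _.
have T0 := enorm_ge0 t.
(* For t = 0 there is no ray to follow, but then the critical radius is 0 and th = 0 is the only
   candidate. *)
have tr0 : t = 0 -> r = 0.
  move=> t0; apply/eqP; rewrite eq_le r0 andbT leNgt; apply/negP => rgt0.
  have [x0|xn0] := eqVneq x 0.
    by move: g0; rewrite x0 t0 eqxx.
  have := slope_lt s_gt0 xn0 (lexx 0) rgt0 xr; rewrite slope0 => h.
  by move: (lt_le_trans h sr); rewrite t0 enorm0 mulr0 ltxx.
pose ray y := (y / enorm t) *: t.
have rayE y : 0 <= y -> (t = 0 -> y = 0) -> enorm (ray y) = y.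
  move=> y0 ty; rewrite /ray enormZ ger0_norm ?divr_ge0//.
  have [t0|tn0] := eqVneq t 0; first by rewrite (ty t0) !mul0r.
  by rewrite divfK ?enorm_eq0.
have rayphi y : 0 <= y -> (t = 0 -> y = 0) ->
    phis s x t (ray y) = radial s x (enorm t) y.
  move=> y0 ty; rewrite /phis /radial rayE//; congr (_ + _).
  rewrite /ray ipZr -mulrA; congr (4 * _).
  have [t0|tn0] := eqVneq t 0; first by rewrite (ty t0) !mul0r mulr0.
  by rewrite -enorm2; field; rewrite enorm_eq0.
have le_r tau : enorm tau < pi -> phis s x t tau <= radial s x (enorm t) r.
  move=> taupi; apply: le_trans (phis_le_radial _ _ _) _.
  have [->//|ne] := eqVneq (enorm tau) r.
  apply: ltW; apply: radial_lt_max => //; last exact: radial_dom_pi.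
  by rewrite enorm_ge0 ltW.
have SE : S = (ccdist U (x, t) ^+ 2)%:E.
  rewrite dE; apply/eqP; rewrite eq_le; apply/andP; split.
    by apply: ge_ereal_sup => _ [tau /= taupi <-]; rewrite lee_fin le_r.
  have lb y : 0 <= y < pi -> (t = 0 -> y = 0) -> ((radial s x (enorm t) y)%:E <= S)%E.
    move=> /andP[y0 ypi] ty; apply: ereal_sup_ubound; exists (ray y).
      by rewrite /= rayE.
    by rewrite rayphi.
  have [rltpi|] := ltP r pi; first by apply: lb => //; rewrite r0.
  move=> pir; have rE : r = pi by apply/eqP; rewrite eq_le rpi' pir.
  have tn0 : t <> 0 by move=> /tr0 h; move: pi0; rewrite -rE h ltxx.
  (* Finiteness lets the limit y -> pi be taken in the reals. *)
  have Sfin : S \is a fin_num.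
    rewrite fin_numE; apply/andP; split.
      apply/eqP => Soo; have := lb 0; rewrite lexx pi0 Soo => /(_ isT (fun _ => erefl)).
      by rewrite leeNy_eq.
    apply/eqP => Soo; have : (S <= (radial s x (enorm t) r)%:E)%E.
      by apply: ge_ereal_sup => _ [tau /= taupi <-]; rewrite lee_fin le_r.
    by rewrite Soo leye_eq.
  rewrite -(fineK Sfin) lee_fin.
  apply: left_closed_le (is_derive_radial s_gt0 _ r0 xr) _; first by rewrite rE.
  move=> y /andP[y0 yr]; rewrite -lee_fin fineK//; apply: lb => [|/tn0//].
  by rewrite ltW//= -rE.
exists (ray r); split.
  split; first by rewrite rayE.
  suff -> : phis_bar x t (ray r) = (ccdist U (x, t) ^+ 2)%:E by [].
  rewrite /phis_bar rayE// rayphi// dE; case: ltP => // pir.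
  have rE : r = pi by apply/eqP; rewrite eq_le rpi' pir.
  by rewrite asboolF//; case: (ninM (hpi rE)).
move=> th [thpi [e _]].
have [thdom eth] : radial_dom s x (enorm th) /\ phis s x t th = radial s x (enorm t) r.
  move: e; rewrite /phis_bar dE; case: ltP => [h [->]|h].
    by split => //; exact: radial_dom_pi.
  case: asboolP => // nm [->]; split => //.
  by apply: radial_dom_le (radial_dom_nomax nm) _.
have rr : enorm th = r.
  apply/eqP; apply: contraT => ne.
  have := phis_le_radial x t th; rewrite eth => /le_lt_trans.
  move=> /(_ (radial s x (enorm t) r)); rewrite ltxx; apply.
  by apply: radial_lt_max => //; rewrite enorm_ge0.
have ipE : ip t th = enorm t * enorm th.
  move: eth; rewrite /phis /radial -rr => /addIr; rewrite -mulrA.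
  by apply: mulfI; rewrite pnatr_eq0.
have := ip_eq_enorm ipE; rewrite rr /ray => h.
have [t0|tn0] := eqVneq t 0.
  have rz := tr0 t0; rewrite rz mul0r scale0r; apply/esym/eqP.
  by rewrite -enorm_eq0 rr rz.
by rewrite mulrC -scalerA h scalerA mulVf ?scale1r// enorm_eq0.
Qed.

End main_coordinates.

(** * Smoothness off the cut locus *)

Section smooth_algebra.
Context {R : realType} {V : normedModType R}.
Implicit Types (f g h : V -> R) (A : set V).

(** A class of functions continuous on A and stable under directional derivatives consists of smooth
    functions. The function h only has to agree with a member on A, as d^2 does on M. *)
Lemma Ck_closed_class (cls : (V -> R) -> Prop) A : open A ->
  (forall f, cls f -> forall y, A y -> {for y, continuous f}) ->
  (forall f v, cls f -> exists2 g, cls g & forall y, A y -> is_derive y v f (g y)) ->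
  forall k f h, cls f -> (forall y, A y -> h y = f y) -> Ck k h A.
Proof.
move=> oA hc hd; elim=> [|k IH] f h cf hf.
  move=> y Ay; have fh : \forall z \near y, f z = h z.
    have : nbhs y A by apply: open_nbhs_nbhs.
    by apply: filterS => z Az; rewrite hf.
  have : h z @[z --> y] --> f y by apply: cvg_trans (hc f cf y Ay); exact: near_eq_cvg.
  by rewrite -hf.
split; first exact: IH cf hf.
move=> v; have [g cg hg] := hd f v cf.
have hder y : A y -> is_derive y v h (g y).
  move=> Ay; apply: near_eq_is_derive (hg y Ay).
  have : nbhs y A by apply: open_nbhs_nbhs.
  by apply: filterS => z Az; rewrite hf.
split; first by move=> y /hder[].
by apply: (IH g) => // y /hder[].
Qed.

(** Implicit differentiation from an exact difference identity: continuity and nonvanishing of the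
    factor D let it be divided out in Caratheodory's criterion, so no implicit function theorem is
    called. *)
Lemma implicit_derive (om D B : R -> R) (x0 : R) :
  (\forall h \near x0, D h * (om h - om x0) = B h * (h - x0)) ->
  {for x0, continuous D} -> {for x0, continuous B} -> D x0 != 0 ->
  is_derive x0 1 om (B x0 / D x0).
Proof.
move=> eqn cD cB D0; apply/is_derive1_caratheodory.
pose g (h : R) := if h == x0 then B x0 / D x0 else (om h - om x0) / (h - x0).
exists g; split.
- move=> z; rewrite /g; case: eqVneq => [->|zx]; first by rewrite !subrr mulr0.
  by rewrite divfK// subr_eq0.
- have gx0 : g x0 = B x0 / D x0 by rewrite /g eqxx.
  suff : g h @[h --> x0] --> B x0 / D x0 by rewrite -gx0.
  have : (fun h : R => B h / D h) @ x0 --> B x0 / D x0.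
    by apply: cvgM => //; apply: cvgV.
  apply: cvg_trans; apply: near_eq_cvg.
  have D0' : \forall h \near x0, D h != 0.
    have e0 : 0 < `|D x0| by rewrite normr_gt0.
    have /cvgrPdist_lt/(_ _ e0) := cD.
    apply: filterS => h; apply: contraTneq => ->.
    by rewrite subr0 ltxx.
  apply: filterS2 eqn D0' => h e Dh; rewrite /g; case: eqVneq => [->//|hx].
  have hx0 : h - x0 != 0 by rewrite subr_eq0.
  by apply: (mulfI Dh); rewrite [RHS]mulrA e mulfK// mulrC divfK.
- by rewrite /g eqxx.
Qed.

End smooth_algebra.

(** * The critical radius as a function of the point *)

Section implicit_radius.
Context {R : realType} (n m : nat) (U : 'I_m -> 'M[R]_(2 * n)) (s : 'I_(2 * n) -> R).
Hypothesis s_gt0 : forall i, 0 < s i.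
Hypothesis s_le1 : forall i, s i <= 1.
Hypothesis s_max : exists i0, s i0 = 1.
Hypothesis U_skew : forall j, (U j)^T = - U j.
Hypothesis U_rel : forall lam lam' : 'rV[R]_m,
  - (Amat U lam *m Amat U lam' + Amat U lam' *m Amat U lam)
  = (2 * ip lam lam') *: wdiag s (fun u => u ^+ 2).
Local Notation V := (@pt R n m).
Implicit Types (x : 'rV[R]_(2 * n)) (t th tau : 'rV[R]_m) (r : R) (y v : V).

Definition Mreg : set V := [set y | inM s y.1 y.2].

Definition rad y : R := xget 0 [set r | 0 <= r < pi /\ slope s y.1 r = 4 * enorm y.2].

Lemma radP y : Mreg y -> 0 <= rad y < pi /\ slope s y.1 (rad y) = 4 * enorm y.2.
Proof.
move=> /(inM_root s_gt0 s_le1)[r r0 hr].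
by apply: (@xgetPex _ 0 [set r | 0 <= r < pi /\ slope s y.1 r = 4 * enorm y.2]); exists r.
Qed.

Definition rad2 y : R := rad y ^+ 2.

Lemma rad2_eq y : Mreg y -> Nsum s y.1 (rad2 y) ^+ 2 * rad2 y = 16 * ip y.2 y.2.
Proof.
move=> /radP[r0 e]; rewrite /rad2 -exprMn -Nover_Nsum// Nover_slope// e exprMn enorm2.
by congr (_ * _); rewrite -natrX.
Qed.

Lemma radial_ssin x (T r : R) : 0 <= r < pi -> slope s x r = 4 * T ->
  radial s x T r = \sum_i x 0 i ^+ 2 * ssin (s i * r) ^+ 2.
Proof.
move=> /andP[r0 rpi] e; rewrite /radial -e /slope mulr_suml -big_split/=.
apply: eq_bigr => i _.
have sr : 0 <= s i * r < pi.
  apply/andP; split; first by rewrite mulr_ge0// ltW.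
  by apply: le_lt_trans rpi; rewrite ler_piMl.
rewrite scot_mu_ssin; first by ring.
have [->|rn0] := eqVneq (s i * r) 0; [by right|left].
rewrite gt_eqF// sin_gt0_pi// lt_neqAle eq_sym rn0.
by have /andP[-> ->] := sr.
Qed.

Lemma ccdist2_rad y : Mreg y ->
  ccdist U y ^+ 2 = \sum_i y.1 0 i ^+ 2 * (sinc_sqrt (s i ^+ 2 * rad2 y))^-1 ^+ 2.
Proof.
move=> My; have [r0 e] := radP My; have [th thpi eth] := inM_theta s_gt0 s_le1 My.
have x0 := inM_neq0 My.
have thE : enorm th = rad y.
  apply: (slope_inj s_gt0 s_le1 x0) => //; first by rewrite enorm_ge0.
  by rewrite (theta_slope s_gt0 s_le1 eth x0 thpi).
rewrite (surjective_pairing y) (ccdist_theta s_gt0 s_le1 s_max U_skew U_rel thpi eth) thE.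
rewrite radial_ssin//; apply: eq_bigr => i _; rewrite ssinE exprMn.
by rewrite /rad2 -surjective_pairing.
Qed.

Lemma is_derive_fst i y v : is_derive y v (fun z : V => z.1 0 i) (v.1 0 i).
Proof.
apply/is_derive_lineP.
have -> : (fun h : R => (h *: v + y).1 0 i) = (fun h : R => (h *: v.1 + y.1) 0 i) by [].
by apply: (is_derive_lineP (fun x : 'rV[R]_(2 * n) => x 0 i) _ _ _).1; exact: is_derive_coord.
Qed.

Lemma is_derive_snd j y v : is_derive y v (fun z : V => z.2 0 j) (v.2 0 j).
Proof.
apply/is_derive_lineP.
have -> : (fun h : R => (h *: v + y).2 0 j) = (fun h : R => (h *: v.2 + y.2) 0 j) by [].
by apply: (is_derive_lineP (fun x : 'rV[R]_m => x 0 j) _ _ _).1; exact: is_derive_coord.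
Qed.

Lemma continuous_fst i y : {for y, continuous (fun z : V => z.1 0 i)}.
Proof.
apply: (@continuous_comp _ _ _ (fun z : V => z.1) (fun x : 'rV[R]_(2 * n) => x 0 i)).
  exact: cvg_fst.
exact: coord_continuous.
Qed.

Lemma continuous_snd j y : {for y, continuous (fun z : V => z.2 0 j)}.
Proof.
apply: (@continuous_comp _ _ _ (fun z : V => z.2) (fun x : 'rV[R]_m => x 0 j)).
  exact: cvg_snd.
exact: coord_continuous.
Qed.

Lemma continuous_gap (c : 'I_(2 * n) -> R) y :
  {for y, continuous (fun z : V => \sum_i z.1 0 i ^+ 2 * c i - 4 * enorm z.2)}.
Proof.
have h1 : {for y, continuous (fun z : V => \sum_i z.1 0 i ^+ 2 * c i)}.
  apply: (cvg_sum_seq (FF := nbhs_filter y)) => i.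
  apply: cvgM; last exact: cvg_cst.
  by apply: cvgM; exact: continuous_fst.
have h2 : {for y, continuous (fun z : V => enorm z.2)}.
  apply: (@continuous_comp _ _ _ (fun z : V => ip z.2 z.2) Num.sqrt); last exact: sqrt_continuous.
  apply: (cvg_sum_seq (FF := nbhs_filter y)) => j.
  by apply: cvgM; exact: continuous_snd.
by apply: cvgB => //; apply: cvgM => //; exact: cvg_cst.
Qed.

Lemma near_pos (f : V -> R) y : {for y, continuous f} -> 0 < f y -> \forall z \near y, 0 < f z.
Proof.
move=> cf f0; have hn : \forall z \near y, `|f y - f z| < f y.
  by have /cvgrPdist_lt/(_ _ f0) := cf.
by apply: filterS hn => z hz; have := ler_norm (f y - f z); lra.
Qed.

Lemma near_neq0 (f : V -> R) y : {for y, continuous f} -> f y != 0 ->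
  \forall z \near y, f z != 0.
Proof.
move=> cf f0; have e0 : 0 < `|f y| by rewrite normr_gt0.
have hn : \forall z \near y, `|f y - f z| < `|f y|.
  by have /cvgrPdist_lt/(_ _ e0) := cf.
by apply: filterS hn => z; apply: contraTneq => ->; rewrite subr0 ltxx.
Qed.

Lemma open_Mreg : open Mreg.
Proof.
rewrite openE => y [[i si yi]|h].
  have := near_neq0 (@continuous_fst i y) yi.
  by apply: filterS => z zi; left; exists i.
have h0 : 0 < \sum_i y.1 0 i ^+ 2 * (s i * mu (s i * pi)) - 4 * enorm y.2.
  by rewrite subr_gt0.
have := near_pos (@continuous_gap _ y) h0.
by apply: filterS => z hz; right; rewrite -subr_gt0.
Qed.

Lemma rad_lt y (r : R) : Mreg y -> 0 <= r -> r < pi -> 4 * enorm y.2 < slope s y.1 r ->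
  rad y < r.
Proof.
move=> My r0 rpi h; have [/andP[q0 qpi] e] := radP My.
rewrite ltNge; apply/negP => le; move: h; rewrite -e ltNge => /negP; apply.
by apply: slope_le => //; exact: radial_dom_pi.
Qed.

Lemma rad_gt y (r : R) : Mreg y -> 0 <= r -> r < pi -> slope s y.1 r < 4 * enorm y.2 ->
  r < rad y.
Proof.
move=> My r0 rpi h; have [/andP[q0 qpi] e] := radP My.
rewrite ltNge; apply/negP => le; move: h; rewrite -e ltNge => /negP; apply.
by apply: slope_le => //; exact: radial_dom_pi.
Qed.

(** For a fixed r1 above [rad y], the inequality 4 |t| < slope(x, r1) is open in (x, t) and bounds
    [rad] by monotonicity; likewise from below. The minimum in r1 keeps it under pi. *)
Lemma continuous_rad y : Mreg y -> {for y, continuous rad}.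
Proof.
move=> My; have [/andP[q0 qpi] e] := radP My; have x0 := inM_neq0 My.
have nM : \forall z \near y, Mreg z.
  by apply: open_nbhs_nbhs; split => //; exact: open_Mreg.
apply/cvgrPdist_lt => eps eps0.
pose r1 := rad y + Num.min (eps / 2) ((pi - rad y) / 2).
have m0 : 0 < Num.min (eps / 2) ((pi - rad y) / 2) by rewrite lt_min !divr_gt0// subr_gt0.
have m1 : Num.min (eps / 2) ((pi - rad y) / 2) <= eps / 2 by rewrite ge_min lexx.
have m2 : Num.min (eps / 2) ((pi - rad y) / 2) <= (pi - rad y) / 2 by rewrite ge_min lexx orbT.
have r10 : 0 <= r1 by rewrite /r1; lra.
have r1pi : r1 < pi by rewrite /r1; lra.
have hup : \forall z \near y, Mreg z -> rad z < r1.
  have h0 : 0 < \sum_i y.1 0 i ^+ 2 * (s i * mu (s i * r1)) - 4 * enorm y.2.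
    rewrite subr_gt0 -e; apply: slope_lt => //; last exact: radial_dom_pi.
    by rewrite /r1; lra.
  have := near_pos (@continuous_gap _ y) h0.
  by apply: filterS => z hz Mz; apply: rad_lt => //; rewrite -subr_gt0.
have hlow : \forall z \near y, Mreg z -> rad y - eps < rad z.
  have [small|big] := ltP (rad y - eps / 2) 0.
    apply: filterS nM => z Mz _; have [/andP[z0 _] _] := radP Mz; lra.
  have r2pi : rad y - eps / 2 < pi by lra.
  have h0 : 0 < 4 * enorm y.2 - \sum_i y.1 0 i ^+ 2 * (s i * mu (s i * (rad y - eps / 2))).
    rewrite subr_gt0 -e; apply: slope_lt => //; last exact: radial_dom_pi.
    by lra.
  have c2 := @continuous_gap (fun i => s i * mu (s i * (rad y - eps / 2))) y.
  have c3 : {for y, continuous (fun z : V => 4 * enorm z.2 -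
      \sum_i z.1 0 i ^+ 2 * (s i * mu (s i * (rad y - eps / 2))))}.
    rewrite (_ : (fun z : V => _) = (fun z : V =>
        - (\sum_i z.1 0 i ^+ 2 * (s i * mu (s i * (rad y - eps / 2))) - 4 * enorm z.2))).
      exact: cvgN c2.
    by apply/funext => z; rewrite opprB.
  have := near_pos c3 h0; apply: filterS => z; rewrite subr_gt0 => hz Mz.
  by have := rad_gt Mz big r2pi hz; lra.
apply: filterS3 nM hup hlow => z Mz /(_ Mz) h1 /(_ Mz) h2.
rewrite ltr_norml; apply/andP; split; first by move: h1; rewrite /r1; lra.
by lra.
Qed.

End implicit_radius.

(** * Derivatives of the squared radius and smoothness of d^2 on M *)

Section smoothness.
Context {R : realType} (n m : nat) (U : 'I_m -> 'M[R]_(2 * n)) (s : 'I_(2 * n) -> R).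
Hypothesis s_gt0 : forall i, 0 < s i.
Hypothesis s_le1 : forall i, s i <= 1.
Hypothesis s_max : exists i0, s i0 = 1.
Hypothesis U_skew : forall j, (U j)^T = - U j.
Hypothesis U_rel : forall lam lam' : 'rV[R]_m,
  - (Amat U lam *m Amat U lam' + Amat U lam' *m Amat U lam)
  = (2 * ip lam lam') *: wdiag s (fun u => u ^+ 2).
Local Notation V := (@pt R n m).
Local Notation Mreg := (@Mreg R n m s).
Local Notation rad := (@rad R n m s).
Local Notation rad2 := (@rad2 R n m s).
Implicit Types (x : 'rV[R]_(2 * n)) (t th tau : 'rV[R]_m) (r : R) (y v : V).

Lemma sinc_rad2_neq0 i y : Mreg y -> sinc_sqrt (s i ^+ 2 * rad2 y) != 0.
Proof.
move=> /(radP s_gt0 s_le1)[/andP[r0 rpi] _].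
rewrite -exprMn gt_eqF// sinc_sqrt_gt0//; apply/andP; split.
  by rewrite mulr_ge0// ltW.
by apply: le_lt_trans rpi; rewrite ler_piMl.
Qed.

Lemma Nsum_rad2_gt0 y : Mreg y -> 0 < Nsum s y.1 (rad2 y).
Proof.
move=> My; have [/andP[r0 rpi] _] := radP s_gt0 s_le1 My.
apply: Nsum_gt0 => //; first exact: inM_neq0 My.
by rewrite sqr_ge0/= ltr_pXn2r ?nnegrE ?pi_ge0.
Qed.

Lemma Nsum_dslope_rad2 y : Mreg y ->
  0 < Nsum s y.1 (rad2 y) + 2 * rad2 y * Nsum' s y.1 (rad2 y).
Proof.
move=> My; have [/andP[r0 rpi] _] := radP s_gt0 s_le1 My.
have -> : Nsum s y.1 (rad2 y) + 2 * rad2 y * Nsum' s y.1 (rad2 y) = dslope s y.1 (rad y).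
  rewrite mulr_sumr -big_split/=; apply: eq_bigr => i _.
  by rewrite /dmu exprMn /rad2; ring.
by apply: dslope_gt0 => //; [exact: inM_neq0 My|exact: radial_dom_pi].
Qed.

Lemma continuous_rad2 y : Mreg y -> {for y, continuous rad2}.
Proof.
move=> My; have cr := continuous_rad s_gt0 s_le1 My.
by apply: cvgM; exact: cr.
Qed.

(* Obtained by differentiating [rad2_eq]. *)
Definition Drad2 v y : R :=
  (32 * ip y.2 v.2 - 2 * Nsum s y.1 (rad2 y) * rad2 y *
     (\sum_i s i ^+ 2 * (2 * y.1 0 i * v.1 0 i) * nu (s i ^+ 2 * rad2 y)))
  / (Nsum s y.1 (rad2 y) * (Nsum s y.1 (rad2 y) + 2 * rad2 y * Nsum' s y.1 (rad2 y))).

(** Along the line y + h v the product N^2 w is an explicit quadratic polynomial in h; splitting its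
    increment gives the difference identity of [implicit_derive]. *)
Lemma is_derive_rad2 y v : Mreg y -> is_derive y v rad2 (Drad2 v y).
Proof.
move=> My; apply/is_derive_lineP; set w0 := rad2 y.
(* The equalities below hide nu and rad2, whose unfolding makes unification diverge. *)
have [om omE] : {om : R -> R | om = fun h : R => rad2 (h *: v + y)} by eexists.
have om0 : om 0 = w0 by rewrite omE scale0r add0r.
have clineE : (fun h : R => h *: v + y) @ (0 : R) --> y.
  have : (fun h : R => h *: v + y) @ (0 : R) --> (0 : R) *: v + y.
    apply: cvgD; last exact: cvg_cst.
    by apply: cvgZl; exact: cvg_id.
  by rewrite scale0r add0r.
have com : om h @[h --> (0 : R)] --> w0.
  rewrite omE; exact: (cvg_comp _ _ clineE (continuous_rad2 My)).
have nM : \forall h \near (0 : R), Mreg (h *: v + y).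
  apply: clineE; apply: open_nbhs_nbhs; split => //; exact: open_Mreg.
have [nui nuiE] : {f : 'I_(2 * n) -> R -> R | f = fun i z => nu (s i ^+ 2 * z)}.
  by exists (fun i z => nu (s i ^+ 2 * z)).
have dH i : is_derive w0 1 (nui i) (nu' (s i ^+ 2 * w0) * s i ^+ 2).
  rewrite nuiE; apply: (is_derive_comp_fun (f := nu) (g := fun z : R => s i ^+ 2 * z)).
    by apply: is_derive_nu; exact: sinc_rad2_neq0.
  by apply: (is_derive_eq (is_deriveZ_fun (s i ^+ 2) (is_derive_id w0 1))); rewrite mulr1.
have [ph phP] := choice (fun i => (is_derive1_caratheodory _ _ _).1 (dH i)).
have [c cE] : {c : 'I_(2 * n) -> R -> R |
    forall i h, c i h = s i ^+ 2 * (h * v.1 0 i + y.1 0 i) ^+ 2}.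
  by exists (fun i h => s i ^+ 2 * (h * v.1 0 i + y.1 0 i) ^+ 2).
have [P PE] : {P : R -> R | P = fun h => \sum_i c i h * nui i (om h)} by eexists.
have [A AE] : {A : R -> R | A = fun h => \sum_i c i h * ph i (om h)} by eexists.
have [B1 B1E] : {B1 : R -> R | B1 = fun h => \sum_i s i ^+ 2 * (2 * y.1 0 i * v.1 0 i
    + h * v.1 0 i ^+ 2) * nui i w0} by eexists.
have PN h : P h = Nsum s (h *: v + y).1 (om h).
  by rewrite PE /Nsum; apply: eq_bigr => i _; rewrite cE !mxE nuiE.
have P0 : P 0 = Nsum s y.1 w0 by rewrite PN om0 scale0r add0r.
(* [A] is the divided difference in the squared radius, through the Caratheodory slopes [ph] of nu;
   [B1] is the one in the coordinates of x. *)
have PB h : P h - P 0 = A h * (om h - w0) + h * B1 h.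
  rewrite PE AE B1E -sumrB mulr_suml mulr_sumr -big_split/=; apply: eq_bigr => i _.
  have [e _ _] := phP i; have {}e := e (om h).
  have alg (S a b k n1 n0 q : R) : n1 - n0 = q -> S * (k * b + a) ^+ 2 * n1
      - S * (0 * b + a) ^+ 2 * n0 = S * (k * b + a) ^+ 2 * q + k * (S * (2 * a * b + k * b ^+ 2) * n0).
    by move=> <-; ring.
  by rewrite om0 -[c i h * _ * _]mulrA !cE; exact: alg.
have cc i : c i h @[h --> (0 : R)] --> c i 0.
  have h1 := is_deriveD_fun (is_deriveM_fun (is_derive_id (0 : R) 1)
    (is_derive_cst (v.1 0 i) (0 : R) 1)) (is_derive_cst (y.1 0 i) (0 : R) 1).
  have := is_derive_continuous1 (is_deriveZ_fun (s i ^+ 2) (is_deriveM_fun h1 h1)).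
  by rewrite (_ : c i = fun h => s i ^+ 2 * ((h * v.1 0 i + y.1 0 i) * (h * v.1 0 i + y.1 0 i)))//;
    apply/funext => h; rewrite cE expr2.
have cP : P h @[h --> (0 : R)] --> P 0.
  rewrite PE; apply: cvg_sum_seq => i; apply: cvgM; first exact: cc.
  by rewrite om0; exact: (cvg_comp _ _ com (is_derive_continuous1 (dH i))).
have cA : A h @[h --> (0 : R)] --> A 0.
  rewrite AE; apply: cvg_sum_seq => i; apply: cvgM; first exact: cc.
  by rewrite om0; have [_ cph _] := phP i; exact: (cvg_comp _ _ com cph).
have cid : h @[h --> (0 : R)] --> (0 : R) by exact: cvg_id.
have cB1 : B1 h @[h --> (0 : R)] --> B1 0.
  rewrite B1E; apply: cvg_sum_seq => i; apply: cvgM; last exact: cvg_cst.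
  apply: cvgM; first exact: cvg_cst.
  apply: cvgD; first exact: cvg_cst.
  by apply: cvgM; [exact: cid|exact: cvg_cst].
have cPP : w0 * (P h + P 0) @[h --> (0 : R)] --> w0 * (P 0 + P 0).
  apply: cvgM; first exact: cvg_cst.
  by apply: cvgD; [exact: cP|exact: cvg_cst].
have A0 : A 0 = Nsum' s y.1 w0.
  rewrite AE; apply: eq_bigr => i _; have [_ _] := phP i; rewrite om0 => ->.
  by rewrite cE mul0r add0r [nu' _ * _]mulrC.
have B10 : B1 0 = \sum_i s i ^+ 2 * (2 * y.1 0 i * v.1 0 i) * nu (s i ^+ 2 * w0).
  by rewrite B1E nuiE; apply: eq_bigr => i _; rewrite mul0r addr0.
have Npos := Nsum_rad2_gt0 My; have Dpos := Nsum_dslope_rad2 My.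
have e0 := rad2_eq s_gt0 s_le1 My.
rewrite /Drad2 -B10; move: Npos Dpos e0; rewrite -/w0 -A0 -P0 => Npos Dpos e0.
have e1 : \forall h \near (0 : R), P h ^+ 2 * om h = P 0 ^+ 2 * w0
     + 16 * (h * (2 * ip y.2 v.2 + h * ip v.2 v.2)).
  apply: filterS nM => h Mh.
  have := rad2_eq s_gt0 s_le1 Mh; rewrite [X in Nsum _ _ X ^+ 2 * X](_ : _ = om h); last by rewrite omE.
  rewrite -PN => ->; rewrite e0 -mulrDr; congr (16 * _).
  rewrite /ip !mulr_sumr -big_split/= mulr_sumr -big_split/=; apply: eq_bigr => j _.
  by rewrite !mxE; ring.
clear nM phP dH PE AE B1E PN cc cE.
move: w0 om0 com PB P0 cPP A0 B10 Npos Dpos e0 e1 => {}w0 om0 com PB _ cPP _ _ Npos Dpos _ e1.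
(* From P(h)^2 om(h) - P(0)^2 w0 = P(h)^2 (om(h) - w0) + w0 (P(h) + P(0)) (P(h) - P(0)): [D] gathers
   the factor of om(h) - w0, and [B] is the remainder divided by h. *)
pose D (h : R) := P h * P h + w0 * (P h + P 0) * A h.
pose B (h : R) := 16 * (2 * ip y.2 v.2 + h * ip v.2 v.2) - w0 * (P h + P 0) * B1 h.
have D0 : D 0 = P 0 * (P 0 + 2 * w0 * A 0) by rewrite /D; ring.
have B0 : B 0 = 32 * ip y.2 v.2 - 2 * P 0 * w0 * B1 0 by rewrite /B; ring.
rewrite -omE -D0 -B0.
apply: (implicit_derive (om := om)).
- apply: filterS e1 => h eh; rewrite om0 subr0 /D /B; have pb := PB h.
  have : (P h * P h * (om h - w0) + w0 * (P h + P 0) * (P h - P 0))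
      = 16 * (h * (2 * ip y.2 v.2 + h * ip v.2 v.2)).
    by rewrite -[RHS](addKr (P 0 ^+ 2 * w0)) -eh; ring.
  rewrite pb => e2.
  have -> : (P h * P h + w0 * (P h + P 0) * A h) * (om h - w0) =
     P h * P h * (om h - w0) + w0 * (P h + P 0) * (A h * (om h - w0) + h * B1 h)
     - w0 * (P h + P 0) * (h * B1 h) by ring.
  by rewrite e2; ring.
- apply: cvgD; apply: cvgM; [exact: cP|exact: cP|exact: cPP|exact: cA].
- apply: cvgB; last by apply: cvgM; [exact: cPP|exact: cB1].
  apply: cvgM; first exact: cvg_cst.
  apply: cvgD; first exact: cvg_cst.
  by apply: cvgM; [exact: cid|exact: cvg_cst].
- by rewrite D0 gt_eqF// mulr_gt0.
Qed.

(** Generated by the coordinates, the squared radius and entire series in it. [Drad2] is built from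
    these, so directional differentiation on [Mreg] stays in the class. *)
Inductive smooth_alg : (V -> R) -> Prop :=
| SA_cst c : smooth_alg (fun=> c)
| SA_fst i : smooth_alg (fun y => y.1 0 i)
| SA_snd j : smooth_alg (fun y => y.2 0 j)
| SA_rad2 : smooth_alg rad2
| SA_psum c k : exp_bounded c -> smooth_alg (fun y => psum c (k * rad2 y))
| SA_add f g : smooth_alg f -> smooth_alg g -> smooth_alg (fun y => f y + g y)
| SA_mul f g : smooth_alg f -> smooth_alg g -> smooth_alg (fun y => f y * g y)
| SA_inv f : (forall y, Mreg y -> f y != 0) -> smooth_alg f ->
    smooth_alg (fun y => (f y)^-1).

Lemma SA_scale c f : smooth_alg f -> smooth_alg (fun y => c * f y).
Proof. by move=> h; apply: SA_mul => //; exact: SA_cst. Qed.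

Lemma SA_opp f : smooth_alg f -> smooth_alg (fun y => - f y).
Proof.
move=> h; have := SA_scale (-1) h.
by under eq_fun do rewrite mulN1r.
Qed.

Lemma SA_sum (I : Type) (r : seq I) (F : I -> V -> R) :
  (forall i, smooth_alg (F i)) -> smooth_alg (fun y => \sum_(i <- r) F i y).
Proof.
move=> h; elim: r => [|i r IH].
  rewrite (_ : (fun _ => _) = (fun=> 0)); first exact: SA_cst.
  by apply/funext => y; rewrite big_nil.
rewrite (_ : (fun _ => _) = (fun y => F i y + \sum_(j <- r) F j y)); first exact: SA_add.
by apply/funext => y; rewrite big_cons.
Qed.

Lemma SA_exp f k : smooth_alg f -> smooth_alg (fun y => f y ^+ k).
Proof.
move=> h; elim: k => [|k IH]; first by under eq_fun do rewrite expr0; exact: SA_cst.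
by under eq_fun do rewrite exprS; exact: SA_mul.
Qed.

Let SA_sinc i : smooth_alg (fun y => sinc_sqrt (s i ^+ 2 * rad2 y)).
Proof. by apply: SA_psum; exact: exp_bounded_sinc. Qed.

Let SA_sincV i k : smooth_alg (fun y => (sinc_sqrt (s i ^+ 2 * rad2 y) ^+ k)^-1).
Proof.
apply: SA_inv; last exact: SA_exp.
by move=> y My; rewrite expf_neq0// sinc_rad2_neq0.
Qed.

Let SA_sinc1 i : smooth_alg (fun y => sinc_sqrt1 (s i ^+ 2 * rad2 y)).
Proof. by apply: SA_psum; apply: exp_bounded_diffs; exact: exp_bounded_sinc. Qed.

Let SA_sinc2 i : smooth_alg (fun y => sinc_sqrt2 (s i ^+ 2 * rad2 y)).
Proof. by apply: SA_psum; do 2 apply: exp_bounded_diffs; exact: exp_bounded_sinc. Qed.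

Let SA_cos i : smooth_alg (fun y => cos_sqrt (s i ^+ 2 * rad2 y)).
Proof. by apply: SA_psum; exact: exp_bounded_cos. Qed.

Let SA_nu i : smooth_alg (fun y => nu (s i ^+ 2 * rad2 y)).
Proof.
apply: SA_add; first exact: SA_cst.
by apply: SA_scale; apply: SA_mul => //; exact: SA_mul.
Qed.

Let SA_nu' i : smooth_alg (fun y => nu' (s i ^+ 2 * rad2 y)).
Proof.
apply: SA_scale; apply: SA_add.
  apply: SA_mul; last exact: SA_mul.
  by apply: SA_mul; [exact: SA_opp|exact: SA_cst].
apply: SA_mul => //; apply: SA_add; first exact: SA_mul.
by apply: SA_opp; apply: SA_mul => //; apply: SA_scale; exact: SA_exp.
Qed.

Lemma SA_Nsum : smooth_alg (fun y => Nsum s y.1 (rad2 y)).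
Proof.
apply: SA_sum => i; apply: SA_mul => //; apply: SA_scale; apply: SA_exp; exact: SA_fst.
Qed.

Lemma SA_Nsum' : smooth_alg (fun y => Nsum' s y.1 (rad2 y)).
Proof.
apply: SA_sum => i; apply: SA_mul.
  by apply: SA_scale; apply: SA_exp; exact: SA_fst.
exact: SA_scale.
Qed.

Lemma SA_Drad2 v : smooth_alg (Drad2 v).
Proof.
apply: SA_mul.
  apply: SA_add.
    apply: SA_scale; apply: SA_sum => j; apply: SA_mul; [exact: SA_snd|exact: SA_cst].
  apply: SA_opp; apply: SA_mul.
    by apply: SA_mul; [apply: SA_scale; exact: SA_Nsum|exact: SA_rad2].
  apply: SA_sum => i; apply: SA_mul => //; apply: SA_scale.
  by apply: SA_mul; [apply: SA_scale; exact: SA_fst|exact: SA_cst].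
apply: SA_inv.
  by move=> y My; rewrite gt_eqF// mulr_gt0 ?Nsum_rad2_gt0 ?Nsum_dslope_rad2.
apply: SA_mul; first exact: SA_Nsum.
apply: SA_add; first exact: SA_Nsum.
by apply: SA_mul; [apply: SA_scale; exact: SA_rad2|exact: SA_Nsum'].
Qed.

Lemma SA_continuous f : smooth_alg f -> forall y, Mreg y -> {for y, continuous f}.
Proof.
move=> h y My; elim: h => {f} [c|i|j||c k hc|f g _ cf _ cg|f g _ cf _ cg|f f0 _ cf].
- exact: cvg_cst.
- exact: continuous_fst.
- exact: continuous_snd.
- exact: continuous_rad2.
- apply: (@continuous_comp _ _ _ (fun y => k * rad2 y) (psum c)).
    by apply: cvgM; [exact: cvg_cst|exact: continuous_rad2].
  exact: is_derive_continuous1 (is_derive_psum _ hc).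
- exact: cvgD.
- exact: cvgM.
- by apply: cvgV => //; exact: f0.
Qed.

Lemma SA_derive f v : smooth_alg f ->
  exists2 g, smooth_alg g & forall y, Mreg y -> is_derive y v f (g y).
Proof.
elim=> {f} [c|i|j||c k hc|f g hf [f' sf' df] hg [g' sg' dg]|f g hf [f' sf' df] hg [g' sg' dg]
  |f f0 hf [f' sf' df]].
- exists (fun=> 0); first exact: SA_cst.
  by move=> y _; exact: is_derive_cst.
- exists (fun=> v.1 0 i); first exact: SA_cst.
  by move=> y _; exact: is_derive_fst.
- exists (fun=> v.2 0 j); first exact: SA_cst.
  by move=> y _; exact: is_derive_snd.
- by exists (Drad2 v); [exact: SA_Drad2|move=> y My; exact: is_derive_rad2].
- exists (fun y => psum (pseries_diffs c) (k * rad2 y) * (k * Drad2 v y)).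
    apply: SA_mul; first by apply: SA_psum; exact: exp_bounded_diffs.
    by apply: SA_scale; exact: SA_Drad2.
  move=> y My; apply: (is_derive_comp_fun (f := psum c)); first exact: is_derive_psum.
  by apply: is_deriveZ_fun; exact: is_derive_rad2.
- exists (fun y => f' y + g' y); first exact: SA_add.
  by move=> y My; apply: is_deriveD_fun; [exact: df|exact: dg].
- exists (fun y => f' y * g y + f y * g' y).
    by apply: SA_add; exact: SA_mul.
  by move=> y My; apply: is_deriveM_fun; [exact: df|exact: dg].
- exists (fun y => - f' y * (f y ^+ 2)^-1).
    apply: SA_mul; first exact: SA_opp.
    by apply: SA_inv; [move=> y My; rewrite expf_neq0// f0|exact: SA_exp].
  by move=> y My; apply: is_deriveV_fun; [exact: f0|exact: df].
Qed.

Lemma smooth_near_Mreg y : Mreg y -> smooth_near (fun z : V => ccdist U z ^+ 2) y.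
Proof.
move=> My; have oM := @open_Mreg R n m s.
(* The exponent 1 puts the inverse into the form of [SA_sincV]. *)
pose F (z : V) := \sum_i z.1 0 i ^+ 2 * (sinc_sqrt (s i ^+ 2 * rad2 z) ^+ 1)^-1 ^+ 2.
have cF : smooth_alg F.
  by apply: SA_sum => i; apply: SA_mul; apply: SA_exp; [exact: SA_fst|exact: SA_sincV].
exists Mreg; split => // k.
apply: (@Ck_closed_class _ _ _ _ oM (@SA_continuous) (@SA_derive) k F) => // z Mz.
rewrite (ccdist2_rad s_gt0 s_le1 s_max U_skew U_rel Mz).
by apply: eq_bigr => i _; rewrite expr1.
Qed.

End smoothness.

(** * Non-smoothness on the cut locus *)

Lemma sin_le_id (R : realType) (u : R) : 0 <= u -> sin u <= u.
Proof.
rewrite le_eqVlt => /predU1P[<-|u0]; first by rewrite sin0.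
have [|c _] := MVT u0 (fun y _ => is_derive_sin y).
  by apply: derivable_within_continuous => y _; exact: is_derive_derivable (is_derive_sin y).
by rewrite sin0 !subr0 => ->; rewrite ler_piMl ?cos_le1// ltW.
Qed.

Lemma cos_ge_half_sqr (R : realType) (u : R) : 0 <= u -> u <= 1 -> 1 - u ^+ 2 / 2 <= cos u.
Proof.
move=> u0 u1; have uE : u = (u / 2) *+ 2 by rewrite -mulr_natr divfK.
have e : cos u = 1 - 2 * sin (u / 2) ^+ 2.
  by rewrite {1}uE cos_mulr2n -mulr_natr cos2sin2; ring.
rewrite e; have h := sin_le_id (divr_ge0 u0 (ler0n R 2)).
have h0 : 0 <= sin (u / 2).
  by apply: sin_ge0_pi; rewrite divr_ge0//=; have := pi_ge2 R; lra.
have : sin (u / 2) ^+ 2 <= (u / 2) ^+ 2 by rewrite ler_pXn2r ?nnegrE// divr_ge0.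
by rewrite expr_div_n; lra.
Qed.

Lemma scot_le1 (R : realType) (r : R) : 0 <= r < pi -> scot r <= 1.
Proof.
move=> /andP[r0 rpi]; rewrite /scot; case: eqP => // /eqP rn0.
have rp : 0 < r by rewrite lt_neqAle eq_sym rn0.
have s0 : 0 < sin r by apply: sin_gt0_pi; rewrite rp.
by rewrite ler_pdivrMr// mul1r ltW// sin_gt_mul_cos// rp.
Qed.

(** With u = pi - r, scot r = - r cos u / sin u. For u < 1/2 this is at most - 1 / u, as r cos u >=
    1 and sin u <= u. For u >= 1/2, scot r <= 1 and 1 / u <= 2, whence the constant 3. *)
Lemma scot_pole (R : realType) (r : R) : 0 <= r < pi -> scot r <= 3 - (pi - r)^-1.
Proof.
move=> /andP[r0 rpi]; have u0 : 0 < pi - r by rewrite subr_gt0.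
have [uh|uh] := leP (1 / 2) (pi - r).
  have : (pi - r)^-1 <= 2.
    by rewrite -[2]invrK lef_pV2 ?posrE// ?invr_gt0// -[2^-1]mul1r.
  have : scot r <= 1 by apply: scot_le1; rewrite r0.
  lra.
have p2 := pi_ge2 R.
set u := pi - r in u0 uh *; have rE : r = pi - u by rewrite /u; ring.
have rn0 : r != 0 by rewrite gt_eqF// rE; lra.
have s0 : 0 < sin u by apply: sin_gt0_pi; rewrite u0/=; lra.
rewrite /scot (negbTE rn0) {2 3}rE sinB cosB cospi sinpi !mul0r !mulN1r sub0r opprK addr0.
rewrite mulrN mulNr; have cu := @cos_ge_half_sqr R u (ltW u0) ltac:(lra).
have : u^-1 <= r * cos u / sin u.
  rewrite ler_pdivlMr//; apply: (@le_trans _ _ 1).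
    by rewrite mulrC ler_pdivrMr// mul1r sin_le_id// ltW.
  have : u ^+ 2 <= 1/4.
    have -> : 1 / 4 = (1 / 2) ^+ 2 :> R by field.
    by rewrite ler_pXn2r ?nnegrE//; lra.
  rewrite rE => u2; nra.
lra.
Qed.

Lemma cusp_not_derivable (R : realType) (D : R -> R) (q K d : R) : 0 < q -> 0 < K ->
  (forall h, h != 0 -> D h <= D 0 - 2 * q * `|h| + K * h ^+ 2) -> ~ is_derive (0 : R) 1 D d.
Proof.
move=> q0 K0 hD /is_derive1_caratheodory[g [gE cg _]].
have /cvgrPdist_lt/(_ _ q0)[del /= d0 hd] := cg.
(* With h <= q / K the quadratic term absorbs at most half of the linear drop: the difference
   quotients at h and -h are at most -q and at least q, so they cannot both be within q of the
   derivative. *)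
pose h := Num.min (del / 2) (q / K).
have h0 : 0 < h by rewrite lt_min !divr_gt0.
have hdel : h < del by rewrite gt_min; apply/orP; left; rewrite ltr_pdivrMr// mulr_natr mulr2n ltrDl.
have hq : K * h <= q by rewrite mulrC -ler_pdivlMr// ge_min lexx orbT.
have nd z : `|z| = h -> `|g 0 - g z| < q by move=> zh; apply: hd; rewrite /= sub0r normrN zh.
have e1 := hD h ltac:(by rewrite gt_eqF).
have e2 := hD (- h) ltac:(by rewrite oppr_eq0 gt_eqF).
have := nd h (gtr0_norm h0); have := nd (- h) ltac:(by rewrite normrN gtr0_norm).
have E1 := gE h; have E2 := gE (- h); rewrite subr0 in E1; rewrite subr0 in E2.
rewrite normrN gtr0_norm// sqrrN in e2; rewrite gtr0_norm// in e1.
have kh : K * h ^+ 2 <= q * h by rewrite expr2 mulrA ler_pM2r.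
have f1 : g h <= - q.
  by rewrite -(ler_pM2r h0) -E1; lra.
have f2 : q <= g (- h).
  by rewrite -(ler_pM2r h0); lra.
by rewrite !ltr_norml => /andP[? _] /andP[_ ?]; lra.
Qed.

(** * The cusp of d^2 on the cut locus *)

Section cut_not_smooth.
Context {R : realType} (n m : nat) (U : 'I_m -> 'M[R]_(2 * n)) (s : 'I_(2 * n) -> R).
Hypothesis s_gt0 : forall i, 0 < s i.
Hypothesis s_le1 : forall i, s i <= 1.
Hypothesis s_max : exists i0, s i0 = 1.
Hypothesis U_skew : forall j, (U j)^T = - U j.
Hypothesis U_rel : forall lam lam' : 'rV[R]_m,
  - (Amat U lam *m Amat U lam' + Amat U lam' *m Amat U lam)
  = (2 * ip lam lam') *: wdiag s (fun u => u ^+ 2).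
Local Notation V := (@pt R n m).
Implicit Types (x : 'rV[R]_(2 * n)) (t : 'rV[R]_m).

Lemma radial_addZ x (T r h : R) i0 : s i0 = 1 -> x 0 i0 = 0 ->
  radial s (h *: unit_rv i0 + x) T r = radial s x T r + h ^+ 2 * scot r.
Proof.
move=> si xi; rewrite /radial -addrA; congr (_ + _).
rewrite (bigD1 i0)//= [in RHS](bigD1 i0)//= !mxE !eqxx/= si xi mul1r mulr1 addr0.
rewrite expr0n mul0r add0r addrC; congr (_ + _).
apply: eq_bigr => i ii0; rewrite !mxE (negbTE ii0) ?andbF mulr0 add0r//.
Qed.

(* A component h along i0 adds h^2 scot r to the radial function, and scot has a pole
   at pi: the maximum over r drops by an amount of order |h|. *)
Lemma ccdist_cusp x t i0 : ~ hasmax s x -> slope s x pi < 4 * enorm t -> s i0 = 1 ->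
  forall h : R, h != 0 ->
  ccdist U (h *: unit_rv i0 + x, t) ^+ 2 <=
    ccdist U (x, t) ^+ 2 - 2 * Num.sqrt (4 * enorm t - slope s x pi) * `|h| + 3 * h ^+ 2.
Proof.
move=> nm sT si h h0.
have xi : x 0 i0 = 0 by apply/eqP; apply: contraT => xi; exfalso; apply: nm; exists i0.
have nM : ~ inM s x t by case=> [//|]; rewrite ltNge => /negP; apply; exact: ltW.
rewrite (ccdist_cut s_gt0 s_le1 s_max U_skew U_rel nM).
have hM : inM s (h *: unit_rv i0 + x) t.
  by left; exists i0 => //; rewrite !mxE !eqxx/= xi addr0 mulr1.
have [r [[/andP[r0 rpi] _] _ _ hpi ->]] :=
  critical_radius s_gt0 s_le1 s_max U_skew U_rel (h *: unit_rv i0 + x) t.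
have {hpi}rpi : r < pi by rewrite lt_neqAle rpi andbT; apply/eqP => /hpi.
rewrite radial_addZ//.
have xpi := radial_dom_nomax s_le1 nm.
have [c /andP[rc cpi] e] := radial_MVT s_gt0 (enorm t) r0 rpi xpi.
have sc : slope s x c <= slope s x pi.
  by apply: slope_le => //; [exact: le_trans (ltW rc)|exact: ltW].
have u0 : 0 < pi - r by rewrite subr_gt0.
have c0 : 0 < 4 * enorm t - slope s x pi by rewrite subr_gt0.
(* Retreating from pi to r costs at least q^2 (pi - r) by the mean value theorem, and the pole of
   [scot] costs h^2 / (pi - r); the arithmetic-geometric mean inequality bounds their sum below by 2
   q |h| whatever r is. *)
set q := Num.sqrt _; have qq : q ^+ 2 = 4 * enorm t - slope s x pi by rewrite sqr_sqrtr// ltW.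
have sp := @scot_pole R r ltac:(by rewrite r0).
have h1 : h ^+ 2 * scot r <= h ^+ 2 * (3 - (pi - r)^-1) by rewrite ler_wpM2l ?sqr_ge0.
have h2 : q ^+ 2 * (pi - r) <= radial s x (enorm t) pi - radial s x (enorm t) r.
  by rewrite e ler_pM2r// qq lerB.
have h3 : 2 * q * `|h| <= q ^+ 2 * (pi - r) + h ^+ 2 * (pi - r)^-1.
  have e3 : (q ^+ 2 * (pi - r) + h ^+ 2 * (pi - r)^-1) * (pi - r) = (q * (pi - r)) ^+ 2 + h ^+ 2.
    by move: (pi - r) u0 => u u0; field; rewrite gt_eqF.
  rewrite -(ler_pM2r u0) e3 -[h ^+ 2]real_normK ?num_real//.
  by rewrite -subr_ge0; have := sqr_ge0 (q * (pi - r) - `|h|); rewrite !expr2; lra.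
lra.
Qed.

Lemma smooth_near_derivable (f : V -> R) y v : smooth_near f y -> derivable f y v.
Proof. by move=> [A [_ Ay /(_ 1%N)[_ /(_ v)[h _]]]]; exact: h. Qed.

Lemma cut_strict_not_smooth x t : ~ hasmax s x -> slope s x pi < 4 * enorm t ->
  ~ smooth_near (fun z : V => ccdist U z ^+ 2) (x, t).
Proof.
move=> nm sT sm; have [i0 si] := s_max.
have dv := @smooth_near_derivable _ _ ((unit_rv i0, 0) : V) sm.
have /is_derive_lineP := derivableP dv.
apply: (@cusp_not_derivable _ _ (Num.sqrt (4 * enorm t - slope s x pi)) 3) => //.
  by rewrite sqrtr_gt0 subr_gt0.
move=> h h0; have := ccdist_cusp nm sT si h0.
by rewrite scale0r add0r; congr (ccdist U (_, _) ^+ 2 <= _); rewrite /= scaler0 add0r.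
Qed.

(** Smoothness is an open condition, so at a boundary point it would extend to nearby points with
    the same x and larger |t|, contradicting the strict case. *)
Lemma cut_not_smooth x t : (0 < m)%N -> ~ inM s x t ->
  ~ smooth_near (fun z : V => ccdist U z ^+ 2) (x, t).
Proof.
move=> m0 /ninM[nm sT] sm.
move: sT; rewrite le_eqVlt => /predU1P[sT|sT]; last exact: cut_strict_not_smooth sm.
(* A direction in which |t| grows: t itself, or any unit vector when t = 0, which exists because m >
   0. *)
have [u u0 hu] : exists2 u : 'rV[R]_m, u != 0 &
    forall e : R, 0 < e -> enorm t < enorm (e *: u + t).
  have [->|t0] := eqVneq t 0.
    exists (unit_rv (Ordinal m0)); first by apply/eqP => /rowP/(_ (Ordinal m0)); rewrite !mxE !eqxx; apply/eqP; exact: oner_neq0.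
    move=> e e0; rewrite enorm0 addr0 enormZ mulr_gt0 ?normr_gt0 ?gt_eqF//.
    rewrite lt_neqAle enorm_ge0 andbT eq_sym enorm_eq0.
    by apply/eqP => /rowP/(_ (Ordinal m0)); rewrite !mxE !eqxx; apply/eqP; exact: oner_neq0.
  exists t => // e e0; rewrite -{3}[t]scale1r -scalerDl enormZ gtr0_norm ?addr_gt0//.
  by rewrite ltr_pMl ?ltrDr// lt_neqAle enorm_ge0 andbT eq_sym enorm_eq0.
have [A [oA Ay hA]] := sm.
have nA : nbhs ((x, t) : V) A by apply: open_nbhs_nbhs.
have cl : (fun e : R => (e *: ((0, u) : V) + (x, t))) @ (0 : R) --> ((x, t) : V).
  have : (fun e : R => (e *: ((0, u) : V) + (x, t))) @ (0 : R) --> (0 : R) *: ((0, u) : V) + (x, t).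
    by apply: cvgD; [apply: cvgZl; exact: cvg_id|exact: cvg_cst].
  by rewrite scale0r add0r.
have [del /= d0 hd] := cl _ nA.
have e0 : 0 < del / 2 by rewrite divr_gt0.
have Ae : A (x, (del / 2) *: u + t).
  have := hd (del / 2); rewrite /= sub0r normrN gtr0_norm// ltr_pdivrMr// mulr_natr mulr2n ltrDl.
  have -> : del / 2 *: ((0, u) : V) + (x, t) = (x, (del / 2) *: u + t).
    by congr (_, _); rewrite /= scaler0 add0r.
  exact.
apply: (@cut_strict_not_smooth x ((del / 2) *: u + t) nm); last by exists A.
by rewrite sT ltr_pM2l// hu.
Qed.

End cut_not_smooth.

(** * Block coordinates *)

Section blocks.
Context (n l : nat) (k : 'I_l.+1 -> nat).
Hypothesis k_gt0 : forall j, (0 < k j)%N.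
Hypothesis sum_k : (\sum_j k j = n)%N.

Let offset (p : nat) : nat := (2 * \sum_(j < l.+1 | j < p) k j)%N.

Let offset_le p p' : (p <= p')%N -> (offset p <= offset p')%N.
Proof.
move=> pp'; rewrite leq_mul2l/= [leqRHS](bigID (fun j : 'I_l.+1 => j < p)%N)/=.
apply: leq_trans (leq_addr _ _); rewrite leq_eqVlt; apply/orP; left; apply/eqP.
by apply: eq_bigl => j; case: (ltnP j p) => [/leq_trans/(_ pp')->|]; rewrite ?andbF.
Qed.

Let offset_last : offset l.+1 = (2 * n)%N.
Proof. by rewrite /offset -sum_k; congr (_ * _)%N; apply: eq_bigl => j; rewrite ltn_ord. Qed.

Let in_blockE (j : 'I_l.+1) (i : nat) : in_block k j i = (offset j <= i < offset j.+1)%N.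
Proof. by []. Qed.

(** The map b sends a coordinate to its block, so that s = a o b lists the diagonal of S. The last
    block is nonempty, which makes 1 an actual diagonal entry. *)
Lemma block_index_exists : exists b : 'I_(2 * n) -> 'I_l.+1,
  (forall j (i : 'I_(2 * n)), in_block k j i = (j == b i)) /\ exists i, b i = ord_max.
Proof.
have [b hb] : exists b : 'I_(2 * n) -> 'I_l.+1, forall i, in_block k (b i) i.
  suff /choice[b hb] : forall i : 'I_(2 * n), exists j : 'I_l.+1, in_block k j i by exists b.
  move=> i; have ex : exists p, (i < offset p.+1)%N by exists l; rewrite offset_last.
  case: (ex_minnP ex) => p ip hp.
  have pl : (p < l.+1)%N by rewrite ltnS; apply: hp; rewrite offset_last.
  exists (Ordinal pl); rewrite in_blockE/= ip andbT.
  case: p ip hp pl => [|p] ip hp pl; first by rewrite /offset big_pred0.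
  by rewrite leqNgt; apply/negP => /hp; rewrite ltnn.
have hb' j (i : 'I_(2 * n)) : in_block k j i = (j == b i).
  apply/idP/eqP => [|->//]; have := hb i.
  rewrite !in_blockE => /andP[h1 h2] /andP[h3 h4].
  apply: val_inj; case: (ltngtP j (b i)) => //= /offset_le.
  - by move/(leq_trans h4); rewrite ltnNge h1.
  - by move/(leq_trans h2); rewrite ltnNge h3.
exists b; split=> //.
have kl : (offset l + 2 * k ord_max = 2 * n)%N.
  rewrite /offset -mulnDr; congr (2 * _)%N; rewrite -sum_k [RHS](bigD1 ord_max)//= addnC.
  congr (_ + _)%N; apply: eq_bigl => j; rewrite -val_eqE/=.
  by have := ltn_ord j; rewrite ltnS leq_eqVlt ltn_neqAle; case: eqP => //= _ ->.
have n0 : (0 < 2 * n)%N by rewrite -kl addn_gt0 muln_gt0 k_gt0 orbT.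
have il : ((2 * n).-1 < 2 * n)%N by rewrite prednK.
exists (Ordinal il); apply/esym/eqP; rewrite -hb' in_blockE/= offset_last il andbT.
by rewrite -ltnS prednK// -kl -addn1 leq_add2l muln_gt0 k_gt0.
Qed.

End blocks.

Section block_sums.
Context {R : realType} (q l : nat) (k : 'I_l.+1 -> nat) (b : 'I_q -> 'I_l.+1).
Hypothesis bP : forall j (i : 'I_q), in_block k j i = (j == b i).
Implicit Types (x : 'rV[R]_q) (F : 'I_l.+1 -> R).

Lemma sum_bnorm2 x F : \sum_j bnorm2 k j x * F j = \sum_i x 0 i ^+ 2 * F (b i).
Proof.
rewrite [RHS](partition_big b xpredT)//=; apply: eq_bigr => j _.
rewrite /bnorm2 mulr_suml; apply: eq_big => [i|i]; first by rewrite bP eq_sym.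
by rewrite bP => /eqP ->.
Qed.

Lemma bnorm2_eq0 x j : reflect (forall i, b i = j -> x 0 i = 0) (bnorm2 k j x == 0).
Proof.
rewrite psumr_eq0 => [|i _]; last exact: sqr_ge0.
apply: (iffP allP) => h i.
  by move=> bi; have := h i (mem_index_enum i); rewrite bP bi eqxx sqrf_eq0 => /eqP.
by move=> _; rewrite bP; apply/implyP => /eqP bi; rewrite h// expr0n.
Qed.

Lemma sum_bnorm2_proper x F : bnorm2 k ord_max x = 0 ->
  \sum_(j < l.+1 | j != ord_max) bnorm2 k j x * F j = \sum_i x 0 i ^+ 2 * F (b i).
Proof. by move=> h; rewrite -sum_bnorm2 [RHS](bigD1 ord_max)//= h mul0r add0r. Qed.

End block_sums.

(** * The matrix U(theta) / sin U(theta) *)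

Section functional_calculus.
Context {R : realType} (q m : nat) (U : 'I_m -> 'M[R]_q) (s : 'I_q -> R).
Hypothesis s_gt0 : forall i, 0 < s i.
Hypothesis U_rel : forall lam lam' : 'rV[R]_m,
  - (Amat U lam *m Amat U lam' + Amat U lam' *m Amat U lam)
  = (2 * ip lam lam') *: wdiag s (fun u => u ^+ 2).

(** The choice in [mfun] is possible, [diag_mx (map_mx h w)] being one candidate, and it is
    determined because the basis vectors are eigenvectors of a diagonal matrix. *)
Lemma mfun_diag (h : R -> R) (w : 'rV[R]_q) (v : 'cV[R]_q) i :
  (Defs.mfun h (diag_mx w) *m v) i 0 = h (w 0 i) * v i 0.
Proof.
have : Defs.mfun h (diag_mx w) \in [set M : 'M[R]_q | forall (v : 'cV[R]_q) (lam : R),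
    diag_mx w *m v = lam *: v -> M *m v = h lam *: v].
  rewrite inE; apply: (@xgetPex _ 0 [set M : 'M[R]_q | forall (v : 'cV[R]_q) (lam : R),
    diag_mx w *m v = lam *: v -> M *m v = h lam *: v]).
  exists (diag_mx (map_mx h w)) => /= u lam /colP e; apply/colP => p.
  have := e p; rewrite !mul_diag_mx !mxE.
  have [->|up] := eqVneq (u p 0) 0; first by rewrite !mulr0.
  by move/(mulIf up) => ->.
rewrite inE/= => hM.
rewrite mxE (bigD1 i)//= big1 => [|p pi]; rewrite ?addr0.
  have -> : Defs.mfun h (diag_mx w) i i = (Defs.mfun h (diag_mx w) *m delta_mx i 0 : 'cV_q) i 0.
    by rewrite -colE mxE.
  rewrite (hM _ (w 0 i)) ?mxE ?eqxx ?mulr1//.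
  apply/colP => j; rewrite mul_diag_mx !mxE/= andbT.
  by case: eqP => [->|_]; rewrite ?mulr1 ?mulr0.
have -> : Defs.mfun h (diag_mx w) i p = (Defs.mfun h (diag_mx w) *m delta_mx p 0 : 'cV_q) i 0.
  by rewrite -colE mxE.
rewrite (hM _ (w 0 p)) ?mxE ?[i == p]eq_sym ?(negbTE pi)/= ?mulr0 ?mul0r//.
apply/colP => j; rewrite mul_diag_mx !mxE/= andbT.
by case: eqP => [->|_]; rewrite ?mulr1 ?mulr0.
Qed.

Lemma esq_UsinU (th : 'rV[R]_m) (x : 'rV[R]_q) :
  esq (UsinU U th *m x^T) = \sum_i x 0 i ^+ 2 * ssin (s i * enorm th) ^+ 2.
Proof.
rewrite /esq; apply: eq_bigr => i _; rewrite big_ord1.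
rewrite /UsinU (Amat_sqr U_rel) /wdiag -scaleNr opprK.
have -> : ip th th *: diag_mx (\row_i s i ^+ 2) = diag_mx (\row_i (s i * enorm th) ^+ 2).
  by apply/matrixP => p p'; rewrite !mxE -enorm2 exprMn mulrnAr mulrC.
rewrite mfun_diag !mxE sqrtr_sqr ger0_norm ?mulr_ge0 ?enorm_ge0 ?(ltW (s_gt0 _))//.
by rewrite exprMn mulrC.
Qed.

End functional_calculus.

(** * Translation between block sums and coordinate sums *)

Section block_coordinates.
Context {R : realType} (n m l : nat) (k : 'I_l.+1 -> nat) (a : 'I_l.+1 -> R)
  (b : 'I_(2 * n) -> 'I_l.+1).
Hypothesis bP : forall j (i : 'I_(2 * n)), in_block k j i = (j == b i).
Hypothesis a_gt0 : forall j, 0 < a j.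
Hypothesis a_lt1 : forall j, j != ord_max -> a j < 1.
Hypothesis a_max : a ord_max = 1.
Let s i : R := a (b i).
Implicit Types (x : 'rV[R]_(2 * n)) (t tau : 'rV[R]_m).

Lemma Smat_wdiag : (Smat k a : 'M[R]_(2 * n)) *m Smat k a = wdiag s (fun u => u ^+ 2).
Proof.
have -> : (Smat k a : 'M[R]_(2 * n)) = wdiag s id.
  apply/matrixP => i i'; rewrite !mxE; case: eqP => [_|]; rewrite ?mulr0n// mulr1n.
  by rewrite (eq_bigl (pred1 (b i))) ?big_pred1_eq// => j; rewrite bP.
by rewrite wdiagM.
Qed.

(** The value 1 is taken by [a] on the last block alone. *)
Lemma hasmax_bnorm2 x : hasmax s x <-> bnorm2 k ord_max x != 0.
Proof.
split=> [[i si xi]|].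
  apply: contraNN xi => /(bnorm2_eq0 bP) h; apply/eqP; apply: h.
  by apply/eqP; apply: contraT => /a_lt1; rewrite [a _]si ltxx.
move=> /(bnorm2_eq0 bP)/existsNP[i /not_implyP[bi /eqP xi]].
by exists i => //; rewrite /s bi.
Qed.

Lemma phi_coord x t : phi k a (x, t) = phis s x t :> ('rV[R]_m -> R).
Proof.
apply/funext => tau; rewrite /phi /phis/=; congr (_ + _).
exact: (sum_bnorm2 bP x (fun j => scot (a j * enorm tau))).
Qed.

Lemma radial_coord x (T r : R) :
  radial s x T r = 4 * T * r + \sum_j bnorm2 k j x * scot (a j * r).
Proof. by rewrite (sum_bnorm2 bP x (fun j => scot (a j * r))). Qed.

Lemma phi_bar_coord x t : phi_bar k a (x, t) = phis_bar s x t.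
Proof.
apply/funext => tau; rewrite /phi_bar /phis_bar phi_coord; case: ifP => // _.
case: (asboolP (hasmax s x)) => [/hasmax_bnorm2/negbTE ->//|h].
have [h0|/hasmax_bnorm2//] := eqVneq (bnorm2 k ord_max x) 0.
rewrite /=; congr (_ + _)%:E.
exact: (sum_bnorm2_proper bP (fun j => scot (a j * enorm tau)) h0).
Qed.

Lemma Nover_coord x (r : R) :
  \sum_j a j ^+ 2 * bnorm2 k j x * mu_over (a j * r) = Nover s x r.
Proof.
under eq_bigr do rewrite [_ ^+ 2 * _]mulrC -mulrA.
rewrite (sum_bnorm2 bP x (fun j => a j ^+ 2 * mu_over (a j * r))).
by apply: eq_bigr => i _; rewrite mulrA [_ * a _ ^+ 2]mulrC.
Qed.

Lemma slope_coord x (r : R) : bnorm2 k ord_max x = 0 ->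
  \sum_(j < l.+1 | j != ord_max) a j * bnorm2 k j x * mu (a j * r) = slope s x r.
Proof.
move=> h; under eq_bigr do rewrite [a _ * _]mulrC -mulrA.
exact: (sum_bnorm2_proper bP (fun j => a j * mu (a j * r)) h).
Qed.

Lemma inM_coord x t : inM s x t <-> bnorm2 k ord_max x != 0 \/
  (bnorm2 k ord_max x = 0 /\
   4 * enorm t < \sum_(j < l.+1 | j != ord_max) a j * bnorm2 k j x * mu (a j * pi)).
Proof.
have [h0|h0] := eqVneq (bnorm2 k ord_max x) 0; last first.
  by split=> _; left => //; apply/hasmax_bnorm2.
rewrite slope_coord// /inM hasmax_bnorm2 h0 eqxx; split=> -[]//; first by right.
by case=> _; right.
Qed.

Lemma ninM_coord x t : ~ inM s x t <-> bnorm2 k ord_max x = 0 /\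
   \sum_(j < l.+1 | j != ord_max) a j * bnorm2 k j x * mu (a j * pi) <= 4 * enorm t.
Proof.
rewrite inM_coord; split=> [h|[h0 h] [|[_]]]; last 2 first.
- by rewrite h0 eqxx.
- by rewrite ltNge h.
have h0 : bnorm2 k ord_max x = 0 by apply/eqP; apply: contraT => h0; exfalso; apply: h; left.
by split=> //; rewrite leNgt; apply/negP => lt; apply: h; right.
Qed.

Lemma radial_cut_coord x (T : R) : bnorm2 k ord_max x = 0 ->
  radial s x T pi = pi * (4 * T + \sum_(j < l.+1 | j != ord_max)
    a j * bnorm2 k j x * (cos (a j * pi) / sin (a j * pi))).
Proof.
move=> h; rewrite mulrDr /radial [_ * pi]mulrC; congr (_ + _).
rewrite -(sum_bnorm2_proper bP (fun j => scot (a j * pi)) h) mulr_sumr.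
apply: eq_bigr => j _; rewrite /scot gt_eqF ?mulr_gt0 ?pi_gt0//.
by ring.
Qed.

End block_coordinates.

Theorem theorem8p1 (R : realType) (n m l : nat) (k : 'I_l.+1 -> nat)
    (a : 'I_l.+1 -> R) (U : 'I_m -> 'M[R]_(2 * n)) :
  (0 < m)%N -> GHtype k a U ->
  (* (1) *)
  (Mset k a = [set g : pt n m | bnorm2 k ord_max g.1 != 0
       \/ (bnorm2 k ord_max g.1 = 0 /\
           4 * enorm g.2 < \sum_(j < l.+1 | j != ord_max)
                              a j * bnorm2 k j g.1 * mu (a j * pi))]
   /\ forall g : pt n m, Mset k a g ->
      (exists! theta : 'rV[R]_m, enorm theta < pi /\
         (4 : R) *: g.2 = (\sum_j a j ^+ 2 * bnorm2 k j g.1 * mu_over (a j * enorm theta))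
                          *: theta)
      /\ forall theta : 'rV[R]_m, enorm theta < pi ->
         (4 : R) *: g.2 = (\sum_j a j ^+ 2 * bnorm2 k j g.1 * mu_over (a j * enorm theta))
                          *: theta ->
         [/\ ccdist U g ^+ 2 = 4 * enorm g.2 * enorm theta
                               + \sum_j bnorm2 k j g.1 * scot (a j * enorm theta),
             ccdist U g ^+ 2 = \sum_j bnorm2 k j g.1 * ssin (a j * enorm theta) ^+ 2 &
             ccdist U g ^+ 2 = esq (UsinU U theta *m g.1^T)])
  (* (2) *)
  /\ (Cut U = ~` Mset k a
      /\ Cut U = [set g : pt n m | bnorm2 k ord_max g.1 = 0 /\
           \sum_(j < l.+1 | j != ord_max) a j * bnorm2 k j g.1 * mu (a j * pi)
             <= 4 * enorm g.2]
      /\ forall g : pt n m, (~` Mset k a) g ->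
           ccdist U g ^+ 2 = pi * (4 * enorm g.2
             + \sum_(j < l.+1 | j != ord_max)
                 a j * bnorm2 k j g.1 * (cos (a j * pi) / sin (a j * pi))))
  (* (3) *)
  /\ (forall g : pt n m, g != (0, 0) ->
      exists! theta : 'rV[R]_m, enorm theta <= pi /\
        ((ccdist U g ^+ 2)%:E = phi_bar k a g theta /\
         phi_bar k a g theta
           = ereal_sup [set (phi k a g tau)%:E | tau in [set tau : 'rV[R]_m | enorm tau < pi]])).
Proof.
move=> m0 [[k0 sum_k] [a0 a_incr a_max] U_skew _ U_relS].
have [b [bP [imax bmax]]] := block_index_exists k0 sum_k.
have a_gt0 j : 0 < a j.
  have [->//|j0] := eqVneq j ord0.
  by apply: lt_trans a0 (a_incr _ _ _); rewrite lt0n.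
have a_lt1 j : j != ord_max -> a j < 1.
  move=> jm; rewrite -a_max; apply: a_incr.
  by rewrite /= ltn_neqAle -[_ == _]/(j == ord_max) jm -ltnS ltn_ord.
pose s (i : 'I_(2 * n)) : R := a (b i).
have s_gt0 i : 0 < s i by exact: a_gt0.
have s_le1 i : s i <= 1.
  by rewrite /s; have [->|/a_lt1/ltW//] := eqVneq (b i) ord_max; rewrite a_max.
have s_max : exists i0, s i0 = 1 by exists imax; rewrite /s bmax.
have U_rel (lam lam' : 'rV[R]_m) : - (Amat U lam *m Amat U lam' + Amat U lam' *m Amat U lam)
    = (2 * ip lam lam') *: wdiag s (fun u => u ^+ 2).
  by rewrite U_relS (Smat_wdiag a bP).
have MsetE : Mset k a = [set g : pt n m | inM s g.1 g.2].
  apply/seteqP; split=> [[x t]|[x t]] /=.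
    by move=> h; apply/(inM_critP s_gt0 s_le1 _ _ m0); rewrite -(phi_coord a bP).
  move/(inM_critP s_gt0 s_le1 _ _ m0); by rewrite -(phi_coord a bP).
have CutE : Cut U = ~` Mset k a.
  rewrite MsetE; apply/seteqP; split=> [[x t]|[x t]] /= h.
    by move=> My; apply: h; exact: (smooth_near_Mreg s_gt0 s_le1 s_max U_skew U_rel).
  exact: (cut_not_smooth s_gt0 s_le1 s_max U_skew U_rel).
have NE (x : 'rV[R]_(2 * n)) r := Nover_coord a bP x r.
split; [split|split; [split=> //; split|]].
- rewrite MsetE; apply/seteqP; split=> [[x t]|[x t]] /=.
    by move/(inM_coord bP a_lt1 a_max).
  by move=> h; apply/(inM_coord bP a_lt1 a_max).
- rewrite MsetE => -[x t] /= h; have x0 := inM_neq0 h.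
  split.
    have [th thpi e] := inM_theta s_gt0 s_le1 h.
    exists th; split; first by rewrite NE.
    by move=> th' []; rewrite NE => thpi'; exact: theta_unique e.
  move=> th thpi; rewrite NE => e.
  have sl := theta_slope s_gt0 s_le1 e x0 thpi.
  rewrite (ccdist_theta s_gt0 s_le1 s_max U_skew U_rel thpi e).
  have th0 : 0 <= enorm th < pi by rewrite enorm_ge0 thpi.
  split; first exact: (radial_coord a bP).
    rewrite (radial_ssin s_gt0 s_le1 th0 sl).
    by rewrite (sum_bnorm2 bP x (fun j => ssin (a j * enorm th) ^+ 2)).
  by rewrite (radial_ssin s_gt0 s_le1 th0 sl) (esq_UsinU s_gt0 U_rel).
- rewrite CutE MsetE; apply/seteqP; split=> [[x t]|[x t]] /=.
    by move/(ninM_coord bP a_lt1 a_max).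
  by move=> h; apply/(ninM_coord bP a_lt1 a_max).
- rewrite MsetE => -[x t] /= h.
  have [h0 _] := (ninM_coord bP a_lt1 a_max x t).1 h.
  rewrite (ccdist_cut s_gt0 s_le1 s_max U_skew U_rel h).
  by rewrite (radial_cut_coord bP a_gt0).
- move=> [x t] g0; rewrite (phi_bar_coord bP a_lt1 a_max) (phi_coord a bP).
  exact: (phis_sup s_gt0 s_le1 s_max U_skew U_rel g0).
Qed.
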